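(* Let $V_1,V_2,V_3$ be irreducible, admissible, infinite-dimensional representations of $G=\mathrm{GL}_2(F)$ with central characters $\omega_1,\omega_2,\omega_3$ satisfying $\omega_1\omega_2\omega_3=1$. Suppose that $V_1$ and $V_2$ are unramified and that $V_3$ has conductor $n_3$. For $i=1,2,3$ let $v_i$ be a new vector of $V_i$, and put $v_1^*=\gamma^{n_3}\cdot v_1$. Then $v_1^*\otimes v_2\otimes v_3$ is a test vector, i.e. $\ell(v_1^*\otimes v_2\otimes v_3)\neq 0$ for every non-zero $G$-invariant linear form $\ell$ on $V_1\otimes V_2\otimes V_3$.
   Context: $F$ is a finite extension of $\mathbb{Q}_p$ with ring of integers $\mathcal{O}$ and uniformizer $\pi$; $G=\mathrm{GL}_2(F)$, $K=\mathrm{GL}_2(\mathcal{O})$, $\gamma=\begin{pmatrix}\pi^{-1}&0\\0&1\end{pmatrix}$. For $n\ge 1$, $I_n=\begin{pmatrix}\mathcal{O}^\times&\mathcal{O}\\ \pi^n\mathcal{O}&\mathcal{O}^\times\end{pmatrix}$, and $I_0=K$. Let $V$ be an irreducible, admissible, infinite-dimensional (complex) representation of $G$ with central character $\omega$. Put $V^{I_0,\omega}=V^K$ and, for $n\ge1$, $V^{I_n,\omega}=\{v\in V: \begin{pmatrix}a&b\\c&d\end{pmatrix}\cdot v=\omega(d)v \text{ for all } \begin{pmatrix}a&b\\c&d\end{pmatrix}\in I_n\}$. The conductor of $V$ is the minimal $n\ge 0$ such that $V^{I_n,\omega}\neq 0$; for this $n$ the space is one-dimensional and any non-zero vector in it is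 called a new vector of $V$. $V$ is unramified if its conductor is $0$. It is a known theorem of Prasad that the space of $G$-invariant linear forms on $V_1\otimes V_2\otimes V_3$ (diagonal action) has dimension at most one, and that it is one-dimensional when $V_1$ and $V_2$ are principal series (in particular in the situation of the claim). Given a non-zero such form $\ell$, a test vector is a vector not in the kernel of $\ell$. *)

(* Defs.v *)
From HB Require Import structures.
From mathcomp Require Import all_boot all_order all_algebra all_field.
From mathcomp Require Import complex.
From mathcomp Require Import boolp classical_sets reals.
Set Implicit Arguments.
Unset Strict Implicit.
Unset Printing Implicit Defensive.
Import Order.TTheory GRing.Theory Num.Theory.
Local Open Scope ring_scope.

Definition padic_norm (p : nat) (q : rat) : rat :=
  if q == 0 then 0
  else p%:R ^ ((logn p `|denq q|%N)%:Z - (logn p `|numq q|%N)%:Z).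

(* (Qp, absp) is the field of p-adic numbers with its absolute value, that is,
   the completion of rat for padic_norm p.  The values lie in p^Z together
   with 0, so a rational-valued absolute value is enough. *)
Record is_padic_field (p : nat) (Qp : fieldType) (absp : Qp -> rat) : Prop := {
  absp_ge0 : forall x, 0 <= absp x;
  absp_eq0 : forall x, absp x = 0 <-> x = 0;
  abspM : forall x y, absp (x * y) = absp x * absp y;
  abspD : forall x y, absp (x + y) <= Num.max (absp x) (absp y);
  absp_ratr : forall q : rat, absp (ratr q) = padic_norm p q;
  absp_dense : forall x (e : rat), 0 < e -> exists q : rat, absp (x - ratr q) < e;
  absp_complete : forall u : nat -> Qp,
    (forall e : rat, 0 < e -> exists N : nat, forall m n : nat,
       (N <= m)%N -> (N <= n)%N -> absp (u m - u n) < e) ->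
    exists l : Qp, forall e : rat, 0 < e -> exists N : nat, forall n : nat,
       (N <= n)%N -> absp (u n - l) < e }.

Section Local.
Context (Qp : fieldType) (absp : Qp -> rat) (F : fieldExtType Qp) (pi : F).

(* The integral closure in F of Z_p = {absp <= 1}. *)
Definition ringO : set F := [set x | exists q : {poly Qp},
  [/\ q \is monic, forall i, absp q`_i <= 1 & root (map_poly (in_alg F) q) x]].

Definition unitO : set F := [set x | [/\ x != 0, ringO x & ringO x^-1]].

Definition piO (n : nat) : set F :=
  [set x | exists2 y, ringO y & x = pi ^+ n * y].

(* The non-units of the local ring O form its maximal ideal. *)
Definition uniformizer : Prop :=
  forall x, (ringO x /\ ~ unitO x) <-> piO 1 x.

Definition GL2 : set 'M[F]_2 := [set g : 'M[F]_2 | g \in unitmx].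

Definition gamma : 'M[F]_2 := \matrix_(i, j)
  (if i == j then if i == 0 then pi^-1 else 1 else 0).

Definition maxK : set 'M[F]_2 :=
  [set g : 'M[F]_2 | (forall i j, ringO (g i j)) /\ unitO (\det g)].

Definition congI (n : nat) : set 'M[F]_2 :=
  if n is 0 then maxK
  else [set g : 'M[F]_2 | [/\ unitO (g 0 0), ringO (g 0 1), piO n (g 1 0)
                  & unitO (g 1 1)]].

(* The topology of F has the cosets of the pi^m O as a basis, and GL2 has the
   topology induced by that of the 2 x 2 matrices, in which it is open. *)
Definition open_mx (U : set 'M[F]_2) : Prop :=
  forall g, U g -> exists m : nat, forall h : 'M[F]_2,
    (forall i j, piO m (h i j - g i j)) -> U h.

Record open_subgroup (H : set 'M[F]_2) : Prop := {
  open_subgroup_sub : (H `<=` GL2)%classic;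
  open_subgroup1 : H 1%:M;
  open_subgroupM : forall g h, H g -> H h -> H (g *m h);
  open_subgroupV : forall g, H g -> H (invmx g);
  open_subgroup_open : open_mx H }.

End Local.

(* Representations of GL2(F) on C-vector spaces.  The action is a total function
   on matrices; nothing below uses its value at a singular matrix. *)
Record rep (F : fieldType) (C : fieldType) := Rep {
  rep_space :> lmodType C;
  act : 'M[F]_2 -> {linear rep_space -> rep_space};
  act1 : forall v, act 1%:M v = v;
  actM : forall g h, g \in unitmx -> h \in unitmx ->
    forall v, act (g *m h) v = act g (act h v) }.

Definition finite_dim (C : fieldType) (V : lmodType C) (W : set V) : Prop :=
  exists (n : nat) (e : 'I_n -> V), forall w, W w ->
    exists c : 'I_n -> C, w = \sum_i c i *: e i.

Section AbstractRepresentations.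
Context (F C : fieldType).
Implicit Type V : rep F C.

Definition irreducible_rep V : Prop :=
  (exists v : V, v != 0) /\
  forall W : {pred V}, submod_closed W ->
    (forall g, g \in unitmx -> {in W, forall v, act V g v \in W}) ->
    {in W, forall v, v = 0} \/ (forall v, v \in W).

Definition infinite_dim V : Prop := ~ finite_dim [set: V].

(* Only the values of w on non-zero elements matter. *)
Definition central_character V (w : F -> C) : Prop :=
  forall z, z != 0 -> forall v, act V z%:M v = w z *: v.

End AbstractRepresentations.

Section Representations.
Context (Qp : fieldType) (absp : Qp -> rat) (F : fieldExtType Qp) (pi : F).
Context (C : fieldType).
Implicit Type V : rep F C.

Definition smooth V : Prop :=
  forall v : V, open_mx absp pi [set g : 'M[F]_2 | g \in unitmx /\ act V g v = v].

Definition admissible V : Prop :=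
  smooth V /\
  forall H, open_subgroup absp pi H ->
    finite_dim [set v : V | forall g, H g -> act V g v = v].

Definition fixI V (w : F -> C) (n : nat) : set V :=
  if n is 0 then [set v | forall g, maxK absp g -> act V g v = v]
  else [set v | forall g, congI absp pi n g -> act V g v = w (g 1 1) *: v].

Definition conductor V (w : F -> C) (n : nat) : Prop :=
  (exists2 v : V, fixI w n v & v != 0) /\
  forall m, (exists2 v : V, fixI w m v & v != 0) -> (n <= m)%N.

Definition unramified V (w : F -> C) : Prop := conductor V w 0.

Definition new_vector V (w : F -> C) (v : V) : Prop :=
  exists n, [/\ conductor V w n, fixI w n v & v != 0].

End Representations.

Section Tensor.
Context (F C : fieldType).

Definition trilinear (V1 V2 V3 W : lmodType C) (f : V1 -> V2 -> V3 -> W) : Prop :=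
  [/\ forall y z, linear (fun x => f x y z),
      forall x z, linear (fun y => f x y z)
    & forall x y, linear (fun z => f x y z)].

(* A tensor product V1 (x) V2 (x) V3, given by its universal property. *)
Record tensor3 (V1 V2 V3 : lmodType C) := Tensor3 {
  tensor_space :> lmodType C;
  tens : V1 -> V2 -> V3 -> tensor_space;
  tens_trilinear : trilinear tens;
  tens_universal : forall (W : lmodType C) (f : V1 -> V2 -> V3 -> W),
    trilinear f ->
    exists h : {linear tensor_space -> W},
      (forall x y z, h (tens x y z) = f x y z) /\
      forall h' : {linear tensor_space -> W},
        (forall x y z, h' (tens x y z) = f x y z) -> h' =1 h }.

Lemma tens_ext (V1 V2 V3 : lmodType C) (T : tensor3 V1 V2 V3) (W : lmodType C)
    (h h' : {linear T -> W}) :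
  (forall x y z, h (tens T x y z) = h' (tens T x y z)) -> h =1 h'.
Proof.
move=> hh'; have [t1 t2 t3] := tens_trilinear T.
have tri : trilinear (fun x y z => h' (tens T x y z)).
  by split=> [y z|x z|x y] a u v; rewrite (t1, t2, t3) linearP.
have [k [_ ku]] := tens_universal T tri.
by move=> x; rewrite (ku h) // (ku h').
Qed.

Context (V1 V2 V3 : rep F C) (T : tensor3 V1 V2 V3).

Lemma tens_act_trilinear (g : 'M[F]_2) :
  trilinear (fun x y z => tens T (act V1 g x) (act V2 g y) (act V3 g z)).
Proof.
have [t1 t2 t3] := tens_trilinear T.
by split=> [y z|x z|x y] a u v; rewrite linearP (t1, t2, t3).
Qed.

Definition tens_act (g : 'M[F]_2) : {linear T -> T} :=
  projT1 (cid (tens_universal T (tens_act_trilinear g))).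

Lemma tens_actE g x y z :
  tens_act g (tens T x y z) = tens T (act V1 g x) (act V2 g y) (act V3 g z).
Proof. by rewrite /tens_act; case: cid => h []. Qed.

Lemma tens_act1 v : tens_act 1%:M v = v.
Proof.
apply: (@tens_ext _ _ _ T T (tens_act 1%:M) idfun) => x y z /=.
by rewrite tens_actE !act1.
Qed.

Lemma tens_actM g h : g \in unitmx -> h \in unitmx ->
  forall v, tens_act (g *m h) v = tens_act g (tens_act h v).
Proof.
move=> ug uh.
apply: (@tens_ext _ _ _ T T (tens_act (g *m h)) (tens_act g \o tens_act h)).
by move=> x y z /=; rewrite !tens_actE !actM.
Qed.

Definition tensor_rep : rep F C := Rep tens_act1 tens_actM.

End Tensor.

Definition invariant_form (F C : fieldType) (V : rep F C) (l : {linear V -> C^o}) :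
  Prop := forall g, g \in unitmx -> forall v, l (act V g v) = l v.

(* Main.v *)
(* Let L be the trilinear form and let l_m(z) = L(gamma^m v1, v2, z), an I_m-invariant
   functional on V3. Since v1 and v2 generate V1 and V2, the Cartan decomposition shows that
   L = 0 as soon as every l_m vanishes. For m < n3 this holds because V3 has no non-zero
   I_m-fixed vector. For m = n3 the I_m-fixed vectors are the multiples of v3, so that
   l_m = 0 if the test value l_m(v3) is zero. For m > n3, by induction, the Hecke relations
   satisfied by v1 and v2 make the traces of l_m to I_(m-1) and to its conjugate by the
   Atkin-Lehner element of I_m vanish, while the corresponding traces of v3 vanish by the
   minimality of n3. A function on I_m \ G / I_n3 with these four properties is zero when
   m > n3: after permuting the entries of the matrix by the normalizers, an entry of minimal
   weight is used as a pivot. Hence l_m(g v3) = 0 for all g, and V3 is generated by v3.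

   The uniqueness of the new vector follows from the same reduction at m = n3: applied to the
   difference of a matrix coefficient and its twisted transpose, it shows that the latter are
   equal, and then the Hecke algebra acts on the I_n3-fixed vectors through commuting
   operators. *)

Require Import Defs.
From HB Require Import structures.
From mathcomp Require Import all_boot all_order all_algebra all_field.
From mathcomp Require Import complex.
From mathcomp Require Import boolp classical_sets reals.
From mathcomp Require Import zify ring.
Set Implicit Arguments.
Unset Strict Implicit.
Unset Printing Implicit Defensive.
Import Order.TTheory GRing.Theory Num.Theory.
Local Open Scope ring_scope.

(** * Valuations *)

(** The power [gamma^m] enters because [I_m] is the intersection of [K], which fixes [v2], with
    [gamma^m K gamma^-m], which fixes [gamma^m v1]. Two traces are needed on each side since [I_m]
    lies in two larger groups of the same kind, exchanged by its Atkin-Lehner element; that element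
    also exchanges the roles of [V1] and [V2], which is why the Hecke relations of both vectors
    occur. For [m > n] the traces kill every double coset. For [m = n] they cannot, as the
    coefficients of the new vector are functions of exactly this kind; but what the pivot then
    leaves over, diagonal matrices and matrices with [v c = v b + n], is stable up to units under
    the twisted transpose, so that antisymmetric functions still vanish there. The argument compares
    only valuations of matrix entries. It is therefore carried out over a field with an abstract
    discrete valuation and a finite set of residues; both are constructed at the end for a finite
    extension of the p-adic numbers, starting from the bare description of the non-units as the
    multiples of [pi]. *)

Section Valuation.
Context (F : fieldType) (v : F -> int).

(** Membership in [pi^k O]. Zero is treated apart because [v] has integer values, so that [v 0]
    carries no information. *)
Definition vge (k : int) (x : F) : bool := (x == 0) || (k <= v x).

Definition vunit (x : F) : bool := (x != 0) && (v x == 0).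

Record valuation_at (pi : F) : Prop := {
  val_pi_neq0 : pi != 0;
  val_pi : v pi = 1;
  valM : forall x y, x != 0 -> y != 0 -> v (x * y) = v x + v y;
  valD_or : forall x y, x != 0 -> y != 0 -> x + y != 0 ->
    (v x <= v (x + y)) || (v y <= v (x + y)) }.

Context (pi : F) (Hv : valuation_at pi).

Let pi0 : pi != 0 := val_pi_neq0 Hv.

Lemma val1 : v 1 = 0.
Proof. by apply: (addrI (v 1)); rewrite -(valM Hv) ?oner_neq0 // mulr1 addr0. Qed.

Lemma valV x : x != 0 -> v x^-1 = - v x.
Proof.
move=> x0; apply: (addrI (v x)).
by rewrite -(valM Hv) ?invr_neq0 // mulfV // val1 subrr.
Qed.

Lemma valN x : v (- x) = v x.
Proof.
have [->|x0] := eqVneq x 0; first by rewrite oppr0.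
have N10 : -1 != 0 :> F by rewrite oppr_eq0 oner_neq0.
rewrite -mulN1r (valM Hv) //.
by have := valM Hv N10 N10; rewrite mulrNN mulr1 val1; lia.
Qed.

Lemma val_piX k : v (pi ^+ k) = k%:Z.
Proof.
elim: k => [|k IH]; first by rewrite expr0 val1.
by rewrite exprS (valM Hv) ?expf_neq0 // IH (val_pi Hv); lia.
Qed.

Lemma vge0 k : vge k 0. Proof. by rewrite /vge eqxx. Qed.

Lemma vge_val x : vge (v x) x. Proof. by rewrite /vge lexx orbT. Qed.

Lemma vge_le j k x : k <= j -> vge j x -> vge k x.
Proof. by move=> kj /orP[/eqP->|jx]; rewrite /vge ?eqxx // (le_trans kj) ?orbT. Qed.

Lemma vgeE k x : x != 0 -> vge k x = (k <= v x).
Proof. by rewrite /vge => /negPf->. Qed.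

Lemma vgeN k x : vge k (- x) = vge k x.
Proof. by rewrite /vge oppr_eq0 valN. Qed.

Lemma vgeD k x y : vge k x -> vge k y -> vge k (x + y).
Proof.
move=> kx ky; rewrite /vge; have [//|xy0] := eqVneq (x + y) 0.
have [x0|x0] := eqVneq x 0; first by move: ky xy0; rewrite x0 add0r => h /vgeE <-.
have [y0|y0] := eqVneq y 0; first by move: kx xy0; rewrite y0 addr0 => h /vgeE <-.
move: kx ky; rewrite !vgeE // => kx ky.
by case/orP: (valD_or Hv x0 y0 xy0); apply: le_trans.
Qed.

Lemma vgeB k x y : vge k x -> vge k y -> vge k (x - y).
Proof. by move=> kx ky; rewrite vgeD // vgeN. Qed.

Lemma vgeM j k x y : vge j x -> vge k y -> vge (j + k) (x * y).
Proof.
have [->|x0] := eqVneq x 0; first by rewrite mul0r !vge0.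
have [->|y0] := eqVneq y 0; first by rewrite mulr0 !vge0.
by rewrite !vgeE ?mulf_neq0 // (valM Hv) // => jx ky; rewrite lerD.
Qed.

Lemma vge_div k x y : y != 0 -> vge k x -> vge (k - v y) (x / y).
Proof.
move=> y0 kx; rewrite -[- v y]valV //; apply: vgeM => //.
exact: vge_val.
Qed.

Lemma vge1 : vge 0 1. Proof. by rewrite /vge val1 lexx orbT. Qed.

Lemma vge_pi : vge 1 pi. Proof. by rewrite vgeE // (val_pi Hv). Qed.

Lemma vge_piV : vge (-1) pi^-1.
Proof. by rewrite vgeE ?invr_neq0 // valV // (val_pi Hv). Qed.

Lemma vge_piX k : vge k%:Z (pi ^+ k).
Proof. by rewrite vgeE ?expf_neq0 // val_piX. Qed.

(** The isosceles principle: if [x + y] had a larger valuation than [x], subtracting [y] again would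
    raise that of [x]. *)
Lemma vge_valD x y : x != 0 -> vge (v x + 1) y -> x + y != 0 /\ v (x + y) = v x.
Proof.
move=> x0 yx; have xy0 : x + y != 0.
  apply/negP => /eqP xy; move: yx; have -> : y = - x.
    by apply/eqP; rewrite eq_sym -subr_eq0 -opprD oppr_eq0 addrC addrC xy.
  by rewrite vgeN vgeE //; lia.
split=> //.
have h1 : vge (v x) (x + y).
  by apply: vgeD; [exact: vge_val | apply: vge_le yx; lia].
have [/eqP ey|y0] := boolP (y == 0); first by rewrite ey addr0.
move: h1; rewrite vgeE // => h1.
apply/eqP; rewrite eq_le h1 andbT; apply/negP => /negP; rewrite -ltNge => h2.
have : vge (v x + 1) (x + y - y).
  by apply: vgeB => //; rewrite vgeE //; lia.
by rewrite addrK vgeE //; lia.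
Qed.

Lemma vunit1D x : vge 1 x -> vunit (1 + x).
Proof.
move=> x1; have := @vge_valD 1 x (oner_neq0 F).
by rewrite val1 add0r => /(_ x1)[h1 h2]; rewrite /vunit h1 h2.
Qed.

Lemma vunit_neq0 x : vunit x -> x != 0. Proof. by case/andP. Qed.

Lemma vunit_val x : vunit x -> v x = 0. Proof. by case/andP=> _ /eqP. Qed.

Lemma vunit_vge x : vunit x -> vge 0 x.
Proof. by case/andP=> x0 /eqP vx; rewrite vgeE // vx. Qed.

Lemma vunit1 : vunit 1. Proof. by rewrite /vunit oner_neq0 val1. Qed.

Lemma vunitV x : vunit x -> vunit x^-1.
Proof. by case/andP=> x0 /eqP vx; rewrite /vunit invr_neq0 // valV // vx. Qed.

Lemma vunitM x y : vunit x -> vunit y -> vunit (x * y).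
Proof.
by move=> /andP[x0 /eqP vx] /andP[y0 /eqP vy];
  rewrite /vunit mulf_neq0 // (valM Hv) // vx vy.
Qed.

Lemma vunit_div x y : x != 0 -> y != 0 -> v x = v y -> vunit (x / y).
Proof.
by move=> x0 y0 xy; rewrite /vunit mulf_neq0 ?invr_neq0 // (valM Hv) ?invr_neq0 //
  valV // xy subrr.
Qed.

Lemma vunitE x : vge 0 x -> ~~ vge 1 x -> vunit x.
Proof. by rewrite /vge /vunit; case: eqP => //= _; lia. Qed.

End Valuation.

(** * Functions on double cosets of Iwahori-type groups *)

(** This is how a trace relation kills a value: in characteristic 0 a sum of zeros and of at least
    one copy of [x] is a positive multiple of [x]. *)
Lemma sum_0_or_eq (C : numFieldType) (W : lmodType C) (I : eqType) (r : seq I)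
    (X : I -> W) (x : W) i0 :
  (forall i, i \in r -> X i = 0 \/ X i = x) -> i0 \in r -> X i0 = x ->
  \sum_(i <- r) X i = 0 -> x = 0.
Proof.
move=> Xr ri0 Xi0; have -> : \sum_(i <- r) X i = x *+ count (fun i => X i == x) r.
  elim: r Xr {ri0} => [|i r IH] Xr /=; first by rewrite big_nil.
  rewrite big_cons IH => [|j jr]; last by apply: Xr; rewrite in_cons jr orbT.
  have [->|->] := Xr i (mem_head _ _); last by rewrite eqxx mulrnDr.
  by have [<-|] := eqVneq 0 x; rewrite ?mul0rn ?add0n add0r.
move/eqP; rewrite -scaler_nat scaler_eq0 pnatr_eq0 => /orP[|/eqP//].
rewrite -leqn0 leqNgt -has_count => /negP[].
by apply/hasP; exists i0; rewrite ?Xi0.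
Qed.

Definition residues (F : fieldType) (v : F -> int) (R : seq F) : Prop :=
  [/\ uniq R, {in R, forall t, vge v 0 t},
      forall x, vge v 0 x -> exists2 t, t \in R & vge v 1 (x - t)
    & {in R &, forall s t, vge v 1 (s - t) -> s = t}].

Section DoubleCosets.
Context (F : fieldType) (v : F -> int) (pi : F) (Hv : valuation_at v pi).
Context (R : seq F) (HR : residues v R).
Context (C : numFieldType) (W : lmodType C).
Implicit Types (f : F -> F -> F -> F -> W) (m n : nat) (a b c d x y z t : F).

(* [f a b c d] stands for the value at the matrix [[a, b], [c, d]], which only matters when
   [a * d - b * c != 0]; [biinv m n] is left [I_m]- and right [I_n]-invariance, tested on
   generators. *)
Record biinv m n f : Prop := {
  bi_s : forall r1 r2 s1 s2 a b c d, vunit v r1 -> vunit v r2 ->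
    vunit v s1 -> vunit v s2 -> a * d - b * c != 0 ->
    f (r1 * a * s1) (r1 * b * s2) (r2 * c * s1) (r2 * d * s2) = f a b c d;
  bi_r1 : forall x a b c d, vge v 0 x -> a * d - b * c != 0 ->
    f (a + x * c) (b + x * d) c d = f a b c d;
  bi_r2 : forall x a b c d, vge v m%:Z x -> a * d - b * c != 0 ->
    f a b (c + x * a) (d + x * b) = f a b c d;
  bi_c1 : forall x a b c d, vge v n%:Z x -> a * d - b * c != 0 ->
    f (a + x * b) b (c + x * d) d = f a b c d;
  bi_c2 : forall x a b c d, vge v 0 x -> a * d - b * c != 0 ->
    f a (b + x * a) c (d + x * c) = f a b c d }.

(* The sums run over representatives of [I_(m-1) / I_m] ([R] represents the residue field)
   and of its conjugate by [[0, 1], [pi^m, 0]]; the case [m = 1] has the extra coset of the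
   Weyl element. *)
Record ltrace m f : Prop := {
  lt_l : (1 < m)%N -> forall a b c d, a * d - b * c != 0 ->
    \sum_(t <- R) f a b (c + pi ^+ m.-1 * t * a) (d + pi ^+ m.-1 * t * b) = 0;
  lt_u : (1 < m)%N -> forall a b c d, a * d - b * c != 0 ->
    \sum_(t <- R) f (a + pi^-1 * t * c) (b + pi^-1 * t * d) c d = 0;
  lt_l1 : m = 1%N -> forall a b c d, a * d - b * c != 0 ->
    \sum_(t <- R) f a b (c + t * a) (d + t * b) + f c d a b = 0;
  lt_u1 : m = 1%N -> forall a b c d, a * d - b * c != 0 ->
    \sum_(t <- R) f (a + pi^-1 * t * c) (b + pi^-1 * t * d) c d +
      f (pi^-1 * c) (pi^-1 * d) (pi * a) (pi * b) = 0 }.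

Record rtrace n f : Prop := {
  rt_l : (1 < n)%N -> forall a b c d, a * d - b * c != 0 ->
    \sum_(t <- R) f (a + pi ^+ n.-1 * t * b) b (c + pi ^+ n.-1 * t * d) d = 0;
  rt_u : (1 < n)%N -> forall a b c d, a * d - b * c != 0 ->
    \sum_(t <- R) f a (b + pi^-1 * t * a) c (d + pi^-1 * t * c) = 0;
  rt_l1 : n = 1%N -> forall a b c d, a * d - b * c != 0 ->
    \sum_(t <- R) f (a + t * b) b (c + t * d) d + f b a d c = 0;
  rt_u1 : n = 1%N -> forall a b c d, a * d - b * c != 0 ->
    \sum_(t <- R) f a (b + pi^-1 * t * a) c (d + pi^-1 * t * c) +
      f (pi * b) (pi^-1 * a) (pi * d) (pi^-1 * c) = 0 }.

Let pi0 : pi != 0 := val_pi_neq0 Hv.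

Lemma residue0 : exists2 t, t \in R & vge v 1 t.
Proof.
case: HR => _ _ /(_ 0 (vge0 _ _))[t tR]; rewrite sub0r (vgeN Hv) => tt _.
by exists t.
Qed.

Lemma sum_residues_eq0 (X : F -> W) (x : W) :
  (forall t, vge v 0 t -> X t = 0 \/ X t = x) ->
  (forall t, vge v 1 t -> X t = x) ->
  \sum_(t <- R) X t = 0 -> x = 0.
Proof.
move=> X01 X1; have [t0 tR t1] := residue0.
apply: (sum_0_or_eq (i0 := t0)) => [t tR'||] //; last exact: X1.
by apply: X01; case: HR => _ /(_ t tR').
Qed.

Lemma val_trace_l m t : vge v 0 t -> vge v m.-1%:Z (pi ^+ m.-1 * t).
Proof. by move=> t0; have := vgeM Hv (vge_piX Hv m.-1) t0; rewrite addr0. Qed.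

Lemma val_trace_u t : vge v 0 t -> vge v (-1) (pi^-1 * t).
Proof. by move=> t0; have := vgeM Hv (vge_piV Hv) t0; rewrite addr0. Qed.

Section Pivot.
Context (m n : nat) (mn : (n <= m)%N) (f : F -> F -> F -> F -> W).
Context (Hf : biinv m n f) (Hl : ltrace m f) (Hr : rtrace n f).
Hypothesis Hdiag : forall a d, a != 0 -> d != 0 ->
  (m < 2)%N \/ (m = n /\ v a = v d) ->
  2 * v a - n%:Z <= 2 * v d - m%:Z -> f a 0 0 d = 0.

(** Outside the cases of [Hdiag] the weights give [v a < v d]. Each entry [pi^-1 t d] created by the
    upper trace is then a multiple of [a] and a column operation removes it, so all terms of the
    trace are equal. *)
Lemma pivot_diag a d : a != 0 -> d != 0 ->
  2 * v a - n%:Z <= 2 * v d - m%:Z -> f a 0 0 d = 0.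
Proof.
move=> a0 d0 ad; have [m2|m2] := ltnP m 2; first by apply: Hdiag => //; left.
have [dd|dd] := boolP ((m == n) && (v a == v d)).
  by apply: Hdiag => //; right; case/andP: dd => /eqP ? /eqP.
have {}ad : v a + 1 <= v d by lia.
have D : a * d - 0 * 0 != 0 by rewrite mulr0 subr0 mulf_neq0.
have tr := lt_u Hl m2 D; move: tr; apply: sum_residues_eq0 => t tt; [right|];
  have {}tt : vge v 0 t by [|apply: vge_le tt].
all: have -> : a + pi^-1 * t * 0 = a by ring.
all: have -> : 0 + pi^-1 * t * d = 0 + (pi^-1 * t * d / a) * a by rewrite divfK.
all: rewrite -[X in f _ _ _ X](_ : d + (pi^-1 * t * d / a) * 0 = d); last by ring.
all: apply: (bi_c2 Hf) => //.
all: apply: vge_le (vge_div Hv a0 (vgeM Hv (val_trace_u tt) (vge_val _ _))); lia.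
Qed.

(** If [c] is not in [pi^m a O], the lower trace replaces it by [c + pi^(m-1) t a]. Either the
    valuation stays the same, and diagonal units bring the value back to [f a 0 c d], or the new
    entry lies in [pi^m a O], where the value is already 0. *)
Lemma pivot_lower a c d : a != 0 -> a * d - 0 * c != 0 ->
  2 * v a - n%:Z <= 2 * v d - m%:Z ->
  (c == 0) || (2 * v a - n%:Z <= 2 * v c - n%:Z - m%:Z) -> f a 0 c d = 0.
Proof.
move=> a0 D ad ac; have d0 : d != 0.
  by apply: contraNneq D => ->; rewrite mulr0 mul0r subr0.
have red c' : vge v (v a + m%:Z) c' -> f a 0 c' d = 0.
  move=> c'm; rewrite -(bi_r2 Hf (x := - c' / a)).
  - rewrite mulr0 addr0 -mulrA mulVf // mulr1 subrr; exact: pivot_diag.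
  - by rewrite mulNr (vgeN Hv); apply: vge_le (vge_div Hv a0 c'm); lia.
  - by rewrite mul0r subr0 mulf_neq0.
have [|cm] := boolP (vge v (v a + m%:Z) c); first exact: red.
have c0 : c != 0 by apply: contraNneq cm => ->; rewrite vge0.
move: ac cm; rewrite (negPf c0) vgeE //= => ac cm.
have m2 : (1 < m)%N by lia.
have tr := lt_l Hl m2 D; move: tr.
have sc t : vge v 0 t -> c + pi ^+ m.-1 * t * a != 0 ->
    v (c + pi ^+ m.-1 * t * a) = v c ->
    f a 0 (c + pi ^+ m.-1 * t * a) (d + pi ^+ m.-1 * t * 0) = f a 0 c d.
  move=> t0 e0 ev; set e := c + _ in e0 ev *.
  have uec : vunit v (e / c) by apply: (vunit_div Hv).
  rewrite mulr0 addr0 -[RHS](bi_s Hf (vunit1 Hv) uec (vunit1 Hv) (vunitV Hv uec)) //.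
  congr f; rewrite ?mulr1 ?mulr0 ?mul0r ?mul1r ?divfK //.
  by rewrite mulrAC divff ?mul1r // mulf_neq0 ?invr_neq0.
apply: sum_residues_eq0 => t tt.
  have h1 : vge v (v c) (c + pi ^+ m.-1 * t * a).
    apply: (vgeD Hv) => //; first exact: vge_val.
    apply: vge_le (vgeM Hv (val_trace_l m tt) (vge_val _ _)); lia.
  have [|nn] := boolP (vge v (v a + m%:Z) (c + pi ^+ m.-1 * t * a)).
    by left; rewrite mulr0 addr0; apply: red.
  have e0 : c + pi ^+ m.-1 * t * a != 0.
    by apply: contraNneq nn => ->; rewrite vge0.
  right; apply: sc => //; move: h1 nn; rewrite !vgeE // => h1 nn.
  have [lt|ge] := ltP (v c) (v a + m.-1%:Z); last by lia.
  have [] // := @vge_valD _ _ _ Hv c (pi ^+ m.-1 * t * a) c0.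
  by apply: vge_le (vgeM Hv (val_trace_l m tt) (vge_val _ _)); lia.
have t0 : vge v 0 t by apply: vge_le tt.
have [e0 ev] : c + pi ^+ m.-1 * t * a != 0 /\ v (c + pi ^+ m.-1 * t * a) = v c.
  apply: (vge_valD Hv) => //.
  by apply: vge_le (vgeM Hv (vgeM Hv (vge_piX Hv m.-1) tt) (vge_val _ _)); lia.
exact: sc.
Qed.

(** The mirror image of [pivot_lower], with the upper trace on the right acting on [b]. *)
Lemma pivot_upper a b d : a != 0 -> a * d - b * 0 != 0 ->
  2 * v a - n%:Z <= 2 * v d - m%:Z ->
  (b == 0) || (2 * v a - n%:Z <= 2 * v b) -> f a b 0 d = 0.
Proof.
move=> a0 D ad ab; have d0 : d != 0.
  by apply: contraNneq D => ->; rewrite !mulr0 subr0.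
have red b' : vge v (v a) b' -> f a b' 0 d = 0.
  move=> b'm; rewrite -(bi_c2 Hf (x := - b' / a)).
  - rewrite mulr0 addr0 -mulrA mulVf // mulr1 subrr; exact: pivot_diag.
  - by rewrite mulNr (vgeN Hv); apply: vge_le (vge_div Hv a0 b'm); lia.
  - by rewrite mulr0 subr0 mulf_neq0.
have [|bm] := boolP (vge v (v a) b); first exact: red.
have b0 : b != 0 by apply: contraNneq bm => ->; rewrite vge0.
move: ab bm; rewrite (negPf b0) vgeE //= => ab bm.
have n2 : (1 < n)%N by lia.
have tr := rt_u Hr n2 D; move: tr.
have sc t : vge v 0 t -> b + pi^-1 * t * a != 0 ->
    v (b + pi^-1 * t * a) = v b ->
    f a (b + pi^-1 * t * a) 0 (d + pi^-1 * t * 0) = f a b 0 d.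
  move=> t0 e0 ev; set e := b + _ in e0 ev *.
  have ueb : vunit v (e / b) by apply: (vunit_div Hv).
  rewrite mulr0 addr0 -[RHS](bi_s Hf (vunit1 Hv) (vunitV Hv ueb) (vunit1 Hv) ueb) //.
  congr f; rewrite ?mulr1 ?mulr0 ?mul0r ?mul1r //; first by rewrite mulrC divfK.
  by rewrite mulrAC mulVf ?mul1r // mulf_neq0 ?invr_neq0.
apply: sum_residues_eq0 => t tt.
  have h1 : vge v (v b) (b + pi^-1 * t * a).
    apply: (vgeD Hv) => //; first exact: vge_val.
    apply: vge_le (vgeM Hv (val_trace_u tt) (vge_val _ _)); lia.
  have [|nn] := boolP (vge v (v a) (b + pi^-1 * t * a)).
    by left; rewrite mulr0 addr0; apply: red.
  have e0 : b + pi^-1 * t * a != 0.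
    by apply: contraNneq nn => ->; rewrite vge0.
  right; apply: sc => //; move: h1 nn; rewrite !vgeE // => h1 nn.
  have [lt|ge] := ltP (v b) (v a - 1); last by lia.
  have [] // := @vge_valD _ _ _ Hv b (pi^-1 * t * a) b0.
  by apply: vge_le (vgeM Hv (val_trace_u tt) (vge_val _ _)); lia.
have t0 : vge v 0 t by apply: vge_le tt.
have [e0 ev] : b + pi^-1 * t * a != 0 /\ v (b + pi^-1 * t * a) = v b.
  apply: (vge_valD Hv) => //.
  by apply: vge_le (vgeM Hv (vgeM Hv (vge_piV Hv) tt) (vge_val _ _)); lia.
exact: sc.
Qed.

(* [g U(x) = T L(y) g T'] with [T, T'] diagonal, when [y = x c / b]. *)
Lemma exchange_col_row x y a b c d : b != 0 -> c != 0 -> a * d - b * c != 0 ->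
  y * b = x * c -> vge v 1 (x * a / b) -> vge v 1 (y * a / c) ->
  f a (b + x * a) c (d + x * c) = f a b (c + y * a) (d + y * b).
Proof.
move=> b0 c0 D yx xa ya.
have u1 := vunit1D Hv xa; have u2 := vunit1D Hv ya.
have w1 := vunit_neq0 u1; have w2 := vunit_neq0 u2.
have ey : y = x * c / b by rewrite -yx mulfK.
have D' : a * (d + y * b) - b * (c + y * a) != 0.
  by rewrite (_ : _ - _ = a * d - b * c) //; ring.
rewrite -(bi_s Hf (vunit1 Hv) (vunitV Hv u2) (vunit1 Hv) u1 D').
have e2 : 1 + y * a / c = (c + y * a) / c by field.
have e1 : 1 + x * a / b = (b + x * a) / b by field.
have w3 : c + y * a != 0 by move: w2; rewrite e2; apply: contraNneq => ->; rewrite mul0r.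
have w4 : b + x * a != 0 by move: w1; rewrite e1; apply: contraNneq => ->; rewrite mul0r.
have w5 : b + a * x != 0 by rewrite mulrC.
have e3 : c + y * a = c * (b + x * a) / b by rewrite ey; field.
congr f; rewrite ?e1 ?e2; [by ring | by field | by rewrite mulr1 invf_div divfK | ].
by rewrite e3 ey; field; rewrite ?b0 ?c0 ?w4 ?w5.
Qed.

(* [U(z) g = T L(y) g T'] with [T, T'] diagonal, when [y = z c d / (a b)]. *)
Lemma exchange_row_row z y a b c d : a != 0 -> b != 0 -> c != 0 ->
  a * d - b * c != 0 -> y * (a * b) = z * (c * d) ->
  vge v 1 (z * c / a) -> vge v 1 (z * d / b) ->
  f (a + z * c) (b + z * d) c d = f a b (c + y * a) (d + y * b).
Proof.
move=> a0 b0 c0 D yz za zb.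
have u1 := vunit1D Hv za; have u2 := vunit1D Hv zb.
have w1 := vunit_neq0 u1; have w2 := vunit_neq0 u2.
have ey : y = z * (c * d) / (a * b) by rewrite -yz mulfK // mulf_neq0.
have D' : (a + z * c) * d - (b + z * d) * c != 0.
  by rewrite (_ : _ - _ = a * d - b * c) //; ring.
rewrite -(bi_s Hf (vunit1 Hv) (vunitM Hv u1 u2) (vunitV Hv u1) (vunitV Hv u2) D').
have e1 : 1 + z * c / a = (a + z * c) / a by field.
have e2 : 1 + z * d / b = (b + z * d) / b by field.
have w3 : a + z * c != 0 by move: w1; rewrite e1; apply: contraNneq => ->; rewrite mul0r.
have w4 : b + z * d != 0 by move: w2; rewrite e2; apply: contraNneq => ->; rewrite mul0r.
by congr f; rewrite ?e1 ?e2 ?ey; field; rewrite ?a0 ?b0 ?w3 ?w4.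
Qed.

(* The four entries have weights 2v(a) - n, 2v(b), 2v(c) - n - m, 2v(d) - m, which the
   normalizers of [I_m] and [I_n] permute up to a common shift; [a] is an entry of minimal
   weight. Either [b] or [c] can be cleared, or one of the traces is a sum of terms all
   equal to [f a b c d]. *)
Lemma pivot a b c d : a != 0 -> a * d - b * c != 0 ->
  (b == 0) || (2 * v a - n%:Z <= 2 * v b) ->
  (c == 0) || (2 * v a - n%:Z <= 2 * v c - n%:Z - m%:Z) ->
  (d == 0) || (2 * v a - n%:Z <= 2 * v d - m%:Z) ->
  (m = n -> (1 < n)%N -> b != 0 -> c != 0 -> v c = v b + n%:Z ->
   f a b c d = 0 \/ 2 * v a - n%:Z < 2 * v b /\ vge v (v a + 1) d) ->
  f a b c d = 0.
Proof.
move=> a0 D ab ac ad Hgood.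
(* Clearing [b] or [c] replaces [d] by [d + e]; the ultrametric inequality keeps the bound on its
   weight. *)
have wD e : (e == 0) || (2 * v a - n%:Z <= 2 * v e - m%:Z) -> d + e != 0 ->
    2 * v a - n%:Z <= 2 * v (d + e) - m%:Z.
  have [->|e0] := eqVneq e 0.
    by rewrite addr0 => _ d0; move: ad; rewrite (negPf d0).
  have [->|d0] := eqVneq d 0; first by rewrite add0r.
  move: ad; rewrite (negPf d0) /= => ad ae de0.
  by case/orP: (valD_or Hv d0 e0 de0) => h; [apply: le_trans ad _ | apply: le_trans ae _];
    rewrite lerD2r ler_pM2l.
have det0 x : (a * (d + x * c) - (b + x * a) * c != 0) /\
    (a * (d + x * b) - b * (c + x * a) != 0).
  by split; apply: contraNneq D => <-; apply/eqP; ring.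
have [bb|bb] := boolP (vge v (v a) b).
  have xb : vge v 0 (- b / a).
    by rewrite mulNr (vgeN Hv); apply: vge_le (vge_div Hv a0 bb); lia.
  rewrite -(bi_c2 Hf xb D); have := proj1 (det0 (- b / a)).
  rewrite divfK // addrN => D'; apply: pivot_lower => //.
  apply: wD; last by apply: contraNneq D' => ->; rewrite mulr0 mul0r subr0.
  have [->|c0] := eqVneq c 0; first by rewrite mulr0 eqxx.
  move: ac; rewrite (negPf c0) /= => ac; have := vgeM Hv xb (vge_val v c).
  by rewrite /vge => /orP[->//|]; rewrite add0r => h; apply/orP; right; lia.
have [cc|cc] := boolP (vge v (v a + m%:Z) c).
  have xc : vge v m%:Z (- c / a).
    by rewrite mulNr (vgeN Hv); apply: vge_le (vge_div Hv a0 cc); lia.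
  rewrite -(bi_r2 Hf xc D); have := proj2 (det0 (- c / a)).
  rewrite divfK // addrN => D'; apply: pivot_upper => //.
  apply: wD; last by apply: contraNneq D' => ->; rewrite !mulr0 subr0.
  have [->|b0] := eqVneq b 0; first by rewrite mulr0 eqxx.
  move: ab; rewrite (negPf b0) /= => ab; have := vgeM Hv xc (vge_val v b).
  by rewrite /vge => /orP[->//|h]; apply/orP; right; lia.
have b0 : b != 0 by apply: contraNneq bb => ->; rewrite vge0.
have c0 : c != 0 by apply: contraNneq cc => ->; rewrite vge0.
move: ab ac bb cc; rewrite (negPf b0) (negPf c0) /= !vgeE // => ab ac bb cc.
have n2 : (1 < n)%N by lia.
have m2 : (1 < m)%N by lia.
have all0 (X : F -> W) : (forall t, vge v 0 t -> X t = f a b c d) ->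
    \sum_(t <- R) X t = 0 -> f a b c d = 0.
  move=> hX; apply: sum_residues_eq0 => t tt; [right|]; apply: hX => //.
  exact: vge_le tt.
(* Here [pi^-1 t c / b] has valuation at least [m]: the upper trace on the right is exchanged for
   row operations that belong to [I_m]. *)
have [lt|ge] := ltP (v b + m%:Z) (v c).
  have tr := rt_u Hr n2 D; move: tr; apply: all0 => t tt.
  have tu := val_trace_u tt.
  rewrite (exchange_col_row (y := pi^-1 * t * c / b)) //; [|by rewrite divfK| |].
  - apply: (bi_r2 Hf) => //.
    by apply: vge_le (vge_div Hv b0 (vgeM Hv tu (vge_val _ _))); lia.
  - by apply: vge_le (vge_div Hv b0 (vgeM Hv tu (vge_val _ _))); lia.
  - rewrite (_ : _ / c = pi^-1 * t * a / b); last by field; rewrite b0 c0 pi0.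
    by apply: vge_le (vge_div Hv b0 (vgeM Hv tu (vge_val _ _))); lia.
(* The opposite exchange: the lower trace on the left becomes a column operation by
   [pi^(m-1) t b / c], which is integral. *)
have [lt'|ge'] := ltP (v c) (v b + m%:Z).
  have tr := lt_l Hl m2 D; move: tr; apply: all0 => t tt.
  have tl := val_trace_l m tt.
  rewrite -(exchange_col_row (x := pi ^+ m.-1 * t * b / c)) //; [|by rewrite divfK| |].
  - apply: (bi_c2 Hf) => //.
    by apply: vge_le (vge_div Hv c0 (vgeM Hv tl (vge_val _ _))); lia.
  - rewrite (_ : _ / b = pi ^+ m.-1 * t * a / c); last by field; rewrite b0 c0.
    by apply: vge_le (vge_div Hv c0 (vgeM Hv tl (vge_val _ _))); lia.
  - by apply: vge_le (vge_div Hv c0 (vgeM Hv tl (vge_val _ _))); lia.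
have vc : v c = v b + m%:Z by lia.
(* With [b] and [c] in balance the upper trace on the left remains. Its row operation is exchanged
   for one by [y = pi^-1 t c d / (a b)], which is in [pi^m O] once [v d > v a]; the second condition
   keeps [pi^-1 t c / a] in [pi O]. *)
have kill : vge v (v a + 1) d -> (m != n) || (2 * v a - n%:Z < 2 * v b) -> f a b c d = 0.
  move=> da mn'; have tr := lt_u Hl m2 D; move: tr; apply: all0 => t tt.
  have tu := val_trace_u tt.
  rewrite (exchange_row_row (y := pi^-1 * t * (c * d) / (a * b))) //; [|by rewrite divfK ?mulf_neq0| |].
  - apply: (bi_r2 Hf) => //.
    have h := vge_div Hv (mulf_neq0 a0 b0) (vgeM Hv tu (vgeM Hv (vge_val v c) da)).
    by apply: vge_le h; rewrite (valM Hv) //; lia.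
  - by apply: vge_le (vge_div Hv a0 (vgeM Hv tu (vge_val _ _))); lia.
  - by apply: vge_le (vge_div Hv b0 (vgeM Hv tu da)); lia.
have [mn'|mn'] := eqVneq m n; last first.
  apply: kill; rewrite ?mn' //; move: ad; rewrite /vge => /orP[->//|ad].
  by apply/orP; right; lia.
have [] // := Hgood mn' n2 b0 c0; first by rewrite vc mn'.
by case=> ab' da; apply: kill; rewrite // ab' orbT.
Qed.

End Pivot.
End DoubleCosets.

(** Ties are decided in favour of the diagonal. An off-diagonal minimum is thus strict against [a]
    and [d], which the case of equal levels depends on. *)
Lemma min_of_four (za zb zc zd : bool) (wa wb wc wd : int) :
  ~~ [&& za, zb, zc & zd] ->
  [|| [&& ~~ za, zb || (wa <= wb), zc || (wa <= wc) & zd || (wa <= wd)],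
      [&& ~~ zd, za || (wd <= wa), zb || (wd <= wb) & zc || (wd <= wc)],
      [&& ~~ zb, za || (wb < wa), zd || (wb < wd) & zc || (wb <= wc)]
    | [&& ~~ zc, za || (wc < wa), zd || (wc < wd) & zb || (wc <= wb)]].
Proof. by case: za zb zc zd => [] [] [] [] //= _; lia. Qed.

(** * Symmetries of the double coset functions and choice of the pivot *)

Section Vanishing.
Context (F : fieldType) (v : F -> int) (pi : F) (Hv : valuation_at v pi).
Context (R : seq F) (HR : residues v R).
Context (C : numFieldType) (W : lmodType C).
Implicit Types (f : F -> F -> F -> F -> W) (m n : nat) (a b c d x y z t : F).

Let pi0 : pi != 0 := val_pi_neq0 Hv.

Definition newfun m n f : Prop :=
  [/\ biinv v m n f, ltrace pi R m f & rtrace pi R n f].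

(** Left translation, and below right translation, by the Atkin-Lehner element with rows [[0, 1]]
    and [[pi^k, 0]]. It normalizes [I_k] and exchanges the lower trace with the upper one. *)
Definition row_swap m f a b c d := f c d (pi ^+ m * a) (pi ^+ m * b).
Definition col_swap n f a b c d := f (pi ^+ n * b) a (pi ^+ n * d) c.

Lemma row_swapE m f a b c d :
  f a b c d = row_swap m f ((pi ^+ m)^-1 * c) ((pi ^+ m)^-1 * d) a b.
Proof. by rewrite /row_swap !mulVKf ?expf_neq0. Qed.

Lemma col_swapE n f a b c d :
  f a b c d = col_swap n f b ((pi ^+ n)^-1 * a) d ((pi ^+ n)^-1 * c).
Proof. by rewrite /col_swap !mulVKf ?expf_neq0. Qed.

Lemma det_row_swap m a b c d :
  a * d - b * c != 0 -> c * (pi ^+ m * b) - d * (pi ^+ m * a) != 0.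
Proof.
move=> D; rewrite (_ : _ - _ = - pi ^+ m * (a * d - b * c)); last by ring.
by rewrite mulf_neq0 ?oppr_eq0 ?expf_neq0.
Qed.

Lemma det_col_swap n a b c d :
  a * d - b * c != 0 -> (pi ^+ n * b) * c - a * (pi ^+ n * d) != 0.
Proof.
move=> D; rewrite (_ : _ - _ = - pi ^+ n * (a * d - b * c)); last by ring.
by rewrite mulf_neq0 ?oppr_eq0 ?expf_neq0.
Qed.

Lemma det_row_unswap m a b c d : a * d - b * c != 0 ->
  ((pi ^+ m)^-1 * c) * b - ((pi ^+ m)^-1 * d) * a != 0.
Proof.
move=> D; rewrite (_ : _ - _ = - (pi ^+ m)^-1 * (a * d - b * c)); last by ring.
by rewrite mulf_neq0 ?oppr_eq0 ?invr_eq0 ?expf_neq0.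
Qed.

Lemma det_col_unswap n a b c d : a * d - b * c != 0 ->
  b * ((pi ^+ n)^-1 * c) - ((pi ^+ n)^-1 * a) * d != 0.
Proof.
move=> D; rewrite (_ : _ - _ = - (pi ^+ n)^-1 * (a * d - b * c)); last by ring.
by rewrite mulf_neq0 ?oppr_eq0 ?invr_eq0 ?expf_neq0.
Qed.

Lemma vge_piM k x : vge v 0 x -> vge v k%:Z (pi ^+ k * x).
Proof. by move=> x0; have := vgeM Hv (vge_piX Hv k) x0; rewrite addr0. Qed.

Lemma vge_piVM k x : vge v k%:Z x -> vge v 0 ((pi ^+ k)^-1 * x).
Proof.
move=> xk; rewrite mulrC.
by apply: vge_le (vge_div Hv _ xk); rewrite ?expf_neq0 // (val_piX Hv) // subrr.
Qed.

Lemma row_swap_newfun m n f : newfun m n f -> newfun m n (row_swap m f).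
Proof.
have pm0 : pi ^+ m != 0 by rewrite expf_neq0.
have piS : (1 < m)%N -> pi ^+ m = pi * pi ^+ m.-1 by case: m {pm0} => // k _; rewrite exprS.
case=> Hb Hl Hr; split; split.
- move=> r1 r2 s1 s2 a b c d u1 u2 u3 u4 D; rewrite /row_swap.
  rewrite -(bi_s Hb u2 u1 u3 u4 (det_row_swap m D)).
  by congr f; ring.
- move=> x a b c d x0 D; rewrite /row_swap.
  rewrite -(bi_r2 Hb (vge_piM m x0) (det_row_swap m D)).
  by congr f; ring.
- move=> x a b c d xm D; rewrite /row_swap.
  rewrite -(bi_r1 Hb (vge_piVM xm) (det_row_swap m D)).
  by congr f; field.
- move=> x a b c d x0 D; rewrite /row_swap.
  rewrite -(bi_c1 Hb x0 (det_row_swap m D)).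
  by congr f; ring.
- move=> x a b c d x0 D; rewrite /row_swap.
  rewrite -(bi_c2 Hb x0 (det_row_swap m D)).
  by congr f; ring.
- move=> m1 a b c d D; rewrite -[RHS](lt_u Hl m1 (det_row_swap m D)).
  by apply: eq_bigr => t _; rewrite /row_swap piS //; congr f; field.
- move=> m1 a b c d D; rewrite -[RHS](lt_l Hl m1 (det_row_swap m D)).
  by apply: eq_bigr => t _; rewrite /row_swap piS //; congr f; field.
- move=> m1 a b c d D; rewrite -[RHS](lt_u1 Hl m1 (det_row_swap m D)).
  congr (_ + _); last by rewrite /row_swap m1 expr1; congr f; field.
  by apply: eq_bigr => t _; rewrite /row_swap m1 expr1; congr f; field.
- move=> m1 a b c d D; rewrite -[RHS](lt_l1 Hl m1 (det_row_swap m D)).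
  congr (_ + _); last by rewrite /row_swap m1 expr1; congr f; field.
  by apply: eq_bigr => t _; rewrite /row_swap m1 expr1; congr f; field.
- move=> n1 a b c d D; rewrite -[RHS](rt_l Hr n1 (det_row_swap m D)).
  by apply: eq_bigr => t _; rewrite /row_swap; congr f; ring.
- move=> n1 a b c d D; rewrite -[RHS](rt_u Hr n1 (det_row_swap m D)).
  by apply: eq_bigr => t _; rewrite /row_swap; congr f; ring.
- move=> n1 a b c d D; rewrite -[RHS](rt_l1 Hr n1 (det_row_swap m D)).
  by congr (_ + _); apply: eq_bigr => t _; rewrite /row_swap; congr f; ring.
- move=> n1 a b c d D; rewrite -[RHS](rt_u1 Hr n1 (det_row_swap m D)).
  congr (_ + _); last by rewrite /row_swap; congr f; ring.
  by apply: eq_bigr => t _; rewrite /row_swap; congr f; ring.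
Qed.

Lemma col_swap_newfun m n f : newfun m n f -> newfun m n (col_swap n f).
Proof.
have pm0 : pi ^+ n != 0 by rewrite expf_neq0.
have piS : (1 < n)%N -> pi ^+ n = pi * pi ^+ n.-1 by case: n {pm0} => // k _; rewrite exprS.
case=> Hb Hl Hr; split; split.
- move=> r1 r2 s1 s2 a b c d u1 u2 u3 u4 D; rewrite /col_swap.
  rewrite -(bi_s Hb u1 u2 u4 u3 (det_col_swap n D)).
  by congr f; ring.
- move=> x a b c d x0 D; rewrite /col_swap.
  rewrite -(bi_r1 Hb x0 (det_col_swap n D)).
  by congr f; ring.
- move=> x a b c d x0 D; rewrite /col_swap.
  rewrite -(bi_r2 Hb x0 (det_col_swap n D)).
  by congr f; ring.
- move=> x a b c d xm D; rewrite /col_swap.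
  rewrite -(bi_c2 Hb (vge_piVM xm) (det_col_swap n D)).
  by congr f; field.
- move=> x a b c d x0 D; rewrite /col_swap.
  rewrite -(bi_c1 Hb (vge_piM n x0) (det_col_swap n D)).
  by congr f; ring.
- move=> m1 a b c d D; rewrite -[RHS](lt_l Hl m1 (det_col_swap n D)).
  by apply: eq_bigr => t _; rewrite /col_swap; congr f; ring.
- move=> m1 a b c d D; rewrite -[RHS](lt_u Hl m1 (det_col_swap n D)).
  by apply: eq_bigr => t _; rewrite /col_swap; congr f; ring.
- move=> m1 a b c d D; rewrite -[RHS](lt_l1 Hl m1 (det_col_swap n D)).
  congr (_ + _); apply: eq_bigr => t _; rewrite /col_swap; congr f; ring.
- move=> m1 a b c d D; rewrite -[RHS](lt_u1 Hl m1 (det_col_swap n D)).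
  congr (_ + _); last by rewrite /col_swap; congr f; ring.
  by apply: eq_bigr => t _; rewrite /col_swap; congr f; ring.
- move=> n1 a b c d D; rewrite -[RHS](rt_u Hr n1 (det_col_swap n D)).
  by apply: eq_bigr => t _; rewrite /col_swap piS //; congr f; field.
- move=> n1 a b c d D; rewrite -[RHS](rt_l Hr n1 (det_col_swap n D)).
  by apply: eq_bigr => t _; rewrite /col_swap piS //; congr f; field.
- move=> n1 a b c d D; rewrite -[RHS](rt_u1 Hr n1 (det_col_swap n D)).
  congr (_ + _); last by rewrite /col_swap n1 expr1; congr f; field.
  by apply: eq_bigr => t _; rewrite /col_swap n1 expr1; congr f; field.
- move=> n1 a b c d D; rewrite -[RHS](rt_l1 Hr n1 (det_col_swap n D)).
  congr (_ + _); last by rewrite /col_swap n1 expr1; congr f; field.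
  by apply: eq_bigr => t _; rewrite /col_swap n1 expr1; congr f; field.
Qed.

(** Composition with the anti-involution [g -> D g^T D^-1], where [D = diag(1, pi^n)]. It preserves
    [I_n] and exchanges left and right, hence requires the same level on both sides. *)
Definition transpose n f a b c d := f a ((pi ^+ n)^-1 * c) (pi ^+ n * b) d.

Lemma det_transpose n a b c d : a * d - b * c != 0 ->
  a * d - ((pi ^+ n)^-1 * c) * (pi ^+ n * b) != 0.
Proof.
have pn0 : pi ^+ n != 0 by rewrite expf_neq0.
by move=> D; rewrite (_ : _ - _ = a * d - b * c) //; field.
Qed.

Lemma transpose_newfun n f : newfun n n f -> newfun n n (transpose n f).
Proof.
have pn0 : pi ^+ n != 0 by rewrite expf_neq0.
have piS : (1 < n)%N -> pi ^+ n = pi * pi ^+ n.-1 by case: n {pn0} => // k _; rewrite exprS.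
have pn10 : pi ^+ n.-1 != 0 by rewrite expf_neq0.
case=> Hb Hl Hr; split; split.
- move=> r1 r2 s1 s2 a b c d u1 u2 u3 u4 D; rewrite /transpose.
  rewrite -(bi_s Hb u3 u4 u1 u2 (det_transpose n D)).
  by congr f; ring.
- move=> x a b c d x0 D; rewrite /transpose.
  rewrite -(bi_c1 Hb (vge_piM n x0) (det_transpose n D)).
  by congr f; field.
- move=> x a b c d xm D; rewrite /transpose.
  rewrite -(bi_c2 Hb (vge_piVM xm) (det_transpose n D)).
  by congr f; field.
- move=> x a b c d xm D; rewrite /transpose.
  rewrite -(bi_r1 Hb (vge_piVM xm) (det_transpose n D)).
  by congr f; field.
- move=> x a b c d x0 D; rewrite /transpose.
  rewrite -(bi_r2 Hb (vge_piM n x0) (det_transpose n D)).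
  by congr f; field.
- move=> n1 a b c d D; rewrite -[RHS](rt_u Hr n1 (det_transpose n D)).
  by apply: eq_bigr => t _; rewrite /transpose piS //; congr f; field; rewrite ?pn10 ?pi0.
- move=> n1 a b c d D; rewrite -[RHS](rt_l Hr n1 (det_transpose n D)).
  by apply: eq_bigr => t _; rewrite /transpose piS //; congr f; field; rewrite ?pn10 ?pi0.
- move=> n1 a b c d D; rewrite -[RHS](rt_u1 Hr n1 (det_transpose n D)).
  congr (_ + _); last by rewrite /transpose n1 expr1; congr f; field.
  by apply: eq_bigr => t _; rewrite /transpose n1 expr1; congr f; field.
- move=> n1 a b c d D; rewrite -[RHS](rt_l1 Hr n1 (det_transpose n D)).
  congr (_ + _); last by rewrite /transpose n1 expr1; congr f; field.
  by apply: eq_bigr => t _; rewrite /transpose n1 expr1; congr f; field.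
- move=> n1 a b c d D; rewrite -[RHS](lt_u Hl n1 (det_transpose n D)).
  by apply: eq_bigr => t _; rewrite /transpose piS //; congr f; field; rewrite ?pn10 ?pi0.
- move=> n1 a b c d D; rewrite -[RHS](lt_l Hl n1 (det_transpose n D)).
  by apply: eq_bigr => t _; rewrite /transpose piS //; congr f; field; rewrite ?pn10 ?pi0.
- move=> n1 a b c d D; rewrite -[RHS](lt_u1 Hl n1 (det_transpose n D)).
  congr (_ + _); last by rewrite /transpose n1 expr1; congr f; field.
  by apply: eq_bigr => t _; rewrite /transpose n1 expr1; congr f; field.
- move=> n1 a b c d D; rewrite -[RHS](lt_l1 Hl n1 (det_transpose n D)).
  congr (_ + _); last by rewrite /transpose n1 expr1; congr f; field.
  by apply: eq_bigr => t _; rewrite /transpose n1 expr1; congr f; field.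
Qed.

Lemma sub_newfun m n f f' : newfun m n f -> newfun m n f' ->
  newfun m n (fun a b c d => f a b c d - f' a b c d).
Proof.
move=> [Hb Hl Hr] [Hb' Hl' Hr']; split; split.
- by move=> *; rewrite (bi_s Hb) // (bi_s Hb').
- by move=> *; rewrite (bi_r1 Hb) // (bi_r1 Hb').
- by move=> *; rewrite (bi_r2 Hb) // (bi_r2 Hb').
- by move=> *; rewrite (bi_c1 Hb) // (bi_c1 Hb').
- by move=> *; rewrite (bi_c2 Hb) // (bi_c2 Hb').
- by move=> *; rewrite sumrB (lt_l Hl) // (lt_l Hl') // subrr.
- by move=> *; rewrite sumrB (lt_u Hl) // (lt_u Hl') // subrr.
- by move=> *; rewrite sumrB addrACA -opprD (lt_l1 Hl) // (lt_l1 Hl') // subrr.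
- by move=> *; rewrite sumrB addrACA -opprD (lt_u1 Hl) // (lt_u1 Hl') // subrr.
- by move=> *; rewrite sumrB (rt_l Hr) // (rt_l Hr') // subrr.
- by move=> *; rewrite sumrB (rt_u Hr) // (rt_u Hr') // subrr.
- by move=> *; rewrite sumrB addrACA -opprD (rt_l1 Hr) // (rt_l1 Hr') // subrr.
- by move=> *; rewrite sumrB addrACA -opprD (rt_u1 Hr) // (rt_u1 Hr') // subrr.
Qed.

Section MinimalEntry.
Context (m n : nat) (mn : (n <= m)%N) (Q : (F -> F -> F -> F -> W) -> Prop).
Hypothesis Qnew : forall f, Q f -> newfun m n f.
Hypothesis Qrow : forall f, Q f -> Q (row_swap m f).
Hypothesis Qcol : forall f, Q f -> Q (col_swap n f).
Hypothesis Qdiag : forall f, Q f -> forall a d, a != 0 -> d != 0 ->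
  (m < 2)%N \/ (m = n /\ v a = v d) -> f a 0 0 d = 0.
Hypothesis Qgood : forall f, Q f -> forall a b c d, a * d - b * c != 0 ->
  m = n -> (1 < n)%N -> b != 0 -> c != 0 -> v c = v b + n%:Z -> f a b c d = 0.

(** The class [Q] is stable under both Atkin-Lehner translations, so an entry of minimal weight can
    be moved to the upper left corner, where [pivot] applies. Leaving [Q] abstract allows further
    conditions to be carried along, such as vanishing on the diagonal. *)
Lemma newfun_eq0 f a b c d : Q f -> a * d - b * c != 0 -> f a b c d = 0.
Proof.
have pn0 k : pi ^+ k != 0 by rewrite expf_neq0.
have vp k x : x != 0 -> v ((pi ^+ k)^-1 * x) = v x - k%:Z.
  by move=> x0; rewrite (valM Hv) ?invr_neq0 // (valV Hv) // (val_piX Hv) // addrC.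
have zp k x : ((pi ^+ k)^-1 * x == 0) = (x == 0).
  by rewrite mulf_eq0 invr_eq0 (negPf (pn0 k)).
have base f' a' b' c' d' : Q f' -> a' * d' - b' * c' != 0 -> a' != 0 ->
    (b' == 0) || (2 * v a' - n%:Z <= 2 * v b') ->
    (c' == 0) || (2 * v a' - n%:Z <= 2 * v c' - n%:Z - m%:Z) ->
    (d' == 0) || (2 * v a' - n%:Z <= 2 * v d' - m%:Z) -> f' a' b' c' d' = 0.
  move=> Qf D a0 ab ac ad; have [Hb Hl Hr] := Qnew Qf.
  apply: (pivot Hv HR mn Hb Hl Hr) => //.
    by move=> x y x0 y0 h _; apply: Qdiag.
  by move=> e n1 b0 c0 h; left; apply: Qgood.
move=> Qf D.
have := @min_of_four (a == 0) (b == 0) (c == 0) (d == 0) (2 * v a - n%:Z)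
  (2 * v b) (2 * v c - n%:Z - m%:Z) (2 * v d - m%:Z).
have -> : ~~ [&& a == 0, b == 0, c == 0 & d == 0].
  by apply: contraNN D => /and4P[/eqP-> /eqP-> _ _]; rewrite !mul0r subr0.
move=> /(_ isT)/or4P[] /and4P[h0 h1 h2 h3].
- exact: base.
- rewrite (row_swapE m) (col_swapE n); apply: base.
  + exact/Qcol/Qrow.
  + exact/det_col_unswap/det_row_unswap.
  + by rewrite mulf_neq0 ?invr_neq0.
  + by rewrite !zp; case: eqVneq h3 => //= c0; rewrite !vp ?mulf_neq0 ?invr_neq0 //; lia.
  + by rewrite !vp //; case: eqVneq h2 => //= b0; lia.
  + by rewrite !zp; case: eqVneq h1 => //= a0; rewrite !vp //; lia.
- rewrite (col_swapE n); apply: base => //.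
  + exact/Qcol.
  + exact/det_col_unswap.
  + by rewrite !zp; case: eqVneq h1 => //= a0; rewrite !vp //; lia.
  + by case: eqVneq h2 => //= d0; lia.
  + by rewrite !zp; case: eqVneq h3 => //= c0; rewrite !vp //; lia.
- rewrite (row_swapE m); apply: base => //.
  + exact/Qrow.
  + exact/det_row_unswap.
  + by rewrite mulf_neq0 ?invr_neq0.
  + by rewrite !zp; case: eqVneq h2 => //= d0; rewrite !vp //; lia.
  + by rewrite !vp //; case: eqVneq h1 => //= a0; lia.
  + by rewrite !vp //; case: eqVneq h3 => //= b0; lia.
Qed.
End MinimalEntry.

End Vanishing.

Lemma sum_two_values (V : zmodType) (I : eqType) (r : seq I) (X : I -> V) x y i0 :
  (forall i, i \in r -> X i = x \/ X i = y) -> i0 \in r -> X i0 = x ->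
  exists k l, \sum_(i <- r) X i = x *+ k.+1 + y *+ l.
Proof.
move=> Xr ri0 Xi0.
have [k [l [-> k0]]] : exists k l, \sum_(i <- r) X i = x *+ k + y *+ l /\ (i0 \in r -> (0 < k)%N).
  elim: r Xr {ri0} => [|i r IH] Xr; first by exists 0, 0; rewrite big_nil !mulr0n addr0.
  have [j jr|k [l [e k0]]] := IH; first by apply: Xr; rewrite in_cons jr orbT.
  rewrite big_cons e in_cons; have [<-|ii] := eqVneq i0 i.
    by exists k.+1, l; rewrite Xi0 mulrS addrA.
  have [->|->] := Xr i (mem_head _ _).
    by exists k.+1, l; rewrite mulrS addrA.
  by exists k, l.+1; rewrite mulrS addrCA.
by case: k k0 => [/(_ ri0)//|k _]; exists k, l.
Qed.

(** * Vanishing theorems: distinct levels, Cartan decomposition, antisymmetric functions *)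

Section Vanishing2.
Context (F : fieldType) (v : F -> int) (pi : F) (Hv : valuation_at v pi).
Context (R : seq F) (HR : residues v R).
Context (C : numFieldType) (W : lmodType C).
Implicit Types (f : F -> F -> F -> F -> W) (m n : nat) (a b c d x y z t : F).

Let pi0 : pi != 0 := val_pi_neq0 Hv.

Lemma mulrSn_eq0 (u : W) k : u *+ k.+1 = 0 -> u = 0.
Proof. by move/eqP; rewrite -scaler_nat scaler_eq0 pnatr_eq0 => /orP[|/eqP]. Qed.

(** Right translation by the Weyl element, which belongs to [I_0]. As [biinv] speaks of generators
    only, it is written as a product of three unipotent matrices and a sign. *)
Lemma biinv_antidiag m f b c : biinv v m 0 f -> b != 0 -> c != 0 ->
  f 0 b c 0 = f b 0 0 c.
Proof.
move=> Hf b0 c0; have O1 := vge1 Hv.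
have ON1 : vge v 0 (-1) by rewrite (vgeN Hv).
have uN1 : vunit v (-1) by rewrite /vunit oppr_eq0 oner_neq0 (valN Hv) (val1 Hv) /=.
have D1 : 0 * 0 - b * c != 0 by rewrite mul0r sub0r oppr_eq0 mulf_neq0.
have D2 : b * 0 - b * c != 0 by rewrite mulr0 sub0r oppr_eq0 mulf_neq0.
have D3 : b * (- c) - 0 * c != 0 by rewrite mul0r subr0 mulf_neq0 ?oppr_eq0.
have D4 : b * c - 0 * 0 != 0 by rewrite mul0r subr0 mulf_neq0.
rewrite -(bi_c1 Hf O1 D1) -[RHS](bi_s Hf (vunit1 Hv) (vunit1 Hv) (vunit1 Hv) uN1 D4).
rewrite (_ : f _ _ _ _ = f b b c 0); last by congr f; ring.
rewrite -(bi_c2 Hf ON1 D2) (_ : f _ _ _ _ = f b 0 c (- c)); last by congr f; ring.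
by rewrite -(bi_c1 Hf O1 D3); congr f; ring.
Qed.

Lemma diag_units m n f a d a' d' : biinv v m n f -> a != 0 -> d != 0 ->
  a' != 0 -> d' != 0 -> v a = v a' -> v d = v d' -> f a 0 0 d = f a' 0 0 d'.
Proof.
move=> Hf a0 d0 a0' d0' va vd.
have D : a' * d' - 0 * 0 != 0 by rewrite mul0r subr0 mulf_neq0.
rewrite -(bi_s Hf (vunit_div Hv a0 a0' va) (vunit_div Hv d0 d0' vd) (vunit1 Hv) (vunit1 Hv) D).
by congr f; rewrite ?mulr0 ?mul0r ?mulr1 ?divfK.
Qed.

(** For a unit [t] the lower unipotent matrix is in the big Bruhat cell, which brings in the Weyl
    translate of [diag(a, d)]. The inequality [v a <= v d] makes the column operation that clears
    [d] integral. *)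
Lemma trace_term_unit m n f a d t : biinv v m n f -> a != 0 -> d != 0 ->
  v a <= v d -> vunit v t -> f a 0 (0 + t * a) (d + t * 0) = f 0 d a 0.
Proof.
move=> Hf a0 d0 ad ut; have t0 := vunit_neq0 ut.
have ta0 : t * a != 0 by rewrite mulf_neq0.
have D : a * d - 0 * (t * a) != 0 by rewrite mul0r subr0 mulf_neq0.
have x0 : vge v 0 (- (d / (t * a))).
  rewrite (vgeN Hv); apply: vge_le (vge_div Hv ta0 (vge_val _ _)).
  by rewrite (valM Hv) // (vunit_val ut); lia.
have y0 : vge v 0 (- t^-1) by rewrite (vgeN Hv) vunit_vge ?(vunitV Hv).
have D' : a * 0 - (- (d / t)) * (t * a) != 0.
  by rewrite mulr0 sub0r oppr_eq0 !mulf_neq0 ?oppr_eq0 // ?mulf_neq0 ?invr_neq0.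
have uNt : vunit v (- t) by rewrite /vunit oppr_eq0 (valN Hv).
have D'' : 0 * 0 - (- (d / t)) * (t * a) != 0.
  by rewrite mulr0 sub0r oppr_eq0 !mulf_neq0 ?oppr_eq0 // ?mulf_neq0 ?invr_neq0.
rewrite mulr0 addr0 add0r -(bi_c2 Hf x0 D).
rewrite (_ : f _ _ _ _ = f a (- (d / t)) (t * a) 0); last first.
  by congr f; [field; rewrite a0 t0 | rewrite mulNr divfK ?subrr].
rewrite -(bi_r1 Hf y0 D') (_ : f _ _ _ _ = f 0 (- (d / t)) (t * a) 0); last first.
  by congr f; [field | ring].
rewrite -(bi_s Hf uNt (vunitV Hv ut) (vunit1 Hv) (vunit1 Hv) D'').
by congr f; field.
Qed.

(** In the level 1 trace the residue 0 gives the diagonal value; the unit residues and the extra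
    coset give the antidiagonal one. Only the positivity of the two multiplicities matters. *)
Lemma trace_diag m n f a d : newfun v pi R m n f -> m = 1%N -> a != 0 -> d != 0 ->
  v a <= v d -> exists k l, f a 0 0 d *+ k.+1 + f 0 d a 0 *+ l.+1 = 0.
Proof.
move=> [Hb Hl _] m1 a0 d0 ad.
have D : a * d - 0 * 0 != 0 by rewrite mul0r subr0 mulf_neq0.
have := lt_l1 Hl m1 D; have [t0 t0R t01] := residue0 Hv HR.
have E1 t : vge v 1 t -> f a 0 (0 + t * a) (d + t * 0) = f a 0 0 d.
  by move=> tt; apply: (bi_r2 Hb) => //; rewrite m1.
have [t tR|k [l ->]] := sum_two_values (X := fun t => f a 0 (0 + t * a) (d + t * 0)) (x := f a 0 0 d) (y := f 0 d a 0) _ t0R (E1 _ t01).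
  have tt : vge v 0 t by case: HR => _ /(_ _ tR).
  have [t1|t1] := boolP (vge v 1 t); first by left; apply: E1.
  by right; apply: (trace_term_unit Hb) => //; apply: (vunitE Hv).
by move=> e; exists k, l; rewrite (mulrSr (f 0 d a 0)) addrA.
Qed.

(** The values on diagonal matrices depend on the valuations alone. [R1] relates [(x, y)] to
    [(y, x)], and its Atkin-Lehner translate [R2] relates a pair at distance [k + 2] to one at
    distance [k]. At distance 0 the relation [R1], and at distance 1 the relation [R2], involves a
    single value, which is therefore 0; this starts the induction. *)
Lemma newfun_diag_level1 f a d : newfun v pi R 1 0 f -> a != 0 -> d != 0 ->
  f a 0 0 d = 0.
Proof.
move=> Hf.
have R1 (g : F -> F -> F -> F -> W) x y : newfun v pi R 1 0 g -> x != 0 -> y != 0 -> v x <= v y ->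
    exists k l, g x 0 0 y *+ k.+1 + g y 0 0 x *+ l.+1 = 0.
  move=> Hg x0 y0 xy; have [k [l e]] := trace_diag Hg erefl x0 y0 xy.
  by have [Hg1 _ _] := Hg; exists k, l; rewrite -(biinv_antidiag Hg1 y0 x0).
have [Hb _ _] := Hf.
have R2 x y : x != 0 -> y != 0 -> v x <= v y ->
    exists k l, f y 0 0 (pi * x) *+ k.+1 + f x 0 0 (pi * y) *+ l.+1 = 0.
  move=> x0 y0 xy; have [k [l e]] := R1 _ _ _ (row_swap_newfun Hv Hf) x0 y0 xy.
  exists k, l; move: e; rewrite /row_swap expr1 !mulr0.
  by rewrite !(biinv_antidiag Hb) ?mulf_neq0.
have R0 (g : F -> F -> F -> F -> W) x y : newfun v pi R 1 0 g -> x != 0 -> y != 0 -> v x <= v y ->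
    g x 0 0 y = 0 -> g y 0 0 x = 0.
  move=> Hg x0 y0 xy g0; have [k [l]] := R1 _ _ _ Hg x0 y0 xy.
  by rewrite g0 mul0rn add0r => /mulrSn_eq0.
have main k x y : x != 0 -> y != 0 -> v y = v x + k%:Z ->
    f x 0 0 y = 0 /\ f y 0 0 x = 0.
  have [j] := ubnP k; elim: j k x y => // j IH [|k] x y kj x0 y0 e.
    have exy : f y 0 0 x = f x 0 0 y by apply: (diag_units Hb) => //; lia.
    have [|k [l]] := R1 _ _ _ Hf x0 y0; first by lia.
    by rewrite exy -mulrnDr addSn => /mulrSn_eq0->.
  suff f0 : f x 0 0 y = 0 by split=> //; apply: R0 => //; lia.
  have y'0 : pi^-1 * y != 0 by rewrite mulf_neq0 ?invr_neq0.
  have vy' : v (pi^-1 * y) = v y - 1.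
    by rewrite (valM Hv) ?invr_neq0 // (valV Hv) // (val_pi Hv) addrC.
  have [|k' [l]] := R2 x (pi^-1 * y) x0 y'0; first by rewrite vy'; lia.
  rewrite mulVKf //; case: k e kj => [|k] e kj.
    rewrite (_ : f _ _ _ (pi * x) = f x 0 0 y); last first.
      apply: (diag_units Hb) => //; first (by rewrite mulf_neq0); [rewrite vy' e| rewrite (valM Hv) // (val_pi Hv) e]; lia.
    by rewrite -mulrnDr addSn => /mulrSn_eq0.
  have px0 : pi * x != 0 by rewrite mulf_neq0.
  have [||_ ->] := IH k (pi * x) (pi^-1 * y) _ px0 y'0; first by lia.
    by rewrite vy' (valM Hv) // (val_pi Hv); lia.
  by rewrite mul0rn add0r => /mulrSn_eq0.
move=> a0 d0; have [ad|da] := leP (v a) (v d).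
  have [] // := main `|v d - v a|%N a d a0 d0; lia.
have [] // := main `|v a - v d|%N d a d0 a0; lia.
Qed.

Theorem newfun_level_gt m n f a b c d : (n < m)%N -> newfun v pi R m n f ->
  a * d - b * c != 0 -> f a b c d = 0.
Proof.
move=> nm Hf D.
apply: (newfun_eq0 Hv HR (ltnW nm) (Q := newfun v pi R m n)) Hf D => {f} f Hf //.
- exact: row_swap_newfun.
- exact: col_swap_newfun.
- move=> a' d' a0 d0 h.
  (* The diagonal is only asked for when [m < 2], since [m = n] is excluded; so the levels are 1 and
     0. *)
  have em : m = 1%N by lia.
  have en : n = 0%N by lia.
  by move: Hf; rewrite em en => Hf; apply: newfun_diag_level1.
- by move=> *; lia.
Qed.

(** The Cartan decomposition as an instance of the pivot argument: in level 0 all trace conditions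
    are empty. *)
Theorem cartan_eq0 f a b c d : biinv v 0 0 f ->
  (forall x y, x != 0 -> y != 0 -> f x 0 0 y = 0) ->
  a * d - b * c != 0 -> f a b c d = 0.
Proof.
move=> Hf f0 D.
pose Q (g : F -> F -> F -> F -> W) := newfun v pi R 0 0 g /\ forall x y, x != 0 -> y != 0 -> g x 0 0 y = 0.
apply: (newfun_eq0 Hv HR (leqnn 0) (Q := Q)) D => [g []|g []|g []|g []|g []|] //.
- move=> Hg g0; split; first exact: row_swap_newfun.
  move=> x y x0 y0; rewrite /row_swap expr0 !mul1r (biinv_antidiag (m := 0)) ?g0 //.
  by case: Hg.
- move=> Hg g0; split; first exact: col_swap_newfun.
  move=> x y x0 y0; rewrite /col_swap expr0 !mul1r (biinv_antidiag (m := 0)) ?g0 //.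
  by case: Hg.
- by move=> _ g0 x y x0 y0 _; apply: g0.
Qed.

Section Antisymmetric.
Context (n : nat) (f : F -> F -> F -> F -> W) (Hf : newfun v pi R n n f).
Hypothesis antisym : forall a b c d, a * d - b * c != 0 ->
  f a ((pi ^+ n)^-1 * c) (pi ^+ n * b) d = - f a b c d.

Lemma opp_fix_eq0 (u : W) : u = - u -> u = 0.
Proof.
by move/eqP; rewrite -addr_eq0 => /eqP e; apply: (@mulrSn_eq0 u 1); rewrite mulr2n.
Qed.

(* Here the matrix and its twisted transpose lie in the same double coset. *)
Lemma antisym_good a b c d : a * d - b * c != 0 -> b != 0 -> c != 0 ->
  v c = v b + n%:Z -> f a b c d = 0.
Proof.
move=> D b0 c0 bc; have [Hb _ _] := Hf; apply: opp_fix_eq0; rewrite -antisym //.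
have pb0 : pi ^+ n * b != 0 by rewrite mulf_neq0 ?expf_neq0.
have u : vunit v ((pi ^+ n)^-1 * c / b).
  apply: (vunit_div Hv) => //; rewrite ?mulf_neq0 ?invr_neq0 ?expf_neq0 //.
  by rewrite (valM Hv) ?invr_neq0 ?expf_neq0 // (valV Hv) ?expf_neq0 // (val_piX Hv) bc; lia.
have pn0 : pi ^+ n != 0 by rewrite expf_neq0.
rewrite -[LHS](bi_s Hb (vunit1 Hv) (vunitV Hv u) (vunit1 Hv) u D).
by congr f; field; rewrite ?b0 ?c0 ?pn0.
Qed.

Lemma antisym_diag a d : a != 0 -> d != 0 -> f a 0 0 d = 0.
Proof.
move=> a0 d0; apply: opp_fix_eq0; rewrite -antisym ?mulr0 //.
by rewrite subr0 mulf_neq0.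
Qed.

(** The twisted transpose moves most antidiagonal matrices, so antisymmetry alone is not enough. In
    level 0 the Weyl element leads back to the diagonal, and in level 1 the trace at [diag(c, b)]
    expresses the value through diagonal ones. *)
Lemma antisym_antidiag b c : b != 0 -> c != 0 -> (n < 2)%N \/ v c = v b + n%:Z ->
  f 0 b c 0 = 0.
Proof.
move=> b0 c0 [n2|]; last first.
  by apply: antisym_good => //; rewrite mul0r sub0r oppr_eq0 mulf_neq0.
have [Hb Hl _] := Hf.
case: n n2 Hf antisym_diag Hb Hl => [|[|//]] _ Hf' fd Hb Hl.
  by rewrite (biinv_antidiag Hb) // fd.
have [cb|bc] := leP (v c) (v b).
  have [k [l]] := trace_diag Hf' erefl c0 b0 cb.
  by rewrite fd // mul0rn add0r => /mulrSn_eq0.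
have D : c * b - 0 * 0 != 0 by rewrite mul0r subr0 mulf_neq0.
have := lt_l1 Hl erefl D; rewrite big_seq big1 ?add0r // => t tR.
have tt : vge v 0 t by case: HR => _ /(_ _ tR).
have D' : c * b - 0 * (t * c) != 0 by rewrite mul0r subr0 mulf_neq0.
rewrite mulr0 addr0 add0r -[LHS](bi_c1 Hb (x := - (t * c / b))) //.
  by rewrite mulr0 addr0 mulNr divfK // subrr fd.
rewrite (vgeN Hv).
by apply: vge_le (vge_div Hv b0 (vgeM Hv tt (vge_val v c))); lia.
Qed.

End Antisymmetric.

(** A single Atkin-Lehner translation need not preserve antisymmetry, because the transpose
    exchanges left and right; only the two together do. So a pivot [d] is moved by both, and a pivot
    [c] is carried to the place of [b] by antisymmetry itself. For a pivot [b] the strict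
    inequalities of [min_of_four] settle the case that [pivot] leaves open. *)
Theorem newfun_antisym_eq0 n f a b c d : newfun v pi R n n f ->
  (forall a b c d, a * d - b * c != 0 ->
    f a ((pi ^+ n)^-1 * c) (pi ^+ n * b) d = - f a b c d) ->
  a * d - b * c != 0 -> f a b c d = 0.
Proof.
have pn0 : pi ^+ n != 0 by rewrite expf_neq0.
have vp x : x != 0 -> v ((pi ^+ n)^-1 * x) = v x - n%:Z.
  by move=> x0; rewrite (valM Hv) ?invr_neq0 // (valV Hv) // (val_piX Hv) // addrC.
have zp x : ((pi ^+ n)^-1 * x == 0) = (x == 0).
  by rewrite mulf_eq0 invr_eq0 (negPf pn0).
have strict (g : F -> F -> F -> F -> W) a' b' c' d' : newfun v pi R n n g ->
    (forall a b c d, a * d - b * c != 0 ->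
      g a ((pi ^+ n)^-1 * c) (pi ^+ n * b) d = - g a b c d) ->
    a' * d' - b' * c' != 0 -> b' != 0 ->
    (a' == 0) || (2 * v b' < 2 * v a' - n%:Z) ->
    (d' == 0) || (2 * v b' < 2 * v d' - n%:Z) ->
    (c' == 0) || (2 * v b' <= 2 * v c' - n%:Z - n%:Z) -> g a' b' c' d' = 0.
  move=> Hg anti D b0 ba bd bc.
  have Hg' := col_swap_newfun Hv Hg; have [Hb Hl Hr] := Hg'.
  rewrite (col_swapE Hv n); apply: (pivot Hv HR (leqnn n) Hb Hl Hr) => //.
  - move=> x y x0 y0 h _; rewrite /col_swap mulr0.
    apply: (antisym_antidiag Hg anti) => //; first by rewrite mulf_neq0.
    case: h => [|[_ xy]]; [by left | right].
    by rewrite (valM Hv) // (val_piX Hv) xy addrC.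
  - exact: (det_col_unswap Hv).
  - by rewrite !zp; case: eqVneq ba => //= a0; rewrite !vp //; lia.
  - by case: eqVneq bd => //= d0; lia.
  - by rewrite !zp; case: eqVneq bc => //= c0; rewrite !vp //; lia.
  move=> _ _ a0 d0 vd; have {}a0 : a' != 0 by rewrite -zp.
  move: ba bd; rewrite (negPf a0) (negPf d0) /= => ba bd.
  have [c0|c0] := eqVneq c' 0; first by right; rewrite c0 mulr0 vge0 vp //; lia.
  move: bc; rewrite (negPf c0) /= => bc.
  have [e|ne] := eqVneq (v c') (v b' + n%:Z).
    left; rewrite -(col_swapE Hv n); exact: (antisym_good Hg anti).
  by right; rewrite vgeE ?zp // !vp //; lia.
move=> Hf anti D; have [Hb Hl Hr] := Hf.
have amin (g : F -> F -> F -> F -> W) a' b' c' d' : newfun v pi R n n g ->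
    (forall a b c d, a * d - b * c != 0 ->
      g a ((pi ^+ n)^-1 * c) (pi ^+ n * b) d = - g a b c d) ->
    a' * d' - b' * c' != 0 -> a' != 0 ->
    (b' == 0) || (2 * v a' - n%:Z <= 2 * v b') ->
    (c' == 0) || (2 * v a' - n%:Z <= 2 * v c' - n%:Z - n%:Z) ->
    (d' == 0) || (2 * v a' - n%:Z <= 2 * v d' - n%:Z) -> g a' b' c' d' = 0.
  move=> Hg ganti D' a0 ab ac ad; have [Hb' Hl' Hr'] := Hg.
  apply: (pivot Hv HR (leqnn n) Hb' Hl' Hr') => //.
    by move=> x y x0 y0 h _; apply: (antisym_diag ganti).
  by move=> _ n1 b0 c0 h; left; apply: (antisym_good Hg ganti).
have := @min_of_four (a == 0) (b == 0) (c == 0) (d == 0) (2 * v a - n%:Z)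
  (2 * v b) (2 * v c - n%:Z - n%:Z) (2 * v d - n%:Z).
have -> : ~~ [&& a == 0, b == 0, c == 0 & d == 0].
  by apply: contraNN D => /and4P[/eqP-> /eqP-> _ _]; rewrite !mul0r subr0.
move=> /(_ isT)/or4P[] /and4P[h0 h1 h2 h3].
- exact: (amin f).
- rewrite (row_swapE Hv n) (col_swapE Hv n); apply: amin.
  + exact/(col_swap_newfun Hv)/(row_swap_newfun Hv).
  + move=> x y z t D'; rewrite /col_swap /row_swap -anti.
      by congr f; field.
    rewrite (_ : _ - _ = pi ^+ n * pi ^+ n * (x * t - y * z)); last by ring.
    by rewrite !mulf_neq0.
  + exact/(det_col_unswap Hv)/(det_row_unswap Hv).
  + by rewrite mulf_neq0 ?invr_neq0.
  + by rewrite !zp; case: eqVneq h3 => //= c0; rewrite !vp ?mulf_neq0 ?invr_neq0 //; lia.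
  + by rewrite !vp //; case: eqVneq h2 => //= b0; lia.
  + by rewrite !zp; case: eqVneq h1 => //= a0; rewrite !vp //; lia.
- exact: strict.
- apply/eqP; rewrite -oppr_eq0 -anti //; apply/eqP; apply: strict => //.
  + by rewrite (_ : _ - _ = a * d - b * c) //; field.
  + by rewrite zp.
  + by case: eqVneq h1 => //= a0; rewrite vp //; lia.
  + by case: eqVneq h2 => //= d0; rewrite vp //; lia.
  + rewrite mulf_eq0 (negPf pn0) /=; case: eqVneq h3 => //= b0.
    by rewrite vp // (valM Hv) // (val_piX Hv); lia.
Qed.

End Vanishing2.

(** * Two by two matrices and coset representatives *)

Section Matrix2.
Context (F : fieldType).
Implicit Types (a b c d x y : F) (g h : 'M[F]_2).

Definition M2 a b c d : 'M[F]_2 := \matrix_(i, j)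
  (if i == 0 then if j == 0 then a else b else if j == 0 then c else d).

Lemma M2E a b c d : [/\ M2 a b c d 0 0 = a, M2 a b c d 0 1 = b,
  M2 a b c d 1 0 = c & M2 a b c d 1 1 = d].
Proof. by split; rewrite mxE. Qed.

Lemma M2K g : g = M2 (g 0 0) (g 0 1) (g 1 0) (g 1 1).
Proof.
apply/matrixP => i j; rewrite mxE.
by case: i j => [[|[|//]] ?] [[|[|//]] ?] /=; congr (g _ _); apply: val_inj.
Qed.

Lemma M2_mul a b c d a' b' c' d' : M2 a b c d *m M2 a' b' c' d' =
  M2 (a * a' + b * c') (a * b' + b * d') (c * a' + d * c') (c * b' + d * d').
Proof.
apply/matrixP => i j; rewrite !mxE !big_ord_recl big_ord0 !mxE /= addr0.
by case: i j => [[|[|//]] ?] [[|[|//]] ?].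
Qed.

Lemma det_M2 a b c d : \det (M2 a b c d) = a * d - b * c.
Proof.
rewrite (expand_det_row _ 0) !big_ord_recl big_ord0 addr0 /cofactor !det_mx11 !mxE /=.
by ring.
Qed.

Lemma det2 g : \det g = g 0 0 * g 1 1 - g 0 1 * g 1 0.
Proof. by rewrite {1}(M2K g) det_M2. Qed.

Lemma M2_unit a b c d : (M2 a b c d \in unitmx) = (a * d - b * c != 0).
Proof. by rewrite unitmxE det_M2 unitfE. Qed.

Lemma M2_1 : M2 1 0 0 1 = 1%:M.
Proof.
apply/matrixP => i j; rewrite !mxE.
by case: i j => [[|[|//]] ?] [[|[|//]] ?].
Qed.

Lemma M2_scalar z : M2 z 0 0 z = z%:M.
Proof.
apply/matrixP => i j; rewrite !mxE.
by case: i j => [[|[|//]] ?] [[|[|//]] ?]; rewrite ?mulr1n ?mulr0n.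
Qed.

Lemma M2_inj a b c d a' b' c' d' : a = a' -> b = b' -> c = c' -> d = d' ->
  M2 a b c d = M2 a' b' c' d'.
Proof. by move=> -> -> -> ->. Qed.

Definition lowmx x := M2 1 0 x 1.
Definition upmx x := M2 1 x 0 1.
Definition w0mx := M2 0 1 1 0.

Lemma lowmx_unit x : lowmx x \in unitmx.
Proof. by rewrite M2_unit mul0r subr0 mulr1 oner_neq0. Qed.

Lemma upmx_unit x : upmx x \in unitmx.
Proof. by rewrite M2_unit mulr0 subr0 mulr1 oner_neq0. Qed.

Lemma w0mx_unit : w0mx \in unitmx.
Proof. by rewrite M2_unit mul0r sub0r mulr1 oppr_eq0 oner_neq0. Qed.

Lemma lowmxD x y : lowmx x *m lowmx y = lowmx (x + y).
Proof. by rewrite M2_mul; apply: M2_inj; ring. Qed.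

Lemma lowmx0 : lowmx 0 = 1%:M. Proof. exact: M2_1. Qed.

Lemma lowmxV x : invmx (lowmx x) = lowmx (- x).
Proof.
by rewrite -[RHS](mulKmx (lowmx_unit x)) lowmxD subrr lowmx0 mulmx1.
Qed.

Lemma w0mxK : w0mx *m w0mx = 1%:M.
Proof. by rewrite M2_mul -M2_1; apply: M2_inj; ring. Qed.

Lemma w0mxV : invmx w0mx = w0mx.
Proof. by rewrite -[RHS](mulKmx w0mx_unit) w0mxK mulmx1. Qed.

End Matrix2.

(** The cover [L] need not lie in [P], so its members cannot serve as representatives. Each of them
    contributes instead an equivalent element of [P], if there is one whose class is still
    missing. *)
Lemma exists_reps (T : eqType) (P : T -> Prop) (e : T -> T -> Prop) (L : seq T) :
  (forall x y, e x y -> e y x) -> (forall x y z, e x y -> e y z -> e x z) ->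
  (forall x, P x -> exists2 y, y \in L & e x y) ->
  exists S : seq T, [/\ uniq S, forall x, x \in S -> P x,
    forall x, P x -> exists2 s, s \in S & e x s
    & {in S &, forall s t, e s t -> s = t}].
Proof.
move=> es et cov.
suff [S [uS SP cS iS]] : exists S : seq T, [/\ uniq S, forall x, x \in S -> P x,
    forall x, P x -> (exists2 y, y \in L & e x y) -> exists2 s, s \in S & e x s
    & {in S &, forall s t, e s t -> s = t}].
  by exists S; split=> // x Px; apply: cS => //; apply: cov.
elim: L {cov} => [|y L [S [uS SP cS iS]]].
  by exists [::]; split=> // x _ [].
have [[x [Px exy nx]]|none] := pselect (exists x, [/\ P x, e x y &
    forall s, s \in S -> ~ e x s]); last first.
  exists S; split=> // x Px [z]; rewrite in_cons => /orP[/eqP->|zL] xz.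
    apply: contrapT => h; apply: none; exists x; split=> // s sS xs.
    by apply: h; exists s.
  by apply: cS => //; exists z.
have xS : x \notin S by apply/negP => /nx; apply; exact: et exy (es _ _ exy).
exists (x :: S); split.
- by rewrite /= xS.
- by move=> z; rewrite in_cons => /orP[/eqP->|/SP].
- move=> z Pz [z']; rewrite in_cons => /orP[/eqP-> zy|z'L zz'].
    by exists x; rewrite ?mem_head //; exact: et zy (es _ _ exy).
  have [s sS zs] : exists2 s, s \in S & e z s by apply: cS => //; exists z'.
  by exists s; rewrite // in_cons sS orbT.
- move=> s t; rewrite !in_cons => /orP[/eqP->|sS] /orP[/eqP->|tS] //.
  + by move/nx => /(_ tS).
  + by move/es/nx => /(_ sS).
  + exact: iS.
Qed.

(** The map [phi] induces an injection of the finite set of classes into itself, hence a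
    permutation. *)
Lemma sum_reps (T : eqType) (P : T -> Prop) (e : T -> T -> Prop) (S : seq T)
    (V : nmodType) (X : T -> V) (phi : T -> T) :
  (forall x y, e x y -> e y x) -> (forall x y z, e x y -> e y z -> e x z) ->
  uniq S -> (forall x, x \in S -> P x) ->
  (forall x, P x -> exists2 s, s \in S & e x s) ->
  {in S &, forall s t, e s t -> s = t} ->
  (forall x, P x -> P (phi x)) ->
  (forall x y, P x -> P y -> e (phi x) (phi y) -> e x y) ->
  (forall x y, P x -> P y -> e x y -> X x = X y) ->
  \sum_(s <- S) X (phi s) = \sum_(s <- S) X s.
Proof.
move=> es et uS SP cS iS phiP phiI Xe.
have red x : {y : T | P x -> y \in S /\ e x y}.
  apply: cid; have [Px|nP] := pselect (P x); last by exists x.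
  by have [s sS xs] := cS _ Px; exists s.
pose r x := projT1 (red (phi x)).
have rP x : P x -> r x \in S /\ e (phi x) (r x).
  by move=> Px; have := projT2 (red (phi x)) (phiP _ Px).
have -> : \sum_(s <- S) X (phi s) = \sum_(s <- map r S) X s.
  rewrite big_map; apply: eq_big_seq => s /SP Ps.
  by have [rS er] := rP _ Ps; apply: Xe => //; [exact: phiP | exact: SP].
have rinj : {in S &, injective r}.
  move=> s t sS tS rst; have [_ e1] := rP _ (SP _ sS); have [_ e2] := rP _ (SP _ tS).
  apply: iS => //; apply: phiI; [exact: SP | exact: SP |].
  by apply: et e1 _; rewrite rst; apply: es.
have uS' : uniq (map r S) by rewrite map_inj_in_uniq.
apply: perm_big; apply: uniq_perm => //.
have sub : {subset map r S <= S} by move=> _ /mapP[s sS ->]; exact: (rP _ (SP _ sS)).1.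
by have [] := uniq_min_size uS' sub _; rewrite ?size_map.
Qed.

(** * Eichler orders, their unit groups and congruences *)

Section Eichler.
Context (F : fieldType) (v : F -> int) (pi : F) (Hv : valuation_at v pi).
Context (R : seq F) (HR : residues v R).
Implicit Types (m n M N : nat) (a b c d x y z t : F) (f g h k : 'M[F]_2).

Let pi0 : pi != 0 := val_pi_neq0 Hv.

(** [pi^M] times the Eichler order with rows [[O, O]] and [[pi^n O, O]]. Being a two-sided ideal of
    this order, it gives a congruence compatible with multiplication on both sides. The unit group
    [levelI] is [I_n] for every [n], including [K] for [n = 0], without a case distinction. *)
Definition eichler n M g : bool :=
  [&& vge v M%:Z (g 0 0), vge v M%:Z (g 0 1), vge v (M + n)%:Z (g 1 0) & vge v M%:Z (g 1 1)].

Definition levelI n g : bool := eichler n 0 g && vunit v (\det g).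

Definition cong n M g h : bool := eichler n M (g - h).

Lemma eichler_M2 n M a b c d : eichler n M (M2 a b c d) =
  [&& vge v M%:Z a, vge v M%:Z b, vge v (M + n)%:Z c & vge v M%:Z d].
Proof. by have [h1 h2 h3 h4] := M2E a b c d; rewrite /eichler h1 h2 h3 h4. Qed.

Lemma levelI_M2 n a b c d : levelI n (M2 a b c d) =
  [&& vge v 0 a, vge v 0 b, vge v n%:Z c & vge v 0 d] && vunit v (a * d - b * c).
Proof. by rewrite /levelI eichler_M2 det_M2 add0n. Qed.

Lemma eichlerD n M g h : eichler n M g -> eichler n M h -> eichler n M (g + h).
Proof.
move=> /and4P[g1 g2 g3 g4] /and4P[h1 h2 h3 h4].
by rewrite /eichler !mxE !(vgeD Hv).
Qed.

Lemma eichlerN n M g : eichler n M (- g) = eichler n M g.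
Proof. by rewrite /eichler !mxE !(vgeN Hv). Qed.

Lemma vgeM_nat (i j k : nat) x y : (k <= i + j)%N ->
  vge v i%:Z x -> vge v j%:Z y -> vge v k%:Z (x * y).
Proof. by move=> kij xi yj; apply: vge_le (vgeM Hv xi yj); lia. Qed.

Lemma vge0M x y : vge v 0 x -> vge v 0 y -> vge v 0 (x * y).
Proof. exact: (@vgeM_nat 0 0 0). Qed.

Lemma vge1M x y : vge v 1 x -> vge v 0 y -> vge v 1 (x * y).
Proof. exact: (@vgeM_nat 1 0 1). Qed.

Lemma eichlerM n M N g h : eichler n M g -> eichler n N h ->
  eichler n (M + N) (g *m h).
Proof.
move=> /and4P[g1 g2 g3 g4] /and4P[h1 h2 h3 h4].
rewrite (M2K g) (M2K h) M2_mul eichler_M2; apply/and4P.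
split; apply: (vgeD Hv).
all: first [ by apply: vgeM_nat g1 h1; lia | by apply: vgeM_nat g2 h3; lia
  | by apply: vgeM_nat g1 h2; lia | by apply: vgeM_nat g2 h4; lia
  | by apply: vgeM_nat g3 h1; lia | by apply: vgeM_nat g4 h3; lia
  | by apply: vgeM_nat g3 h2; lia | by apply: vgeM_nat g4 h4; lia ].
Qed.

Lemma eichler_le n M N g : (N <= M)%N -> eichler n M g -> eichler n N g.
Proof.
move=> NM /and4P[g1 g2 g3 g4]; apply/and4P.
by split; [apply: vge_le g1|apply: vge_le g2|apply: vge_le g3|apply: vge_le g4]; lia.
Qed.

Lemma levelI_unit n g : levelI n g -> g \in unitmx.
Proof. by case/andP=> _ /andP[d0 _]; rewrite unitmxE unitfE. Qed.

Lemma levelI1 n : levelI n 1%:M.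
Proof.
rewrite -M2_1 levelI_M2 !vge0 (vge1 Hv) mul0r subr0 mulr1.
by rewrite (vunit1 Hv).
Qed.

Lemma levelIM n g h : levelI n g -> levelI n h -> levelI n (g *m h).
Proof.
move=> /andP[g1 g2] /andP[h1 h2]; apply/andP; split; first exact: (eichlerM g1 h1).
by rewrite det_mulmx (vunitM Hv).
Qed.

Lemma invmx2 g : g \in unitmx ->
  invmx g = M2 (g 1 1 / \det g) (- g 0 1 / \det g) (- g 1 0 / \det g) (g 0 0 / \det g).
Proof.
move=> ug; have dg : \det g != 0 by move: ug; rewrite unitmxE unitfE.
rewrite -[LHS]mulmx1; apply: (canLR (mulKmx ug)); rewrite -M2_1 [X in X *m _](M2K g) M2_mul.
by apply: M2_inj; rewrite det2; field; rewrite -det2.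
Qed.

Lemma levelIV n g : levelI n g -> levelI n (invmx g).
Proof.
move=> Ig; have ug := levelI_unit Ig; case/andP: (Ig) => /and4P[g1 g2 g3 g4] ud.
have uV := vunit_vge (vunitV Hv ud).
apply/andP; split; last by rewrite det_inv (vunitV Hv).
rewrite invmx2 // eichler_M2; apply/and4P; split.
- exact: (vgeM_nat (leqnn _) g4 uV).
- by apply: (vgeM_nat (leqnn 0) _ uV (i := 0)); rewrite (vgeN Hv).
- by apply: (vgeM_nat _ _ uV (i := n)); rewrite ?(vgeN Hv) ?addn0.
- exact: (vgeM_nat (leqnn _) g1 uV).
Qed.

Lemma cong_sym n M g h : cong n M g h -> cong n M h g.
Proof. by rewrite /cong -opprB eichlerN. Qed.

Lemma cong_trans n M f g h : cong n M f g -> cong n M g h -> cong n M f h.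
Proof. by move=> fg gh; have := eichlerD fg gh; rewrite addrA subrK. Qed.

Lemma cong_mull n M k g h : eichler n 0 k -> cong n M g h -> cong n M (k *m g) (k *m h).
Proof. by move=> kn gh; rewrite /cong -mulmxBr; exact: (eichlerM kn gh). Qed.

Lemma cong_mulr n M k g h : eichler n 0 k -> cong n M g h -> cong n M (g *m k) (h *m k).
Proof.
by move=> kn gh; rewrite /cong -mulmxBl; have := eichlerM gh kn; rewrite addn0.
Qed.

Lemma levelI_eichler n g : levelI n g -> eichler n 0 g. Proof. by case/andP. Qed.

Lemma cong_levelI n M g h : (0 < M)%N -> levelI n g -> cong n M g h -> levelI n h.
Proof.
move=> M0 /andP[gn dg] gh.
have hn : eichler n 0 h.
  have := eichlerD gn (eichler_le (leq0n M) (cong_sym gh)).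
  by rewrite addrCA subrr addr0.
apply/andP; split=> //; move: gn gh hn.
move=> /and4P[g1 g2 g3 g4] /and4P[]; rewrite !mxE => e1 e2 e3 e4 /and4P[h1 h2 h3 h4].
have : vge v 1 (\det h - \det g).
  rewrite !det2 (_ : _ - _ = - ((g 0 0 - h 0 0) * g 1 1 + h 0 0 * (g 1 1 - h 1 1)) +
    ((g 0 1 - h 0 1) * g 1 0 + h 0 1 * (g 1 0 - h 1 0))); last by ring.
  apply: (vgeD Hv); rewrite ?(vgeN Hv); apply: (vgeD Hv).
  - by apply: vgeM_nat e1 g4; rewrite !addn_gt0 M0 ?orbT.
  - by apply: vgeM_nat h1 e4; rewrite !addn_gt0 M0 ?orbT.
  - by apply: vgeM_nat e2 g3; rewrite !addn_gt0 M0 ?orbT.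
  - by apply: vgeM_nat h2 e3; rewrite !addn_gt0 M0 ?orbT.
case/andP: dg => dg /eqP vdg dd.
have [|e0 ev] := @vge_valD _ _ _ Hv (\det g) (\det h - \det g) dg; first by rewrite vdg.
by move: e0 ev; rewrite addrC subrK /vunit => -> ->; rewrite vdg.
Qed.

Lemma exists_cover M : exists L : seq F,
  forall x, vge v 0 x -> exists2 t, t \in L & vge v M%:Z (x - t).
Proof.
elim: M => [|M [L HL]]; first by exists [:: 0] => x; exists 0; rewrite ?mem_head ?subr0.
exists [seq t + pi ^+ M * s | t <- L, s <- R] => x x0.
have [t tL xt] := HL _ x0.
have pM0 : pi ^+ M != 0 by rewrite expf_neq0.
have y0 : vge v 0 ((x - t) / pi ^+ M).
  by apply: vge_le (vge_div Hv pM0 xt); rewrite (val_piX Hv) subrr.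
have [_ _ cR _] := HR; have [s sR ys] := cR _ y0.
exists (t + pi ^+ M * s); first by apply/allpairsP; exists (t, s).
have := vgeM Hv (vge_piX Hv M) ys.
by rewrite mulrBr mulrCA divff // mulr1 opprD addrA; apply: vge_le; lia.
Qed.

Lemma exists_levelI_reps n M : (0 < M)%N -> exists S : seq 'M[F]_2,
  [/\ uniq S, forall g, g \in S -> levelI n g,
    forall g, levelI n g -> exists2 s, s \in S & cong n M g s
    & {in S &, forall g h, cong n M g h -> g = h}].
Proof.
move=> M0; have [L HL] := exists_cover M; have [L' HL'] := exists_cover (M + n).
pose LL := [seq M2 p.1.1 p.1.2 p.2.1 p.2.2 |
    p <- [seq (p, q) | p <- [seq (a, b) | a <- L, b <- L],
                       q <- [seq (c, d) | c <- L', d <- L]]].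
refine (@exists_reps _ (fun g => levelI n g) (fun g h => cong n M g h) LL _ _ _).
- exact: cong_sym.
- exact: cong_trans.
move=> g /andP[/and4P[g1 g2 g3 g4] _].
have [a aL ga] := HL _ g1; have [b bL gb] := HL _ g2; have [d dL gd] := HL _ g4.
have [c cL gc] := HL' _ (vge_le (le0z_nat _) g3).
exists (M2 a b c d).
  apply/mapP; exists ((a, b), (c, d)) => //.
  by apply/allpairsP; exists ((a, b), (c, d)); split=> //;
    apply/allpairsP; [exists (a, b) | exists (c, d)].
by have [e1 e2 e3 e4] := M2E a b c d; rewrite /cong /eichler !mxE /= in e1 e2 e3 e4 *;
  apply/and4P.
Qed.

Definition reps n M : seq 'M[F]_2 :=
  if pselect (0 < M)%N is left M0 then projT1 (cid (exists_levelI_reps n M0)) else [::].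

Lemma repsP n M : (0 < M)%N ->
  [/\ uniq (reps n M), forall g, g \in reps n M -> levelI n g,
    forall g, levelI n g -> exists2 s, s \in reps n M & cong n M g s
    & {in reps n M &, forall g h, cong n M g h -> g = h}].
Proof. by move=> M0; rewrite /reps; case: pselect => // h; case: cid. Qed.

Lemma reps_gt0 n M : (0 < M)%N -> (0 < size (reps n M))%N.
Proof.
move=> /(@repsP n) [_ _ /(_ _ (levelI1 n))[s sS _] _].
by case: (reps n M) sS.
Qed.

Lemma sum_levelI (V : nmodType) n M (X : 'M[F]_2 -> V) (phi : 'M[F]_2 -> 'M[F]_2) :
  (0 < M)%N -> (forall g, levelI n g -> levelI n (phi g)) ->
  (forall g h, levelI n g -> levelI n h -> cong n M (phi g) (phi h) -> cong n M g h) ->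
  (forall g h, levelI n g -> levelI n h -> cong n M g h -> X g = X h) ->
  \sum_(s <- reps n M) X (phi s) = \sum_(s <- reps n M) X s.
Proof.
move=> /(@repsP n) [uS SP cS iS] pI pinj Xe.
apply: (sum_reps (P := fun g => levelI n g) (e := fun g h => cong n M g h)) => //.
- exact: cong_sym.
- exact: cong_trans.
Qed.

Lemma sum_residues (V : nmodType) (X : F -> V) (phi : F -> F) :
  (forall x, vge v 0 x -> vge v 0 (phi x)) ->
  (forall x y, vge v 0 x -> vge v 0 y -> vge v 1 (phi x - phi y) -> vge v 1 (x - y)) ->
  (forall x y, vge v 0 x -> vge v 0 y -> vge v 1 (x - y) -> X x = X y) ->
  \sum_(s <- R) X (phi s) = \sum_(s <- R) X s.
Proof.
case: HR => uR R0 cR iR pI pinj Xe.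
apply: (sum_reps (P := fun x => vge v 0 x) (e := fun x y => vge v 1 (x - y))) => //.
- by move=> x y; rewrite -opprB (vgeN Hv).
- by move=> x y z h1 h2; have := vgeD Hv h1 h2; rewrite addrA subrK.
Qed.

(** As [d] is in [pi O], the homography reduces to an affine bijection of the residue field. *)
Lemma sum_residues_homography (V : nmodType) (X : F -> V) a b c d :
  vge v 0 a -> vunit v b -> vunit v c -> vge v 1 d ->
  (forall x y, vge v 0 x -> vge v 0 y -> vge v 1 (x - y) -> X x = X y) ->
  \sum_(t <- R) X ((a + b * t) / (c + d * t)) = \sum_(t <- R) X t.
Proof.
move=> a0 ub uc d1 Xe.
have den t : vge v 0 t -> vunit v (c + d * t).
  move=> t0; case/andP: (uc) => c0 /eqP vc.
  have [|h1 h2] := @vge_valD _ _ _ Hv c (d * t) c0.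
    by rewrite vc; exact: vge1M d1 t0.
  by rewrite /vunit h1 h2 vc.
have vb := vunit_vge ub.
have num t : vge v 0 t -> vge v 0 (a + b * t).
  by move=> t0; apply: (vgeD Hv) => //; exact: vge0M vb t0.
apply: sum_residues => // [t t0|s t s0 t0].
  by apply: vge0M (num _ t0) _; exact/(vunit_vge)/(vunitV Hv)/den.
have ns := vunit_neq0 (den _ s0); have nt := vunit_neq0 (den _ t0).
move=> h; have := vge1M h (vge0M (vunit_vge (den _ s0)) (vunit_vge (den _ t0))).
rewrite (_ : _ * _ = b * c * (s - t) + d * (a * (t - s))); last by field; rewrite ns nt.
have k1 : vge v 1 (d * (a * (t - s))).
  by apply: (vge1M d1 (vge0M a0 _)); apply: (vgeB Hv).
move=> /(vgeB Hv) /(_ k1); rewrite addrK => h'.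
have ubc := vunitM Hv ub uc.
have := vge1M h' (vunit_vge (vunitV Hv ubc)).
by rewrite mulrAC mulfV ?mul1r ?(vunit_neq0 ubc).
Qed.

End Eichler.

(** * Traces from [I_n] to [I_(n-1)] *)

Section Traces.
Context (F : fieldType) (v : F -> int) (pi : F) (Hv : valuation_at v pi).
Context (R : seq F) (HR : residues v R) (V : nmodType).
Implicit Types (m n M N : nat) (a b c d x y z t : F) (f g h k : 'M[F]_2).
Implicit Types G : 'M[F]_2 -> V.

Let pi0 : pi != 0 := val_pi_neq0 Hv.

Definition rinv n G : Prop :=
  forall g k, g \in unitmx -> levelI v n k -> G (g *m k) = G g.

Lemma rinv_mull n G g : g \in unitmx -> rinv n G -> rinv n (fun h => G (g *m h)).
Proof. by move=> ug Gn h k uh kn; rewrite mulmxA Gn // unitmx_mul ug. Qed.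

Lemma levelI_diag_units n k : (0 < n)%N -> levelI v n k ->
  vunit v (k 0 0) /\ vunit v (k 1 1).
Proof.
move=> n0 /andP[/and4P[k1 k2 k3 k4]]; rewrite det2 => ud.
have {}k3 : vge v 1 (k 1 0) by apply: vge_le k3; rewrite lez_nat.
have bc : vge v 1 (k 0 1 * k 1 0) by rewrite mulrC; apply: (vge1M Hv).
have nad : ~~ vge v 1 (k 0 0 * k 1 1).
  apply/negP => /(vgeB Hv)/(_ bc); case/andP: ud => d0 /eqP vd.
  by rewrite vgeE // vd.
by split; apply: (vunitE Hv) => //; apply: contraNN nad => h;
  [|rewrite mulrC]; apply: (vge1M Hv).
Qed.

Lemma lowmx_levelI n x : vge v n%:Z x -> levelI v n (lowmx x).
Proof.
by move=> xn; rewrite levelI_M2 xn (vge1 Hv) vge0 mul0r subr0 mulr1 (vunit1 Hv).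
Qed.

Lemma upmx_levelI n x : vge v 0 x -> levelI v n (upmx x).
Proof.
by move=> xn; rewrite levelI_M2 xn (vge1 Hv) vge0 mulr0 subr0 mulr1 (vunit1 Hv).
Qed.

Lemma levelI_M2_det n a b c d e : vge v 0 a -> vge v 0 b -> vge v n%:Z c ->
  vge v 0 d -> vunit v e -> a * d - b * c = e -> levelI v n (M2 a b c d).
Proof. by move=> h1 h2 h3 h4 u e1; rewrite levelI_M2 h1 h2 h3 h4 e1 u. Qed.

(** Left multiplication by [k] permutes the cosets of the lower unipotent matrices: the product is
    [lowmx s] times an upper triangular element of [I_n], and [s] is a homography of [t] that is
    affine modulo [pi]. *)
Lemma trace_low n G k : (1 < n)%N -> rinv n G -> levelI v n.-1 k ->
  \sum_(t <- R) G (k *m lowmx (pi ^+ n.-1 * t)) =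
  \sum_(t <- R) G (lowmx (pi ^+ n.-1 * t)).
Proof.
move=> n1 Gn kn; have n0 : (0 < n.-1)%N by case: n n1 {Gn kn} => [|[]].
have [ua ud] := levelI_diag_units n0 kn; have uk := levelI_unit kn.
have [a [b [c [d ek]]]] : exists a b c d, k = M2 a b c d.
  by exists (k 0 0), (k 0 1), (k 1 0), (k 1 1); apply: M2K.
have [e1 _ _ e4] := M2E a b c d; rewrite {}ek {}e1 {}e4 in ua ud kn uk *.
move: kn; rewrite levelI_M2 => /andP[/and4P[ka kb kc kd] udet].
have q0 : pi ^+ n.-1 != 0 by rewrite expf_neq0.
have qn : pi ^+ n = pi ^+ n.-1 * pi by rewrite -exprSr prednK // ltnW.
have bq : vge v 1 (b * pi ^+ n.-1).
  by rewrite mulrC; apply: (vge1M Hv) => //; apply: vge_le (vge_piX Hv _); rewrite lez_nat.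
rewrite -[RHS](sum_residues_homography Hv HR (vge_piVM Hv kc) ud ua bq) => [|x y x0 y0 xy].
  rewrite big_seq [RHS]big_seq; apply: eq_bigr => t tR.
  have t0 : vge v 0 t by case: HR => _ /(_ _ tR).
  have ab : vunit v (a + b * pi ^+ n.-1 * t).
    case/andP: ua => a0 /eqP va; have [|h1 h2] := @vge_valD _ _ _ Hv a (b * pi ^+ n.-1 * t) a0.
      by rewrite va add0r (vge1M Hv).
    by rewrite /vunit h1 h2 va.
  have ab0 := vunit_neq0 ab.
  set s := pi ^+ n.-1 * (_ / _).
  have s0 : vge v 0 s.
    apply: (vge0M Hv); first by apply: vge_le (vge_piX Hv _); rewrite lez_nat.
    apply: (vge0M Hv); last exact/vunit_vge/(vunitV Hv).
    by apply: (vgeD Hv); [exact: (vge_piVM Hv) | exact: (vge0M Hv)].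
  have qt0 : vge v 0 (pi ^+ n.-1 * t).
    by apply: (vge0M Hv) => //; apply: vge_le (vge_piX Hv _); rewrite lez_nat.
  have Ik : levelI v n (M2 (a + b * (pi ^+ n.-1 * t)) b 0 (d - s * b)).
    apply: levelI_M2_det udet _ => //.
    - by apply: (vgeD Hv) => //; apply: (vge0M Hv).
    - exact: vge0.
    - by apply: (vgeB Hv) => //; apply: (vge0M Hv).
    by rewrite /s; field; rewrite q0 ab0.
  rewrite -[RHS](Gn _ _ (lowmx_unit _) Ik); congr G.
  by rewrite !M2_mul; apply: M2_inj; rewrite /s; field; rewrite ?q0 ?ab0.
have Ik : levelI v n (lowmx (pi ^+ n.-1 * (x - y))).
  apply: lowmx_levelI; have := vgeM Hv (vge_piX Hv n.-1) xy.
  by apply: vge_le; rewrite -PoszD addn1 prednK // ltnW.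
rewrite -[RHS](Gn _ _ (lowmx_unit _) Ik) lowmxD; congr (G (lowmx _)).
by ring.
Qed.

(** The trace from [I_1] to [K] along the Bruhat representatives [1] and [upmx t w0], as a function
    of a left factor [k]. This form allows invariance to be checked on [I_1] and on the Weyl element
    separately. *)
Definition trace1 G k := G k + \sum_(t <- R) G (k *m (upmx t *m w0mx F)).

Lemma upw0_unit x : upmx x *m w0mx F \in unitmx.
Proof. by rewrite unitmx_mul upmx_unit w0mx_unit. Qed.

Lemma rinv_upw0 G x y : rinv 1 G -> vge v 1 (x - y) ->
  G (upmx x *m w0mx F) = G (upmx y *m w0mx F).
Proof.
move=> G1 xy; rewrite -[RHS](G1 _ _ (upw0_unit _) (@lowmx_levelI 1 _ xy)); congr G.
by rewrite !M2_mul; apply: M2_inj; ring.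
Qed.

Lemma trace1_levelI1 G k : rinv 1 G -> levelI v 1 k -> trace1 G k = trace1 G 1%:M.
Proof.
move=> G1 kn; have [ua ud] := levelI_diag_units (ltn0Sn 0) kn.
congr (_ + _); first by rewrite -{1}[k]mul1mx G1 ?unitmx1.
have [a [b [c [d ek]]]] : exists a b c d, k = M2 a b c d.
  by exists (k 0 0), (k 0 1), (k 1 0), (k 1 1); apply: M2K.
have [e1 _ _ e4] := M2E a b c d; rewrite {}ek {}e1 {}e4 in ua ud kn *.
move: kn; rewrite levelI_M2 => /andP[/and4P[ka kb kc kd] udet].
have Gx x y : vge v 0 x -> vge v 0 y -> vge v 1 (x - y) ->
    G (1%:M *m (upmx x *m w0mx F)) = G (1%:M *m (upmx y *m w0mx F)).
  by move=> _ _ xy; rewrite !mul1mx; apply: rinv_upw0.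
rewrite -[RHS](sum_residues_homography Hv HR kb ua ud kc Gx).
rewrite big_seq [RHS]big_seq; apply: eq_bigr => t tR.
have t0 : vge v 0 t by case: HR => _ /(_ _ tR).
have dc : vunit v (d + c * t).
  case/andP: ud => d0 /eqP vd; have [|h1 h2] := @vge_valD _ _ _ Hv d (c * t) d0.
    by rewrite vd add0r (vge1M Hv).
  by rewrite /vunit h1 h2 vd.
have dc0 := vunit_neq0 dc.
set s := _ / _.
have s0 : vge v 0 s.
  apply: (vge0M Hv); last exact/vunit_vge/(vunitV Hv).
  by apply: (vgeD Hv) => //; apply: (vge0M Hv) => //; apply: vunit_vge.
have Ik : levelI v 1 (M2 (d + c * t) c 0 (a - s * c)).
  apply: levelI_M2_det udet _; rewrite ?vge0 //; first exact: vunit_vge.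
  - by apply: vge_le kc.
  - by apply: (vgeB Hv) => //; apply: (vge0M Hv) => //; apply: vge_le kc.
  by rewrite /s; field; rewrite dc0.
rewrite mul1mx -[RHS](G1 _ _ (upw0_unit _) Ik); congr G.
by rewrite !M2_mul; apply: M2_inj; rewrite /s; field; rewrite ?dc0.
Qed.

(** The Weyl element acts on the projective line over the residue field by inversion: it exchanges 0
    and infinity and sends a unit [t] to [1/t]. [B] puts the coset of 1 in the place of the residue
    0, so that this becomes a substitution in a sum over residues. *)
Lemma trace1_w0 G : rinv 1 G -> trace1 G (w0mx F) = trace1 G 1%:M.
Proof.
move=> G1; rewrite /trace1; have [t0 t0R t01] := residue0 Hv HR.
case: (HR) => uR R0 cR iR.
pose B t := if vge v 1 t then G 1%:M else G (upmx t *m w0mx F).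
pose phi t := if vge v 1 t then t else t^-1.
have vge1_cong x y : vge v 1 (x - y) -> vge v 1 x = vge v 1 y.
  move=> xy; apply/idP/idP => h; last by rewrite -(subrK y x) (vgeD Hv).
  by rewrite -(subKr x y) (vgeB Hv).
have nphi x : vge v 0 x -> ~~ vge v 1 x -> ~~ vge v 1 x^-1.
  move=> x0 x1; have := vunitV Hv (vunitE Hv x0 x1).
  by case/andP=> xV /eqP vx; rewrite vgeE // vx.
have -> : \sum_(t <- R) G (w0mx F *m (upmx t *m w0mx F)) = \sum_(t <- R) B t.
  rewrite -[RHS](sum_residues Hv HR (phi := phi)).
  - rewrite big_seq [RHS]big_seq; apply: eq_bigr => t tR; rewrite /B /phi.
    have -> : w0mx F *m (upmx t *m w0mx F) = lowmx t.
      by rewrite !M2_mul; apply: M2_inj; ring.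
    case: (boolP (vge v 1 t)) => t1 /=.
      by rewrite t1 -[in LHS](mul1mx (lowmx t)) G1 ?unitmx1 ?lowmx_levelI.
    rewrite (negPf (nphi _ (R0 _ tR) t1)).
    have ut := vunitE Hv (R0 _ tR) t1; have tn0 := vunit_neq0 ut.
    have Ik : levelI v 1 (M2 t 1 0 (- t^-1)).
      apply: (@levelI_M2_det _ _ _ _ _ (-1)).
      - exact: R0.
      - exact: (vge1 Hv).
      - exact: vge0.
      - by rewrite (vgeN Hv); apply/vunit_vge/(vunitV Hv).
      - by rewrite /vunit oppr_eq0 oner_neq0 (valN Hv) (val1 Hv) eqxx.
      - by field.
    rewrite -[RHS](G1 _ _ (upw0_unit _) Ik); congr G.
    by rewrite !M2_mul; apply: M2_inj; field.
  - move=> x x0; rewrite /phi; case: ifPn => // x1.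
    exact/vunit_vge/(vunitV Hv)/(vunitE Hv).
  - move=> x y x0 y0; rewrite /phi; case: ifPn => x1; case: ifPn => y1 //.
    + move/vge1_cong; rewrite x1 => /esym h.
      by move: (nphi _ y0 y1); rewrite h.
    + move/vge1_cong; rewrite y1 => h.
      by move: (nphi _ x0 x1); rewrite h.
    + have ux := vunit_neq0 (vunitE Hv x0 x1); have uy := vunit_neq0 (vunitE Hv y0 y1).
      move=> /(vge1M Hv)/(_ (vge0M Hv x0 y0)).
      rewrite (_ : _ * _ = - (x - y)) ?(vgeN Hv) //.
      by field; rewrite ux uy.
  - move=> x y x0 y0 xy; rewrite /B (vge1_cong _ _ xy).
    by case: ifP => // _; apply: rinv_upw0.
rewrite (bigD1_seq t0) //= [in RHS](bigD1_seq t0) //= /B t01 addrCA; congr (_ + (_ + _)).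
  rewrite mul1mx -(G1 _ _ (w0mx_unit _) (@lowmx_levelI 1 _ t01)); congr G.
  by rewrite !M2_mul; apply: M2_inj; ring.
rewrite big_seq_cond [RHS]big_seq_cond; apply: eq_bigr => t /andP[tR tt0].
rewrite mul1mx ifN //; apply: contraNN tt0 => t1.
by apply/eqP/iR => //; apply: (vgeB Hv).
Qed.

(** Bruhat decomposition: an element of [K] outside [I_1] has a unit in the lower left corner and is
    in [upmx (a / c) w0 I_1]. *)
Lemma trace1_K G k : rinv 1 G -> levelI v 0 k -> trace1 G k = trace1 G 1%:M.
Proof.
move=> G1 k0.
have shift h k' : trace1 G (h *m k') = trace1 (fun g => G (h *m g)) k'.
  by congr (_ + _); apply: eq_bigr => t _; rewrite -!mulmxA.
have I1 h k' : h \in unitmx -> levelI v 1 k' -> trace1 G (h *m k') = trace1 G h.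
  move=> uh k1; rewrite shift trace1_levelI1 //; last exact: rinv_mull.
  by rewrite -shift mulmx1.
have w0 h : h \in unitmx -> trace1 G (h *m w0mx F) = trace1 G h.
  move=> uh; rewrite shift trace1_w0 //; last exact: rinv_mull.
  by rewrite -shift mulmx1.
have [a [b [c [d ek]]]] : exists a b c d, k = M2 a b c d.
  by exists (k 0 0), (k 0 1), (k 1 0), (k 1 1); apply: M2K.
have uk := levelI_unit k0.
rewrite {}ek in k0 uk *.
move: k0; rewrite levelI_M2 => /andP[/and4P[ka kb kc kd] udet].
have [c1|c1] := boolP (vge v 1 c).
  rewrite -{1}[M2 a b c d]mul1mx I1 ?unitmx1 // levelI_M2 ka kb kd udet.
  by rewrite c1.
have uc := vunitE Hv kc c1; have c0 := vunit_neq0 uc.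
have ac : vge v 0 (a / c) by apply: (vge0M Hv) => //; apply/vunit_vge/(vunitV Hv).
have Ik : levelI v 1 (M2 c d 0 (b - a / c * d)).
  have uN : vunit v (- (a * d - b * c)) by rewrite /vunit oppr_eq0 (valN Hv).
  apply: levelI_M2_det uN _; rewrite ?vge0 //; last by field.
  by apply: (vgeB Hv) => //; apply: (vge0M Hv).
have -> : M2 a b c d = upmx (a / c) *m w0mx F *m M2 c d 0 (b - a / c * d).
  by rewrite !M2_mul; apply: M2_inj; field.
rewrite I1 ?upw0_unit // w0 ?upmx_unit // -{1}[upmx _]mul1mx I1 ?unitmx1 //.
exact: upmx_levelI.
Qed.

Definition trace n G : V := \sum_(t <- R) G (lowmx (pi ^+ n.-1 * t)) +
  (if n == 1%N then G (w0mx F) else 0).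

Theorem trace_inv n G k : (0 < n)%N -> rinv n G -> levelI v n.-1 k ->
  trace n (fun g => G (k *m g)) = trace n G.
Proof.
rewrite leq_eqVlt => /orP[/eqP <- G1 k0|n1 Gn kn]; last first.
  by rewrite /trace gtn_eqF // !addr0 trace_low.
have tr G' : trace 1 G' = trace1 G' (w0mx F).
  rewrite /trace /trace1 /= addrC; congr (_ + _); apply: eq_bigr => t _.
  by rewrite expr0 mul1r; congr G'; rewrite !M2_mul; apply: M2_inj; ring.
rewrite !tr trace1_w0; last by apply: rinv_mull => //; apply: levelI_unit k0.
have -> : trace1 (fun g => G (k *m g)) 1%:M = trace1 G k.
  by rewrite /trace1 mulmx1; under eq_bigr => t _ do rewrite mul1mx.
by rewrite trace1_K // trace1_w0.
Qed.

End Traces.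

(** * Smooth representations *)

Definition mk_linear (A : fieldType) (U W : lmodType A) (f : U -> W)
  (Hf : linear f) : {linear U -> W} := HB.pack f (GRing.isLinear.Build A U W *:%R f Hf).

Definition val_smooth (F : fieldType) (v : F -> int) (C : fieldType) (V : rep F C) : Prop :=
  forall u : V, exists m : nat, forall h : 'M[F]_2,
    (forall i j, vge v m%:Z (h i j - (1%:M : 'M[F]_2) i j)) -> act V h u = u.

Section Average.
Context (F : fieldType) (v : F -> int) (pi : F) (Hv : valuation_at v pi).
Context (R : seq F) (HR : residues v R) (C : numFieldType) (V : rep F C).
Implicit Types (m n M N : nat) (a b c d x y z t : F) (f g h k : 'M[F]_2).
Implicit Types (u w : V).

Hypothesis Hsmooth : val_smooth v V.

Definition level_fixed n u : Prop := forall k, levelI v n k -> act V k u = u.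
Definition cong_fixed n M u : Prop := forall k, cong v n M k 1%:M -> act V k u = u.

Lemma cong_fixed_le n M N u : (M <= N)%N -> cong_fixed n M u -> cong_fixed n N u.
Proof. by move=> MN uM k kN; apply: uM; apply: (eichler_le Hv) kN. Qed.

Lemma exists_cong_fixed n u : exists2 M, (0 < M)%N & cong_fixed n M u.
Proof.
have [m um] := Hsmooth u; exists m.+1 => // k /and4P[k1 k2 k3 k4].
apply: um => i j; rewrite !mxE in k1 k2 k3 k4 *.
have w e : vge v m.+1%:Z e -> vge v m%:Z e by apply: vge_le; rewrite lez_nat.
case: i j => [[|[|//]] ?] [[|[|//]] ?] /=.
- by move/w: k1; congr (vge _ _ (k _ _ - _)); exact: val_inj.
- by move/w: k2; congr (vge _ _ (k _ _ - _)); exact: val_inj.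
- have {}k3 : vge v m%:Z (k 1 0 - (1 == 0 :> 'I_2)%:R) by apply: vge_le k3; rewrite lez_nat addSn ltnW // ltnS leq_addr.
  by move: k3; congr (vge _ _ (k _ _ - _)); exact: val_inj.
- by move/w: k4; congr (vge _ _ (k _ _ - _)); exact: val_inj.
Qed.

Lemma cong_act n M u g h : cong_fixed n M u -> levelI v n g -> levelI v n h ->
  cong v n M g h -> act V g u = act V h u.
Proof.
move=> uM gn hn gh; have ug := levelI_unit gn; have uh := levelI_unit hn.
have e : g = h *m (invmx h *m g) by rewrite mulKVmx.
rewrite {1}e actM ?unitmx_mul ?unitmx_inv ?uh //; congr (act V h _); apply: uM.
rewrite -(mulVmx uh); apply: (cong_mull Hv) => //.
exact/levelI_eichler/(levelIV Hv).
Qed.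

(** The projection onto the [I_n]-fixed vectors as a finite average in place of a Haar integral; [M]
    only has to be so large that the congruence subgroup fixes [u]. *)
Definition avg n M u : V := (size (reps Hv HR n M))%:R^-1 *: \sum_(s <- reps Hv HR n M) act V s u.

Lemma reps_levelI n M g : (0 < M)%N -> g \in reps Hv HR n M -> levelI v n g.
Proof. by move=> M0; have [_ h _ _] := repsP Hv HR n M0; apply: h. Qed.

Lemma size_reps_neq0 n M : (0 < M)%N -> (size (reps Hv HR n M))%:R != 0 :> C.
Proof. by move=> M0; rewrite pnatr_eq0 -lt0n; apply: (reps_gt0 Hv HR). Qed.

Lemma act_avg n M u k : (0 < M)%N -> cong_fixed n M u -> levelI v n k ->
  act V k (avg n M u) = avg n M u.
Proof.
move=> M0 uM kn; rewrite linearZ linear_sum /=; congr (_ *: _).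
rewrite -[RHS](sum_levelI Hv HR (phi := fun g => k *m g) M0) => [|g gn|g h gn hn|g h gn hn].
- apply: eq_big_seq => s /(reps_levelI M0) sn.
  by rewrite actM ?(levelI_unit kn) ?(levelI_unit sn).
- exact: (levelIM Hv).
- move/(cong_mull Hv (levelI_eichler (levelIV Hv kn))).
  by rewrite !mulKmx ?(levelI_unit kn).
- exact: cong_act.
Qed.

Lemma avg_act n M u k : (0 < M)%N -> cong_fixed n M u -> levelI v n k ->
  avg n M (act V k u) = avg n M u.
Proof.
move=> M0 uM kn; congr (_ *: _).
rewrite -[RHS](sum_levelI Hv HR (phi := fun g => g *m k) M0) => [|g gn|g h gn hn|g h gn hn].
- apply: eq_big_seq => s /(reps_levelI M0) sn.
  by rewrite actM ?(levelI_unit kn) ?(levelI_unit sn).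
- exact: (levelIM Hv gn kn).
- move/(cong_mulr Hv (levelI_eichler (levelIV Hv kn))).
  by rewrite !mulmxK ?(levelI_unit kn).
- exact: cong_act.
Qed.

Lemma avg_fixed n M u : (0 < M)%N -> level_fixed n u -> avg n M u = u.
Proof.
move=> M0 un; rewrite /avg (eq_big_seq (fun=> u)); last first.
  by move=> s /(reps_levelI M0)/un.
by rewrite big_const_seq count_predT iter_addr_0 -scaler_nat scalerA mulVf ?scale1r ?size_reps_neq0.
Qed.

Lemma avg_sum n M (I : Type) (r : seq I) (us : I -> V) :
  avg n M (\sum_(i <- r) us i) = \sum_(i <- r) avg n M (us i).
Proof.
rewrite /avg -scaler_sumr; congr (_ *: _); rewrite exchange_big /=.
by apply: eq_bigr => s _; rewrite linear_sum.
Qed.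

Lemma avgZ n M e u : avg n M (e *: u) = e *: avg n M u.
Proof.
rewrite /avg scalerA mulrC -scalerA; congr (_ *: _); rewrite scaler_sumr.
by apply: eq_bigr => s _; rewrite linearZ.
Qed.

Lemma avgD n M u w : avg n M (u + w) = avg n M u + avg n M w.
Proof.
rewrite /avg -scalerDr -big_split /=; congr (_ *: _).
by apply: eq_bigr => s _; rewrite linearD.
Qed.

(** The double average [avg n M (avg n N u)] can be computed in two ways: the inner average is
    already fixed by [I_n], and the outer one absorbs the action of [I_n]. *)
Lemma avg_level n M N u : (0 < M)%N -> (0 < N)%N -> cong_fixed n M u ->
  cong_fixed n N u -> avg n M u = avg n N u.
Proof.
move=> M0 N0 uM uN; rewrite -[RHS](avg_fixed (n := n) M0); last first.
  by move=> k kn; apply: act_avg.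
rewrite [in RHS]/avg -/(avg n M _) avgZ avg_sum (eq_big_seq (fun=> avg n M u)).
  by rewrite big_const_seq count_predT iter_addr_0 -scaler_nat scalerA mulVf ?scale1r ?size_reps_neq0.
by move=> s /(reps_levelI N0) sn; rewrite avg_act.
Qed.

Definition proj_level n u : nat := projT1 (cid2 (exists_cong_fixed n u)).

Definition proj n u : V := avg n (proj_level n u) u.

Lemma projE n M u : (0 < M)%N -> cong_fixed n M u -> proj n u = avg n M u.
Proof.
move=> M0 uM; rewrite /proj /proj_level; case: cid2 => N N0 uN /=.
exact: avg_level.
Qed.

Lemma proj_linear n : linear (proj n).
Proof.
move=> e u w; have [M M0 uM] := exists_cong_fixed n u; have [N N0 wN] := exists_cong_fixed n w.
have le1 := leq_maxl M N; have le2 := leq_maxr M N.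
have K0 : (0 < maxn M N)%N by rewrite leq_max M0.
have uK := cong_fixed_le le1 uM; have wK := cong_fixed_le le2 wN.
rewrite (projE K0 uK) (projE K0 wK) (projE K0) ?avgD ?avgZ //.
by move=> k kc; rewrite linearP uK ?wK.
Qed.

Lemma proj_fixed n u : level_fixed n (proj n u).
Proof.
have [M M0 uM] := exists_cong_fixed n u; rewrite (projE M0 uM) => k kn.
exact: act_avg.
Qed.

Lemma proj_id n u : level_fixed n u -> proj n u = u.
Proof.
by move=> un; have [M M0 uM] := exists_cong_fixed n u; rewrite (projE M0 uM) avg_fixed.
Qed.

Lemma proj_act n u k : levelI v n k -> proj n (act V k u) = proj n u.
Proof.
move=> kn; have [M M0 uM] := exists_cong_fixed n u.
have [N N0 wN] := exists_cong_fixed n (act V k u).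
have le1 := leq_maxl M N; have le2 := leq_maxr M N.
have K0 : (0 < maxn M N)%N by rewrite leq_max M0.
have uK := cong_fixed_le le1 uM; have wK := cong_fixed_le le2 wN.
by rewrite (projE K0 uK) (projE K0 wK) avg_act.
Qed.

Definition level_inv (W : lmodType C) n (lam : V -> W) : Prop :=
  forall k u, levelI v n k -> lam (act V k u) = lam u.

Lemma level_inv_proj (W : lmodType C) n (lam : {linear V -> W}) u :
  level_inv n lam -> lam (proj n u) = lam u.
Proof.
move=> ln; have [M M0 uM] := exists_cong_fixed n u; rewrite (projE M0 uM).
rewrite /avg linearZ linear_sum /= (eq_big_seq (fun=> lam u)); last first.
  by move=> s /(reps_levelI M0) sn; rewrite /= ln.
by rewrite big_const_seq count_predT iter_addr_0 -scaler_nat scalerA mulVf ?scale1r ?size_reps_neq0.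
Qed.

(** An invariant functional factors through the projection onto the fixed vectors. This allows
    functionals to be treated without the contragredient representation. *)
Lemma level_inv_eq0 (W : lmodType C) n (lam : {linear V -> W}) :
  level_inv n lam -> (forall u, level_fixed n u -> lam u = 0) -> forall u, lam u = 0.
Proof. by move=> ln l0 u; rewrite -(level_inv_proj u ln) l0 //; apply: proj_fixed. Qed.

End Average.

(** * Matrix coefficients and Atkin-Lehner elements *)

Section Coefficients.
Context (F : fieldType) (v : F -> int) (pi : F) (Hv : valuation_at v pi).
Context (R : seq F) (HR : residues v R) (C : numFieldType) (V : rep F C).
Context (W : lmodType C).
Implicit Types (m n M N : nat) (a b c d x y z t : F) (f g h k : 'M[F]_2).
Implicit Types (u w : V) (lam : {linear V -> W}).

Let pi0 : pi != 0 := val_pi_neq0 Hv.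

Definition wmx n : 'M[F]_2 := M2 0 1 (pi ^+ n) 0.

Lemma wmx_unit n : wmx n \in unitmx.
Proof. by rewrite M2_unit mul0r sub0r mul1r oppr_eq0 expf_neq0. Qed.

Lemma invmx_wmx n : invmx (wmx n) = M2 0 (pi ^+ n)^-1 1 0.
Proof.
have pn0 : pi ^+ n != 0 by rewrite expf_neq0.
rewrite -[LHS]mulmx1; apply: (canLR (mulKmx (wmx_unit n))).
by rewrite M2_mul -M2_1; apply: M2_inj; field.
Qed.

Lemma levelI_wmxV n k : levelI v n k -> levelI v n (invmx (wmx n) *m k *m wmx n).
Proof.
have [a [b [c [d ->]]]] : exists a b c d, k = M2 a b c d.
  by exists (k 0 0), (k 0 1), (k 1 0), (k 1 1); apply: M2K.
have pn0 : pi ^+ n != 0 by rewrite expf_neq0.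
rewrite levelI_M2 => /andP[/and4P[ka kb kc kd] u].
have -> : invmx (wmx n) *m M2 a b c d *m wmx n = M2 d ((pi ^+ n)^-1 * c) (pi ^+ n * b) a.
  by rewrite invmx_wmx !M2_mul; apply: M2_inj; field.
apply: levelI_M2_det u _ => //; last by field.
- exact: (vge_piVM Hv).
- exact: (vge_piM Hv).
Qed.

Lemma wmx_low n x : invmx (wmx n) *m lowmx x *m wmx n = upmx ((pi ^+ n)^-1 * x).
Proof.
have pn0 : pi ^+ n != 0 by rewrite expf_neq0.
by rewrite invmx_wmx !M2_mul; apply: M2_inj; field.
Qed.

Lemma wmx1_w0 : invmx (wmx 1) *m w0mx F *m wmx 1 = M2 0 pi^-1 pi 0.
Proof. by rewrite invmx_wmx !M2_mul expr1; apply: M2_inj; field. Qed.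

Lemma act_wmx_fixed n u : level_fixed v n u -> level_fixed v n (act V (wmx n) u).
Proof.
move=> un k kn; have uk := levelI_unit kn.
rewrite -actM ?wmx_unit //.
have -> : k *m wmx n = wmx n *m (invmx (wmx n) *m k *m wmx n).
  by rewrite -mulmxA mulKVmx ?wmx_unit.
by rewrite actM ?unitmx_mul ?unitmx_inv ?wmx_unit ?uk // un // levelI_wmxV.
Qed.

Definition lam_wmx n lam : {linear V -> W} := lam \o act V (invmx (wmx n)).

Lemma level_inv_wmx n lam : level_inv v n lam -> level_inv v n (lam_wmx n lam).
Proof.
move=> ln k u kn; have uk := levelI_unit kn; rewrite /lam_wmx /=.
rewrite -actM ?unitmx_inv ?wmx_unit //.
have -> : invmx (wmx n) *m k = (invmx (wmx n) *m k *m wmx n) *m invmx (wmx n).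
  by rewrite mulmxK ?wmx_unit.
by rewrite actM ?unitmx_mul ?unitmx_inv ?wmx_unit ?uk // ln // levelI_wmxV.
Qed.

Definition new_vec n u : Prop :=
  trace pi R n (fun g => act V g u) = 0 /\
  trace pi R n (fun g => act V g (act V (wmx n) u)) = 0.

(** The inverse makes [g -> lam (g^-1 u)] right invariant under [I_n] for an invariant [lam], as a
    trace over cosets [g I_n] requires. *)
Definition new_lin n lam : Prop :=
  (forall u, trace pi R n (fun g => lam (act V (invmx g) u)) = 0) /\
  (forall u, trace pi R n (fun g => lam_wmx n lam (act V (invmx g) u)) = 0).

Definition coef lam u a b c d : W := lam (act V (M2 a b c d) u).

Lemma coef_biinv m n lam u : level_inv v m lam -> level_fixed v n u ->
  biinv v m n (coef lam u).
Proof.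
move=> ml un.
have E k k' a b c d g : levelI v m k -> levelI v n k' -> a * d - b * c != 0 ->
    k *m M2 a b c d *m k' = g -> lam (act V g u) = coef lam u a b c d.
  move=> km kn D <-; have uk := levelI_unit km; have uk' := levelI_unit kn.
  by rewrite actM ?unitmx_mul ?uk ?M2_unit // un // actM ?M2_unit // ml.
have [I1m I1n] := (levelI1 Hv m, levelI1 Hv n).
split.
- move=> r1 r2 s1 s2 a b c d u1 u2 u3 u4 D.
  apply: (E (M2 r1 0 0 r2) (M2 s1 0 0 s2)) => //.
  + by rewrite levelI_M2 !vge0 !vunit_vge // mul0r subr0 (vunitM Hv).
  + by rewrite levelI_M2 !vge0 !vunit_vge // mul0r subr0 (vunitM Hv).
  + by rewrite !M2_mul; apply: M2_inj; ring.
- move=> x a b c d x0 D; apply: (E (upmx x) 1%:M) => //; first exact: (upmx_levelI Hv).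
  by rewrite mulmx1 M2_mul; apply: M2_inj; ring.
- move=> x a b c d x0 D; apply: (E (lowmx x) 1%:M) => //; first exact: (lowmx_levelI Hv).
  by rewrite mulmx1 M2_mul; apply: M2_inj; ring.
- move=> x a b c d x0 D; apply: (E 1%:M (lowmx x)) => //; first exact: (lowmx_levelI Hv).
  by rewrite mul1mx M2_mul; apply: M2_inj; ring.
- move=> x a b c d x0 D; apply: (E 1%:M (upmx x)) => //; first exact: (upmx_levelI Hv).
  by rewrite mul1mx M2_mul; apply: M2_inj; ring.
Qed.

Lemma sum_residues_opp (X : F -> W) :
  (forall x y, vge v 0 x -> vge v 0 y -> vge v 1 (x - y) -> X x = X y) ->
  \sum_(t <- R) X (- t) = \sum_(t <- R) X t.
Proof.
move=> Xe; apply: (sum_residues Hv HR (phi := -%R)) => //.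
- by move=> x; rewrite (vgeN Hv).
- by move=> x y _ _; rewrite -opprD (vgeN Hv).
Qed.

Lemma trace_lin m lam u : (0 < m)%N -> level_inv v m lam ->
  trace pi R m (fun g => lam (act V (invmx g) u)) =
  \sum_(t <- R) lam (act V (lowmx (pi ^+ m.-1 * t)) u) +
    (if m == 1%N then lam (act V (w0mx F) u) else 0).
Proof.
move=> m0 ml; rewrite /trace w0mxV; congr (_ + _).
rewrite -[RHS]sum_residues_opp => [|x y x0 y0 xy].
  by apply: eq_bigr => t _; rewrite lowmxV mulrN.
have e : lowmx (pi ^+ m.-1 * x) = lowmx (pi ^+ m.-1 * (x - y)) *m lowmx (pi ^+ m.-1 * y).
  by rewrite lowmxD; congr lowmx; ring.
rewrite e actM ?lowmx_unit // ml // (lowmx_levelI Hv) //.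
by have := vgeM Hv (vge_piX Hv m.-1) xy; apply: vge_le; rewrite -PoszD addn1 prednK.
Qed.

Lemma coef_ltrace m lam u : level_inv v m lam -> new_lin m lam ->
  ltrace pi R m (coef lam u).
Proof.
move=> ml [l1 l2].
have T1 : (0 < m)%N -> forall u,
  \sum_(t <- R) lam (act V (lowmx (pi ^+ m.-1 * t)) u) +
    (if m == 1%N then lam (act V (w0mx F) u) else 0) = 0.
  by move=> m0 u'; rewrite -trace_lin.
(* Conjugation by the Atkin-Lehner element turns [lowmx (pi^(m-1) t)] into [upmx (pi^-1 t)], and for
   [m = 1] the Weyl element into the extra representative of [lt_u1]. *)
have T2 : (0 < m)%N -> forall u,
  \sum_(t <- R) lam (act V (upmx (pi^-1 * t)) u) +
    (if m == 1%N then lam (act V (M2 0 pi^-1 pi 0) u) else 0) = 0.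
  move=> m0 u'; have := l2 (act V (wmx m) u').
  rewrite trace_lin //; last exact: level_inv_wmx.
  move=> e; rewrite -[RHS]e; congr (_ + _).
    apply: eq_bigr => t _; rewrite /lam_wmx /= -!actM ?unitmx_inv ?wmx_unit ?lowmx_unit //.
      rewrite mulmxA wmx_low; congr (lam (act V (upmx _) _)).
      case: (m) m0 => // m' _ /=; rewrite exprS; field.
      by rewrite pi0 expf_neq0.
    by rewrite unitmx_mul lowmx_unit wmx_unit.
  case: eqP => // em; rewrite /lam_wmx /= -!actM ?unitmx_inv ?wmx_unit ?w0mx_unit //.
    by rewrite mulmxA em wmx1_w0.
  by rewrite unitmx_mul w0mx_unit wmx_unit.
have A g a b c d : g \in unitmx -> a * d - b * c != 0 ->
    lam (act V g (act V (M2 a b c d) u)) = lam (act V (g *m M2 a b c d) u).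
  by move=> ug D; rewrite actM ?M2_unit.
split.
- move=> m1 a b c d D; have m0 := ltnW m1.
  rewrite -[RHS](T1 m0 (act V (M2 a b c d) u)) gtn_eqF // addr0.
  apply: eq_bigr => t _; rewrite A ?lowmx_unit // M2_mul; congr (lam (act V (M2 _ _ _ _) _)); ring.
- move=> m1 a b c d D; have m0 := ltnW m1.
  rewrite -[RHS](T2 m0 (act V (M2 a b c d) u)) gtn_eqF // addr0.
  apply: eq_bigr => t _; rewrite A ?upmx_unit // M2_mul; congr (lam (act V (M2 _ _ _ _) _)); ring.
- move=> m1 a b c d D; have m0 : (0 < m)%N by rewrite m1.
  rewrite -[RHS](T1 m0 (act V (M2 a b c d) u)) m1 /=; congr (_ + _).
    apply: eq_bigr => t _; rewrite A ?lowmx_unit // M2_mul expr0.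
    congr (lam (act V (M2 _ _ _ _) _)); ring.
  rewrite A ?w0mx_unit // M2_mul; congr (lam (act V (M2 _ _ _ _) _)); ring.
- move=> m1 a b c d D; have m0 : (0 < m)%N by rewrite m1.
  rewrite -[RHS](T2 m0 (act V (M2 a b c d) u)) m1 /=; congr (_ + _).
    apply: eq_bigr => t _; rewrite A ?upmx_unit // M2_mul.
    congr (lam (act V (M2 _ _ _ _) _)); ring.
  rewrite A ?M2_mul; first by congr (lam (act V (M2 _ _ _ _) _)); ring.
    by rewrite M2_unit mul0r sub0r mulVf ?oppr_eq0 ?oner_neq0.
  by [].
Qed.

Lemma coef_rtrace n lam u : (0 < n)%N -> new_vec n u -> rtrace pi R n (coef lam u).
Proof.
move=> n0 [u1 u2].
have T2 : \sum_(t <- R) act V (upmx (pi^-1 * t)) u +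
    (if n == 1%N then act V (M2 0 pi^-1 pi 0) u else 0) = 0.
  have := congr1 (act V (invmx (wmx n))) u2.
  rewrite linear0 /trace linearD linear_sum => e; rewrite -[RHS]e {e}.
  congr (_ + _).
    apply: eq_bigr => t _; rewrite -!actM ?unitmx_inv ?wmx_unit ?lowmx_unit //.
      rewrite wmx_low; congr (act V (upmx _) _).
      case: (n) n0 => // m' _ /=; rewrite exprS; field.
      by rewrite pi0 expf_neq0.
    by rewrite unitmx_mul unitmx_inv lowmx_unit wmx_unit.
  case: eqP => [en|_]; last by rewrite linear0.
  rewrite -!actM ?unitmx_inv ?wmx_unit ?w0mx_unit //.
    by rewrite en wmx1_w0.
  by rewrite unitmx_mul unitmx_inv w0mx_unit wmx_unit.
have A g a b c d : g \in unitmx -> a * d - b * c != 0 ->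
    lam (act V (M2 a b c d) (act V g u)) = lam (act V (M2 a b c d *m g) u).
  by move=> ug D; rewrite actM ?M2_unit.
have L a b c d : a * d - b * c != 0 -> forall X : V, X = 0 -> lam (act V (M2 a b c d) X) = 0.
  by move=> _ X ->; rewrite !linear0.
split.
- move=> n1 a b c d D; rewrite -[RHS](L _ _ _ _ D _ u1) /trace gtn_eqF // addr0 !linear_sum.
  apply: eq_bigr => t _ /=; rewrite A ?lowmx_unit // M2_mul; congr (lam (act V (M2 _ _ _ _) _)); ring.
- move=> n1 a b c d D; rewrite -[RHS](L _ _ _ _ D _ T2) gtn_eqF // addr0 !linear_sum.
  apply: eq_bigr => t _ /=; rewrite A ?upmx_unit // M2_mul; congr (lam (act V (M2 _ _ _ _) _)); ring.
- move=> n1 a b c d D; rewrite -[RHS](L _ _ _ _ D _ u1) /trace n1 /= !linearD !linear_sum.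
  congr (_ + _).
    apply: eq_bigr => t _ /=; rewrite A ?lowmx_unit // M2_mul expr0.
    congr (lam (act V (M2 _ _ _ _) _)); ring.
  rewrite A ?w0mx_unit // M2_mul; congr (lam (act V (M2 _ _ _ _) _)); ring.
- move=> n1 a b c d D; rewrite -[RHS](L _ _ _ _ D _ T2) n1 /= !linearD !linear_sum.
  congr (_ + _).
    apply: eq_bigr => t _ /=; rewrite A ?upmx_unit // M2_mul.
    congr (lam (act V (M2 _ _ _ _) _)); ring.
  rewrite A ?M2_mul; first by congr (lam (act V (M2 _ _ _ _) _)); ring.
    by rewrite M2_unit mul0r sub0r mulVf ?oppr_eq0 ?oner_neq0.
  by [].
Qed.

End Coefficients.

(** * Eigenvectors in finite-dimensional subspaces *)

Section Eigenvector.
Context (C : closedFieldType) (V : lmodType C) (T : {linear V -> V}).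

Definition poly_act (p : {poly C}) (u : V) : V := \sum_(i < size p) p`_i *: iter i T u.

Lemma poly_actE N (p : {poly C}) u : (size p <= N)%N -> poly_act p u = \sum_(i < N) p`_i *: iter i T u.
Proof.
move=> pN; rewrite /poly_act (big_ord_widen N (fun i => p`_i *: iter i T u)) // big_mkcond.
apply: eq_bigr => i _; case: ltnP => // h; by rewrite nth_default // scale0r.
Qed.

Lemma poly_act_factor (q : {poly C}) z u :
  poly_act (q * ('X - z%:P)) u = poly_act q (T u - z *: u).
Proof.
have sN : (size (q * ('X - z%:P))%R <= (size q).+1)%N.
  by apply: leq_trans (size_polyMleq _ _) _; rewrite size_XsubC addn2.
have it i (x y : V) : iter i T (x - z *: y) = iter i T x - z *: iter i T y.
  by elim: i => //= i ->; rewrite linearB linearZ.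
rewrite (poly_actE _ sN) (@poly_actE (size q).+1 q) //.
under eq_bigr => i _ do rewrite mulrBr coefB coefMX mulrC mul_polyC coefZ scalerBl.
under [RHS]eq_bigr => i _ do rewrite it scalerBr scalerA mulrC.
rewrite !sumrB; congr (_ - _); rewrite big_ord_recl /= scale0r add0r.
rewrite big_ord_recr /= nth_default // scale0r addr0.
by apply: eq_bigr => i _; rewrite add0n -iterSr.
Qed.

(** Split off a root [z] of [p]: either [u] is an eigenvector for [z], or [T u - z u] is a non-zero
    vector killed by the cofactor, which has smaller degree. *)
Lemma eigenvector_of_poly (P : V -> Prop) N (p : {poly C}) u :
  (forall z x, P x -> P (T x - z *: x)) -> (size p <= N)%N -> p != 0 ->
  P u -> u != 0 -> poly_act p u = 0 -> exists z x, [/\ P x, x != 0 & T x = z *: x].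
Proof.
move=> PT; elim: N p u => [|N IH] p u; first by rewrite leqn0 size_poly_eq0 => ->.
move=> pN p0 Pu u0 pu0; have [/eqP sp|sp] := boolP (size p == 1).
  move: pu0; rewrite /poly_act sp big_ord1 /= => /eqP; rewrite scaler_eq0 (negPf u0) orbF.
  by have := p0; rewrite -lead_coef_eq0 lead_coefE sp => /negPf->.
have [z /factor_theorem[q pq]] := closed_rootP p sp.
have [e|ne] := eqVneq (T u - z *: u) 0.
  by exists z, u; split=> //; apply/eqP; rewrite -subr_eq0 e.
have q0 : q != 0 by apply: contraNneq p0 => q0; rewrite pq q0 mul0r.
apply: (IH q (T u - z *: u)) => //; [|exact: PT|by rewrite -poly_act_factor -pq].
by move: pN; rewrite pq size_Mmonic ?monicXsubC // size_XsubC addn2.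
Qed.

(** The subspace [P] is known only to lie in the span of [n] vectors, so the first [n + 1] iterates
    of [u] are dependent. The relation between them, read as a polynomial, annihilates [u]. *)
Lemma eigenvector (P : V -> Prop) (u : V) : finite_dim (fun x => P x) ->
  (forall x, P x -> P (T x)) -> (forall z x y, P x -> P y -> P (x + z *: y)) ->
  P u -> u != 0 -> exists z x, [/\ P x, x != 0 & T x = z *: x].
Proof.
move=> [n [e He]] PT PD Pu u0.
have Pit i : P (iter i T u) by elim: i => //= i; apply: PT.
pose A := \matrix_(i < n.+1, j < n) projT1 (cid (He _ (Pit i))) j.
have HA (i : 'I_n.+1) : iter i T u = \sum_j A i j *: e j.
  by under eq_bigr => j _ do rewrite mxE; case: cid.
have : kermx A != 0.
  by rewrite kermx_eq0 /row_free ltn_eqF // ltnS rank_leq_col.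
move=> /rowV0Pn[r /sub_kermxP rA r0].
pose p := \poly_(i < n.+1) r 0 (inord i).
have pi0 i : p`_(nat_of_ord (i : 'I_n.+1)) = r 0 i by rewrite coef_poly ltn_ord inord_val.
apply: (@eigenvector_of_poly P n.+1 p u) => //.
- by move=> z x Px; rewrite -scaleNr; apply: PD => //; apply: PT.
- exact: size_poly.
- apply: contraNneq r0 => p0; apply/eqP/rowP => i.
  by rewrite -pi0 p0 coef0 mxE.
rewrite (poly_actE (N := n.+1)) ?size_poly //.
under eq_bigr => i _ do rewrite pi0 HA scaler_sumr.
rewrite exchange_big big1 // => j _ /=.
under eq_bigr => i _ do rewrite scalerA.
rewrite -scaler_suml; move/rowP/(_ j): rA; rewrite !mxE => ->.
by rewrite scale0r.
Qed.

End Eigenvector.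

Lemma irreducible_ind (F C : fieldType) (V : rep F C) (P : V -> Prop) (u : V) :
  irreducible_rep V -> P 0 -> (forall a x y, P x -> P y -> P (a *: x + y)) ->
  (forall g x, g \in unitmx -> P x -> P (act V g x)) -> P u -> u != 0 ->
  forall x, P x.
Proof.
move=> [_ irr] P0 PD PG Pu u0; have [||W0|WT] := irr (fun x => `[< P x >]).
- by split; [apply/asboolP | move=> a x y /asboolP Px /asboolP Py; apply/asboolP; apply: PD].
- by move=> g ug x /asboolP Px; apply/asboolP; apply: PG.
- by have := W0 u (introT (asboolP _) Pu) => e; rewrite e eqxx in u0.
- by move=> x; apply/asboolP/WT.
Qed.

Lemma invmx_mul (F : fieldType) n (g h : 'M[F]_n) : g \in unitmx -> h \in unitmx ->
  invmx (g *m h) = invmx h *m invmx g.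
Proof.
move=> ug uh; rewrite -[LHS]mulmx1; apply: (canLR (mulKmx _)).
  by rewrite unitmx_mul ug.
by rewrite -mulmxA mulKVmx // mulmxV.
Qed.

(** * Vanishing of the traces at the conductor *)

Section Conductor.
Context (F : fieldType) (v : F -> int) (pi : F) (Hv : valuation_at v pi).
Context (R : seq F) (HR : residues v R).
Implicit Types (m n M N : nat) (a b c d x y z t : F) (f g h k : 'M[F]_2).

Let pi0 : pi != 0 := val_pi_neq0 Hv.

Lemma trace_ext (U : nmodType) n (G G' : 'M[F]_2 -> U) :
  (forall g, g \in unitmx -> G g = G' g) -> trace pi R n G = trace pi R n G'.
Proof.
move=> e; congr (_ + _); last by rewrite e ?w0mx_unit.
by apply: eq_bigr => t _; rewrite e ?lowmx_unit.
Qed.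

Section New.
Context (C : numFieldType) (V : rep F C).
Implicit Types (u w : V).
Hypothesis Hsmooth : val_smooth v V.
Context (n : nat) (n0 : (0 < n)%N).

Lemma trace_act_fixed u : level_fixed v n u ->
  level_fixed v n.-1 (trace pi R n (fun g => act V g u)).
Proof.
move=> un k kn; have uk := levelI_unit kn.
have rn : rinv v n (fun g => act V g u).
  by move=> g h ug hn; rewrite actM ?(levelI_unit hn) // un.
rewrite -[RHS](trace_inv Hv HR n0 rn kn) /trace linearD linear_sum; congr (_ + _).
  by apply: eq_bigr => t _; rewrite actM ?lowmx_unit.
by case: ifP => _; rewrite ?linear0 ?actM ?w0mx_unit.
Qed.

Lemma trace_lin_linear (W : lmodType C) (lam : {linear V -> W}) :
  linear (fun u => trace pi R n (fun g => lam (act V (invmx g) u))).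
Proof.
move=> e u w; rewrite /trace scalerDr addrACA; congr (_ + _).
  by rewrite scaler_sumr -big_split; apply: eq_bigr => t _ /=; rewrite !linearP.
by case: ifP => _; rewrite ?linearP ?scaler0 ?addr0.
Qed.

Lemma trace_lin_inv (W : lmodType C) (lam : {linear V -> W}) : level_inv v n lam ->
  level_inv v n.-1 (fun u => trace pi R n (fun g => lam (act V (invmx g) u))).
Proof.
move=> ln k u kn; have uk := levelI_unit kn.
have rn : rinv v n (fun g => lam (act V (invmx g) u)).
  move=> g h ug hn; have uh := levelI_unit hn.
  by rewrite invmx_mul // actM ?unitmx_inv // ln // (levelIV Hv).
rewrite -[RHS](trace_inv Hv HR n0 rn (levelIV Hv kn)).
apply: trace_ext => g ug.
by rewrite invmx_mul ?unitmx_inv // invmxK actM ?unitmx_inv.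
Qed.

Section Old.
Hypothesis Hold : forall u, level_fixed v n.-1 u -> u = 0.

Lemma new_vec_of_conductor u : level_fixed v n u -> new_vec pi R n u.
Proof.
move=> un; split; apply: Hold; apply: trace_act_fixed => //.
exact: act_wmx_fixed.
Qed.

(** The trace of [lam] is an [I_(n-1)]-invariant functional, and it factors through the fixed
    vectors of that level, which are all zero. *)
Lemma new_lin_of_conductor (W : lmodType C) (lam : {linear V -> W}) :
  level_inv v n lam -> new_lin pi R n lam.
Proof.
have key (mu : {linear V -> W}) : level_inv v n mu ->
    forall u, trace pi R n (fun g => mu (act V (invmx g) u)) = 0.
  move=> ln; apply: (level_inv_eq0 Hv HR Hsmooth (n := n.-1)
    (lam := mk_linear (trace_lin_linear mu))); first exact: trace_lin_inv.
  by move=> u /Hold->; rewrite linear0.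
by move=> ln; split; apply: key => //; apply: (level_inv_wmx Hv).
Qed.

End Old.
End New.
End Conductor.

(** * Multiplicity one *)

Section MultiplicityOne.
Context (F : fieldType) (v : F -> int) (pi : F) (Hv : valuation_at v pi).
Context (R : seq F) (HR : residues v R) (C : numClosedFieldType) (V : rep F C).
Implicit Types (m n M N : nat) (a b c d x y z t : F) (f g h k : 'M[F]_2) (u w : V).

Let pi0 : pi != 0 := val_pi_neq0 Hv.

Hypothesis Virr : irreducible_rep V.
Hypothesis Hsmooth : val_smooth v V.
Context (n : nat).
Hypothesis Hfin : finite_dim (fun u => level_fixed v n u).
Hypothesis Hold : (0 < n)%N -> forall u, level_fixed v n.-1 u -> u = 0.

Lemma coef_newfun (W : lmodType C) (lam : {linear V -> W}) u :
  level_inv v n lam -> level_fixed v n u -> newfun v pi R n n (coef lam u).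
Proof.
move=> ln un; split; first exact: (coef_biinv Hv).
  have [n0|n0] := posnP n; first by rewrite n0; split.
  exact/(coef_ltrace Hv HR _ ln)/(new_lin_of_conductor Hv HR Hsmooth n0 (Hold n0)).
have [n0|n0] := posnP n; first by rewrite n0; split.
exact/(coef_rtrace Hv _ n0)/(new_vec_of_conductor Hv HR n0 (Hold n0)).
Qed.

Definition sig g : 'M[F]_2 :=
  M2 (g 0 0) ((pi ^+ n)^-1 * g 1 0) (pi ^+ n * g 0 1) (g 1 1).

Lemma sig_M2 a b c d : sig (M2 a b c d) = M2 a ((pi ^+ n)^-1 * c) (pi ^+ n * b) d.
Proof. by have [e1 e2 e3 e4] := M2E a b c d; rewrite /sig e1 e2 e3 e4. Qed.

Let pn0 : pi ^+ n != 0. Proof. by rewrite expf_neq0. Qed.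

Lemma sigM g h : sig (g *m h) = sig h *m sig g.
Proof.
by rewrite (M2K g) (M2K h) M2_mul !sig_M2 M2_mul; apply: M2_inj; field.
Qed.

Lemma det_sig g : \det (sig g) = \det g.
Proof. by rewrite det_M2 det2; field. Qed.

Lemma sig_unit g : g \in unitmx -> sig g \in unitmx.
Proof. by rewrite !unitmxE det_sig. Qed.

Lemma sig_levelI g : levelI v n g -> levelI v n (sig g).
Proof.
case/andP => /and4P[g1 g2 g3 g4] gd; apply/andP; split; last by rewrite det_sig.
rewrite eichler_M2 g1 g4 /= andbT; apply/andP; split.
  exact: (vge_piVM Hv).
exact: (vge_piM Hv).
Qed.

Lemma sig_cong M g h : cong v n M (sig g) (sig h) -> cong v n M g h.
Proof.
rewrite /cong; have -> : sig g - sig h = sig (g - h).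
  apply/matrixP => i j; rewrite !mxE.
  by case: i j => [[|[|//]] ?] [[|[|//]] ?] /=; rewrite ?mulrBr.
rewrite eichler_M2 => /and4P[g1 g2 g3 g4]; apply/and4P; split=> //.
- have := vgeM Hv (vge_val v (pi ^+ n)^-1) g3.
  by rewrite mulKf // (valV Hv) // (val_piX Hv) PoszD addrCA addNr addr0.
- have := vgeM Hv (vge_piX Hv n) g2.
  by rewrite mulVKf // -PoszD addnC.
Qed.

Lemma coef_sig (W : lmodType C) (lam : {linear V -> W}) u g :
  level_inv v n lam -> level_fixed v n u -> g \in unitmx ->
  lam (act V (sig g) u) = lam (act V g u).
Proof.
move=> ln un ug; have Hf := coef_newfun ln un.
have D : g 0 0 * g 1 1 - g 0 1 * g 1 0 != 0 by rewrite -det2 -unitfE -unitmxE.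
have := newfun_antisym_eq0 Hv HR (sub_newfun Hf (transpose_newfun Hv Hf)) _ D.
rewrite /coef /transpose -M2K -/(sig g) => e; apply/esym/eqP; rewrite -subr_eq0.
apply/eqP/e => a b c d D'; rewrite opprB; congr (lam (act V _ u) - lam (act V _ u)).
by apply: M2_inj; field.
Qed.

Definition eproj : {linear V -> V} := mk_linear (proj_linear Hv HR Hsmooth n).

Lemma eproj_inv : level_inv v n eproj.
Proof. by move=> k u kn; apply: proj_act. Qed.

Lemma eproj_fixed u : level_fixed v n (eproj u).
Proof. exact: proj_fixed. Qed.

Lemma eproj_id u : level_fixed v n u -> eproj u = u.
Proof. exact: proj_id. Qed.

(* Gelfand's trick: the anti-involution [sig] fixes every coefficient, so that the operators
   [eproj \o act V g] commute on the [I_n]-fixed vectors. *)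
Lemma eproj_comm u g h : level_fixed v n u -> g \in unitmx -> h \in unitmx ->
  eproj (act V g (eproj (act V h u))) = eproj (act V h (eproj (act V g u))).
Proof.
move=> un ug uh.
have [M M0 uM] := exists_cong_fixed Hsmooth n (act V h u).
have [N N0 wN] := exists_cong_fixed Hsmooth n (act V (sig g) u).
have le1 := leq_maxl M N; have le2 := leq_maxr M N.
have K0 : (0 < maxn M N)%N by rewrite leq_max M0.
have {}uM := cong_fixed_le Hv le1 uM; have {}wN := cong_fixed_le Hv le2 wN.
rewrite -(coef_sig eproj_inv un ug) -(coef_sig eproj_inv (eproj_fixed _) uh).
rewrite [eproj (act V h u)](projE Hv HR Hsmooth K0 uM).
rewrite [eproj (act V (sig g) u)](projE Hv HR Hsmooth K0 wN).
rewrite /avg !linearZ; congr (_ *: _); rewrite !linear_sum.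
(* [sig] permutes the classes of [I_n] modulo the congruence subgroup, so the average over [s] may
   be taken over [sig s]; then [sig] reverses the product [g s h]. *)
apply: etrans (sum_levelI Hv HR (n := n) (phi := sig)
  (X := fun s => eproj (act V (sig h) (act V s (act V (sig g) u)))) K0 _ _ _).
- apply: eq_big_seq => s /(reps_levelI K0)/levelI_unit us.
  have E : act V g (act V s (act V h u)) = act V (g *m (s *m h)) u.
    by rewrite !actM ?unitmx_mul ?us ?uh.
  have E' : act V (sig h) (act V (sig s) (act V (sig g) u)) = act V (sig (g *m (s *m h))) u.
    by rewrite !sigM !actM ?unitmx_mul ?sig_unit ?us ?uh.
  rewrite [X in eproj X = _]E [X in _ = eproj X]E' (coef_sig eproj_inv un) //.
  by rewrite !unitmx_mul ug us.
- exact: sig_levelI.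
- by move=> s s' _ _; apply: sig_cong.
- by move=> s s' sn sn' ss; rewrite (cong_act Hv wN sn sn' ss).
Qed.

(** A form of Schur's lemma. Finite dimension provides an eigenvector [x], with eigenvalue [z]. By
    commutation [x] belongs to the vectors [w] such that the operator is [z] on [eproj (act V h w)]
    for all [h]; these form a stable subspace, hence all of [V]. *)
Lemma eproj_scalar g : g \in unitmx ->
  exists e : C, forall u, level_fixed v n u -> eproj (act V g u) = e *: u.
Proof.
move=> ug; have [h|none] := pselect (exists u0 : V, level_fixed v n u0 /\ u0 != 0); last first.
  exists 0 => u un; have [->|u0] := eqVneq u 0; first by rewrite !linear0 ?scaler0.
  by case: none; exists u.
have {h}[u0 [un u0n]] := h.
have Tfix (z : C) (x y : V) : level_fixed v n x -> level_fixed v n y -> level_fixed v n (x + z *: y).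
  by move=> xn yn k kn; rewrite linearD linearZ /= xn // yn.
have [] := @eigenvector C V (eproj \o act V g : {linear V -> V})
  (level_fixed v n) u0 Hfin _ Tfix un u0n.
  by move=> x _; apply: eproj_fixed.
move=> z [x [xn x0 Tx]].
exists z => u nu.
have P (w : V) : forall h, h \in unitmx ->
    eproj (act V g (eproj (act V h w))) = z *: eproj (act V h w).
  apply: (irreducible_ind (P := fun w => forall h, h \in unitmx ->
    eproj (act V g (eproj (act V h w))) = z *: eproj (act V h w)) Virr _ _ _ _ x0).
  - by move=> h uh; rewrite !linear0 ?scaler0.
  - by move=> e y y' yP yP' h uh; rewrite !linearP yP // yP' // scalerDr !scalerA.
  - by move=> k y uk yP h uh; rewrite -actM // yP // unitmx_mul uh.
  - by move=> h uh; rewrite eproj_comm // -linearZ -linearZ -[in RHS]Tx.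
by have := P u 1%:M (unitmx1 _ _); rewrite act1 (eproj_id nu).
Qed.

(** The translates of [u] span [V], and [eproj] sends each of them to a multiple of [u]; so the
    image of [eproj], which contains [w], is a line. *)
Theorem multiplicity_one u w : level_fixed v n u -> u != 0 -> level_fixed v n w ->
  exists e : C, w = e *: u.
Proof.
move=> un u0 wn.
have P (x : V) : forall h, h \in unitmx -> exists e : C, eproj (act V h x) = e *: u.
  apply: (irreducible_ind (P := fun x : V => forall h, h \in unitmx ->
    exists e : C, eproj (act V h x) = e *: u) Virr _ _ _ _ u0).
  - by move=> h uh; exists 0; rewrite !linear0 ?scale0r.
  - move=> e x1 x2 xP yP h uh; have [e1 E1] := xP h uh; have [e2 E2] := yP h uh.
    by exists (e * e1 + e2); rewrite !linearP E1 E2 scalerDl scalerA.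
  - by move=> k x1 uk xP h uh; rewrite -actM //; apply: xP; rewrite unitmx_mul uh.
  - by move=> h uh; have [e E] := eproj_scalar uh; exists e; apply: E.
have [e E] := P w 1%:M (unitmx1 _ _).
by exists e; rewrite -E act1 (eproj_id wn).
Qed.

End MultiplicityOne.

(** * Trilinear forms *)

Section Hecke.
Context (F : fieldType) (v : F -> int) (pi : F) (Hv : valuation_at v pi).
Context (R : seq F) (HR : residues v R) (C : numClosedFieldType).
Implicit Types (m n M N : nat) (a b c d : F) (g h k : 'M[F]_2).

Let pi0 : pi != 0 := val_pi_neq0 Hv.
Let pX0 n : pi ^+ n != 0. Proof. by rewrite expf_neq0. Qed.

Definition Gm m : 'M[F]_2 := M2 (pi ^+ m)^-1 0 0 1.

Lemma Gm_unit m : Gm m \in unitmx.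
Proof. by rewrite M2_unit mulr1 mulr0 subr0 invr_eq0. Qed.

Lemma Gm0 : Gm 0 = 1%:M. Proof. by rewrite /Gm expr0 invr1 M2_1. Qed.

Lemma levelI_Gm m k : levelI v m k -> levelI v 0 (invmx (Gm m) *m k *m Gm m).
Proof.
have [a [b [c [d ->]]]] : exists a b c d, k = M2 a b c d.
  by exists (k 0 0), (k 0 1), (k 1 0), (k 1 1); apply: M2K.
rewrite levelI_M2 => /andP[/and4P[ka kb kc kd] u].
have -> : invmx (Gm m) *m M2 a b c d *m Gm m = M2 a (pi ^+ m * b) ((pi ^+ m)^-1 * c) d.
  rewrite -!mulmxA -[X in _ = X](mulKmx (Gm_unit m)); congr (_ *m _).
  by rewrite !M2_mul; apply: M2_inj; field.
apply: levelI_M2_det u _ => //; last by field.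
- by apply: vge_le (vge_piM Hv m kb); rewrite lez_nat.
- exact: (vge_piVM Hv).
Qed.

Lemma levelI_le m n k : (m <= n)%N -> levelI v n k -> levelI v m k.
Proof.
move=> mn /andP[/and4P[k1 k2 k3 k4] u]; apply/andP; split=> //; apply/and4P; split=> //.
by apply: vge_le k3; rewrite lez_nat !add0n.
Qed.

Lemma Gm_fixed (V : rep F C) m (u : V) :
  level_fixed v 0 u -> level_fixed v m (act V (Gm m) u).
Proof.
move=> u0 k km; have uk := levelI_unit km; rewrite -actM ?Gm_unit //.
have -> : k *m Gm m = Gm m *m (invmx (Gm m) *m k *m Gm m).
  by rewrite -mulmxA mulKVmx ?Gm_unit.
by rewrite actM ?unitmx_mul ?unitmx_inv ?Gm_unit ?uk // u0 // levelI_Gm.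
Qed.

Lemma w0mx_levelI0 : levelI v 0 (w0mx F).
Proof.
by rewrite levelI_M2 !vge0 !(vge1 Hv) mul0r sub0r mulr1 /vunit oppr_eq0 oner_neq0
  (valN Hv) (val1 Hv) eqxx.
Qed.

(** [e] is the eigenvalue of the Hecke operator on the spherical line: for [m = 1] the trace of
    [gamma u] is fixed by [K], hence a multiple of [u]. For larger [m] this relation is translated
    by [gamma^(m-1)]; the trace then lacks the coset of the Weyl element, which accounts for the
    term at [gamma^(m-2)]. *)
Lemma hecke_relation (V : rep F C) (w : F -> C) (u : V) :
  irreducible_rep V ->
  val_smooth v V ->
  finite_dim (fun u : V => level_fixed v 0 u) ->
  central_character V w -> level_fixed v 0 u -> u != 0 ->
  exists e : C, forall m, (0 < m)%N ->
    trace pi R m (fun g => act V g (act V (Gm m) u)) =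
    e *: act V (Gm m.-1) u - (if m == 1%N then 0 else w pi^-1 *: act V (Gm m.-2) u).
Proof.
move=> Virr Hsm Hfin cc uf u0.
have yf := trace_act_fixed Hv HR (ltn0Sn 0) (Gm_fixed (m := 1) uf).
have [//|e E] := multiplicity_one Hv HR Virr Hsm Hfin _ uf u0 yf.
exists e => -[//|[_|m _]]; first by rewrite /= Gm0 act1 subr0.
(* As the Weyl element fixes [u], it may be inserted on the right, and [gamma^(m+1) w0 gamma w0] is
   [pi^-1 gamma^m]. *)
have w0 : act V (Gm m.+1) (act V (w0mx F) (act V (Gm 1) u)) = w pi^-1 *: act V (Gm m) u.
  rewrite -{1}(uf _ w0mx_levelI0) -!actM ?unitmx_mul ?Gm_unit ?w0mx_unit //.
  rewrite -cc ?invr_neq0 // -actM ?Gm_unit //; last first.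
    by rewrite -M2_scalar M2_unit mul0r subr0 mulf_neq0 ?invr_neq0.
  congr (act V _ u); rewrite -M2_scalar /Gm !M2_mul (exprS pi m); apply: M2_inj; field;
  by rewrite ?pi0 ?pX0.
rewrite /trace /= addr0; move: E; rewrite /trace /= => /(canRL (addrK _)) E.
rewrite -w0 -linearZ -linearB -E linear_sum /=; apply: eq_bigr => t _.
rewrite expr0 mul1r -!actM ?unitmx_mul ?Gm_unit ?lowmx_unit //.
congr (act V _ u); rewrite /Gm !M2_mul !(exprS pi m.+1) !(exprS pi m) ?expr0 ?expr1; apply: M2_inj; field; by rewrite ?pi0 ?pX0.
Qed.

Section Trilinear.
Context (V1 V2 V3 : rep F C).
Context (L : V1 -> V2 -> V3 -> C^o).
Hypothesis Ltri : trilinear L.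
Hypothesis Linv : forall g, g \in unitmx -> forall x y z,
  L (act V1 g x) (act V2 g y) (act V3 g z) = L x y z.

Lemma Linv1 g x y z : g \in unitmx ->
  L (act V1 g x) y z = L x (act V2 (invmx g) y) (act V3 (invmx g) z).
Proof.
by move=> ug; rewrite -(Linv (g := invmx g)) ?unitmx_inv // -actM ?unitmx_inv // mulVmx // act1.
Qed.

Definition lin1 y z : {linear V1 -> C^o} :=
  mk_linear (let: And3 t1 _ _ := Ltri in t1 y z).

Definition lin3 x y : {linear V3 -> C^o} :=
  mk_linear (let: And3 _ _ t3 := Ltri in t3 x y).

Definition ell m v1 v2 : {linear V3 -> C^o} := lin3 (act V1 (Gm m) v1) v2.

Lemma ell_inv m v1 v2 : level_fixed v 0 v1 -> level_fixed v 0 v2 ->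
  level_inv v m (ell m v1 v2).
Proof.
move=> f1 f2 k z km; have uk := levelI_unit km; rewrite /= /ell /lin3 /=.
rewrite -[in LHS](Gm_fixed f1 km) -[in LHS](f2 _ (levelI_le (leq0n m) km)).
exact: Linv.
Qed.

(** The coset representatives lie in [K] and fix [v2]. The trace therefore passes from the
    functional to [gamma^m v1], where the Hecke relation expresses it through lower powers of
    [gamma]. *)
Lemma ell_trace m v1 v2 (w1 : F -> C) : (0 < m)%N ->
  irreducible_rep V1 ->
  val_smooth v V1 ->
  finite_dim (fun u : V1 => level_fixed v 0 u) -> central_character V1 w1 ->
  level_fixed v 0 v1 -> v1 != 0 -> level_fixed v 0 v2 ->
  (forall j, (j < m)%N -> forall z, L (act V1 (Gm j) v1) v2 z = 0) ->
  forall z, trace pi R m (fun g => L (act V1 (Gm m) v1) v2 (act V3 (invmx g) z)) = 0.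
Proof.
move=> m0 irr sm fd cc f1 n1 f2 Lj z.
have [e He] := hecke_relation irr sm fd cc f1 n1.
have E g : g \in unitmx -> levelI v 0 g ->
    L (act V1 (Gm m) v1) v2 (act V3 (invmx g) z) =
    lin1 v2 z (act V1 g (act V1 (Gm m) v1)).
  by move=> ug g0; rewrite [RHS]Linv1 // f2 // (levelIV Hv).
have -> : trace pi R m (fun g => L (act V1 (Gm m) v1) v2 (act V3 (invmx g) z)) =
    lin1 v2 z (trace pi R m (fun g => act V1 g (act V1 (Gm m) v1))).
  rewrite /trace linearD linear_sum; congr (_ + _).
    rewrite big_seq [RHS]big_seq; apply: eq_bigr => t tR; rewrite E ?lowmx_unit //.
    apply: (lowmx_levelI Hv); apply: (vge0M Hv); last by case: HR => _ /(_ _ tR).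
    by apply: vge_le (vge_piX Hv _); rewrite lez_nat.
  by case: ifP => _; rewrite ?linear0 // E ?w0mx_unit ?w0mx_levelI0.
have l0 j : (j < m)%N -> lin1 v2 z (act V1 (Gm j) v1) = 0 by move=> /Lj; apply.
rewrite He // linearB linearZ_LR l0 ?prednK // scaler0 sub0r.
case: eqP => m1; first by rewrite linear0 oppr0.
rewrite linearZ_LR l0 ?scaler0 ?oppr0 //.
by case: (m) m0 m1 => [|[|j]] // _ _; rewrite /= ltnW.
Qed.

End Trilinear.
End Hecke.

(** * Vanishing of the trilinear form *)

Section Main.
Context (F : fieldType) (v : F -> int) (pi : F) (Hv : valuation_at v pi).
Context (R : seq F) (HR : residues v R) (C : numClosedFieldType).
Implicit Types (m n M N : nat) (a b c d : F) (g h k : 'M[F]_2).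

Let pi0 : pi != 0 := val_pi_neq0 Hv.
Let pX0 n : pi ^+ n != 0. Proof. by rewrite expf_neq0. Qed.

Lemma ell_eq0_ext (V1 V2 V3 : rep F C) (L : V1 -> V2 -> V3 -> C^o) (w1 : F -> C) v1 v2 :
  trilinear L ->
  (forall g, g \in unitmx -> forall x y z,
     L (act V1 g x) (act V2 g y) (act V3 g z) = L x y z) ->
  irreducible_rep V1 -> irreducible_rep V2 -> central_character V1 w1 ->
  level_fixed v 0 v1 -> v1 != 0 -> level_fixed v 0 v2 -> v2 != 0 ->
  (forall m z, L (act V1 (Gm pi m) v1) v2 z = 0) -> forall x y z, L x y z = 0.
Proof.
move=> Ltri Linv irr1 irr2 cc f1 n1 f2 n2 L0.
have [t1 t2 t3] := Ltri.
(* The set of g with L(g v1, v2, -) = 0 is K-biinvariant; apply [cartan_eq0] to the indicator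
   function of its complement. *)
pose f a b c d : C^o := if `[< forall z, L (act V1 (M2 a b c d) v1) v2 z = 0 >] then 0 else 1.
have fE a b c d a' b' c' d' :
    ((forall z, L (act V1 (M2 a b c d) v1) v2 z = 0) <->
     (forall z, L (act V1 (M2 a' b' c' d') v1) v2 z = 0)) -> f a b c d = f a' b' c' d'.
  by move=> e; rewrite /f; congr (if _ then _ else _); apply: asbool_equiv_eq.
have LK k g : levelI v 0 k -> g \in unitmx ->
    (forall z, L (act V1 (k *m g) v1) v2 z = 0) <-> (forall z, L (act V1 g v1) v2 z = 0).
  move=> k0 ug; have uk := levelI_unit k0; rewrite actM //.
  split=> h z; last first.
    by rewrite (Linv1 Linv) // f2 ?h // (levelIV Hv).
  by rewrite -(Linv k uk) f2 ?h.
have RK k g : levelI v 0 k -> g \in unitmx ->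
    (forall z, L (act V1 (g *m k) v1) v2 z = 0) <-> (forall z, L (act V1 g v1) v2 z = 0).
  by move=> k0 ug; rewrite actM ?(levelI_unit k0) // f1.
have fK k k' a b c d g : levelI v 0 k -> levelI v 0 k' -> a * d - b * c != 0 ->
    k *m M2 a b c d *m k' = g -> f (g 0 0) (g 0 1) (g 1 0) (g 1 1) = f a b c d.
  move=> k0 k0' D <-; apply: fE; rewrite -M2K.
  have uM : M2 a b c d \in unitmx by rewrite M2_unit.
  by rewrite RK ?unitmx_mul ?(levelI_unit k0) ?uM // LK.
have I1 := levelI1 Hv 0.
have fbi : biinv v 0 0 f.
  have M2f a b c d : f a b c d = f (M2 a b c d 0 0) (M2 a b c d 0 1) (M2 a b c d 1 0) (M2 a b c d 1 1).
    by have [-> -> -> ->] := M2E a b c d.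
  split.
  - move=> r1 r2 s1 s2 a b c d u1 u2 u3 u4 D; rewrite M2f.
    apply: (fK (M2 r1 0 0 r2) (M2 s1 0 0 s2)) => //.
    + by rewrite levelI_M2 !vge0 !vunit_vge // mul0r subr0 (vunitM Hv).
    + by rewrite levelI_M2 !vge0 !vunit_vge // mul0r subr0 (vunitM Hv).
    + by rewrite !M2_mul; apply: M2_inj; ring.
  - move=> x a b c d x0 D; rewrite M2f; apply: (fK (upmx x) 1%:M) => //; first exact: (upmx_levelI Hv).
    by rewrite mulmx1 M2_mul; apply: M2_inj; ring.
  - move=> x a b c d x0 D; rewrite M2f; apply: (fK (lowmx x) 1%:M) => //; first exact: (lowmx_levelI Hv).
    by rewrite mulmx1 M2_mul; apply: M2_inj; ring.
  - move=> x a b c d x0 D; rewrite M2f; apply: (fK 1%:M (lowmx x)) => //; first exact: (lowmx_levelI Hv).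
    by rewrite mul1mx M2_mul; apply: M2_inj; ring.
  - move=> x a b c d x0 D; rewrite M2f; apply: (fK 1%:M (upmx x)) => //; first exact: (upmx_levelI Hv).
    by rewrite mul1mx M2_mul; apply: M2_inj; ring.
(* Up to a unit on the right, [diag(x, y)] is the scalar [y] times [gamma^m] with [m = v y - v x];
   the scalar acts through the central character. *)
have diag_le (x y : F) : x != 0 -> y != 0 -> v x <= v y ->
    forall z, L (act V1 (M2 x 0 0 y) v1) v2 z = 0.
  move=> x0 y0 xy z; pose m := `|v y - v x|%N.
  have vm : m%:Z = v y - v x by rewrite /m; lia.
  have uu : vunit v (x * pi ^+ m / y).
    apply: (vunit_div Hv); rewrite ?mulf_neq0 //.
    by rewrite (valM Hv) // (val_piX Hv) vm addrC subrK.
  have e : M2 x 0 0 y = y%:M *m Gm pi m *m M2 (x * pi ^+ m / y) 0 0 1.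
    by rewrite -M2_scalar /Gm !M2_mul; apply: M2_inj; field; rewrite ?y0 ?pX0.
  have u1 : (y%:M : 'M[F]_2) \in unitmx by rewrite -M2_scalar M2_unit mul0r subr0 mulf_neq0.
  have Ik : levelI v 0 (M2 (x * pi ^+ m / y) 0 0 1).
    apply: (levelI_M2_det _ _ _ _ uu); rewrite ?vge0 ?(vge1 Hv) ?vunit_vge //.
    by rewrite mulr1 mul0r subr0.
  rewrite e actM ?unitmx_mul ?u1 ?(Gm_unit Hv) ?(levelI_unit Ik) // f1 // actM ?(Gm_unit Hv) //.
  have lL := linearZ_LR (lin1 Ltri v2 z) (w1 y) (act V1 (Gm pi m) v1).
  by rewrite (cc _ y0) [LHS]lL [X in _ *: X]L0 scaler0.
have fdiag (x y : F) : x != 0 -> y != 0 -> f x 0 0 y = 0.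
  move=> x0 y0; rewrite /f asboolT // => z.
  (* The opposite order of valuations is reached by conjugating with the Weyl element of [K]. *)
  have [xy|yx] := leP (v x) (v y); first exact: diag_le.
  have e : M2 x 0 0 y = w0mx F *m M2 y 0 0 x *m w0mx F.
    by rewrite !M2_mul; apply: M2_inj; ring.
  move: z; rewrite e.
  have uM : M2 y 0 0 x \in unitmx by rewrite M2_unit mul0r subr0 mulf_neq0.
  have w00 := w0mx_levelI0 Hv.
  rewrite RK ?unitmx_mul ?w0mx_unit ?uM // LK //.
  by apply: diag_le => //; apply: ltW.
have Lg g z : g \in unitmx -> L (act V1 g v1) v2 z = 0.
  move=> ug; have D : g 0 0 * g 1 1 - g 0 1 * g 1 0 != 0 by rewrite -det2 -unitfE -unitmxE.
  have := cartan_eq0 Hv HR fbi fdiag D; rewrite /f -M2K; case: asboolP => // _ /eqP.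
  by rewrite oner_eq0.
have lin (y : V2) (z : V3) : forall (a : C) (x x' : V1), L (a *: x + x') y z = a *: L x y z + L x' y z by move=> *; apply: t1.
have lin0 (y : V2) (z : V3) : L 0 y z = 0 by have := linear0 (lin1 Ltri y z).
have lin' (x : V1) (z : V3) : forall (a : C) (y y' : V2), L x (a *: y + y') z = a *: L x y z + L x y' z by move=> *; apply: t2.
have lin'0 (x : V1) (z : V3) : L x 0 z = 0 by have := linear0 (mk_linear (t2 x z)).
(* The quantifier over [h] makes the condition stable under the group, so that it spreads from [v1]
   to all of [V1]. *)
have L1 (x : V1) : forall h z, h \in unitmx -> L (act V1 h x) v2 z = 0.
  apply: (irreducible_ind (P := fun x : V1 => forall h z, h \in unitmx -> L (act V1 h x) v2 z = 0)
    irr1 _ _ _ _ n1).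
  - by move=> h z uh; rewrite linear0.
  - by move=> a y y' yP yP' h z uh; rewrite linearP lin yP // yP' // scaler0 addr0.
  - by move=> g y ug yP h z uh; rewrite -actM // yP // unitmx_mul uh.
  - by move=> h z uh; apply: Lg.
have L2 (y : V2) : forall h x z, h \in unitmx -> L x (act V2 h y) z = 0.
  apply: (irreducible_ind (P := fun y : V2 => forall h x z, h \in unitmx -> L x (act V2 h y) z = 0)
    irr2 _ _ _ _ n2).
  - by move=> h x z uh; rewrite linear0.
  - by move=> a y1 y2 yP yP' h x z uh; rewrite linearP lin' yP // yP' // scaler0 addr0.
  - by move=> g y1 ug yP h x z uh; rewrite -actM // yP // unitmx_mul uh.
  - move=> h x z uh; rewrite -(Linv (invmx h)) ?unitmx_inv // -(actM (h := h)) ?unitmx_inv //.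
    by rewrite mulVmx // act1 L1 // unitmx_inv.
by move=> x y z; rewrite -(act1 y) L2 ?unitmx1.
Qed.

Theorem test_vector (V1 V2 V3 : rep F C) (L : V1 -> V2 -> V3 -> C^o) (w1 w2 : F -> C)
    n (v1 : V1) (v2 : V2) (v3 : V3) :
  trilinear L ->
  (forall g, g \in unitmx -> forall x y z,
     L (act V1 g x) (act V2 g y) (act V3 g z) = L x y z) ->
  irreducible_rep V1 -> irreducible_rep V2 -> irreducible_rep V3 ->
  val_smooth v V1 -> val_smooth v V2 -> val_smooth v V3 ->
  (forall n, finite_dim (fun u : V1 => level_fixed v n u)) ->
  (forall n, finite_dim (fun u : V2 => level_fixed v n u)) ->
  (forall n, finite_dim (fun u : V3 => level_fixed v n u)) ->
  central_character V1 w1 -> central_character V2 w2 ->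
  level_fixed v 0 v1 -> v1 != 0 -> level_fixed v 0 v2 -> v2 != 0 ->
  level_fixed v n v3 -> v3 != 0 ->
  (forall m, (m < n)%N -> forall u : V3, level_fixed v m u -> u = 0) ->
  L (act V1 (Gm pi n) v1) v2 v3 = 0 -> forall x y z, L x y z = 0.
Proof.
move=> Ltri Linv irr1 irr2 irr3 sm1 sm2 sm3 fd1 fd2 fd3 cc1 cc2 f1 n1 f2 n2 f3 n3 old L0.
have linv m : level_inv v m (ell pi Ltri m v1 v2) by apply: ell_inv.
apply: (ell_eq0_ext Ltri Linv irr1 irr2 cc1 f1 n1 f2 n2) => m.
(* The induction is strong because the Hecke relation reaches back two levels. *)
have [j] := ubnP m; elim: j m => // j IH m mj.
have {}IH i : (i < m)%N -> forall z, L (act V1 (Gm pi i) v1) v2 z = 0.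
  by move=> im; apply: IH; exact: leq_trans im mj.
have [mn|nm|mn] := ltngtP m n.
- apply: (level_inv_eq0 Hv HR sm3 (linv m)) => u /(old _ mn) ->.
  exact: linear0.
- have m0 : (0 < m)%N by case: (m) nm.
  have new : new_lin pi R m (ell pi Ltri m v1 v2).
    split=> z; first exact: (ell_trace Hv HR Ltri Linv m0 irr1 sm1 (fd1 _) cc1 f1 n1 f2 IH).
    pose L' y x z := L x y z.
    have Ltri' : trilinear L' by case: (Ltri) => t1 t2 t3; split=> *; [apply: t2 | apply: t1 | apply: t3].
    have Linv' g : g \in unitmx -> forall x y z,
      L' (act V2 g x) (act V1 g y) (act V3 g z) = L' x y z by move=> ug *; apply: Linv.
    (* The Atkin-Lehner element exchanges the roles of [V1] and [V2]. *)
    have E i z' : L (act V1 (Gm pi i) v1) v2 (act V3 (invmx (wmx pi i)) z') =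
        w2 (pi ^+ i) *: L' (act V2 (Gm pi i) v2) v1 z'.
      have uw := wmx_unit Hv i.
      have w00 := w0mx_levelI0 Hv.
      rewrite -(Linv (wmx pi i) uw) -(@actM _ _ V3 _ _ uw) ?unitmx_inv // mulmxV // act1.
      (* Since [wmx i] times [gamma^i] is the Weyl element and [wmx i] equals [pi^i gamma^i w0],
         this translation takes [gamma^i] away from [v1] and puts it on [v2], up to a central
         scalar. *)
      have -> : act V1 (wmx pi i) (act V1 (Gm pi i) v1) = v1.
        rewrite -actM ?(Gm_unit Hv) // -[RHS](f1 _ w00); congr (act V1 _ v1).
        by rewrite !M2_mul; apply: M2_inj; field.
      have u1 : ((pi ^+ i)%:M : 'M[F]_2) \in unitmx.
        by rewrite -M2_scalar M2_unit mul0r subr0 mulf_neq0.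
      have -> : act V2 (wmx pi i) v2 = w2 (pi ^+ i) *: act V2 (Gm pi i) v2.
        rewrite -cc2 // -[in RHS](f2 _ w00) -!actM ?unitmx_mul ?(Gm_unit Hv) ?w0mx_unit //.
          by congr (act V2 _ v2); rewrite -M2_scalar !M2_mul; apply: M2_inj; field; rewrite pX0.
        by rewrite u1.
      exact: (linearZ_LR (lin1 Ltri' v1 z')).
    (* The central character has no zeros because scalar matrices act invertibly. *)
    have w2n i : w2 (pi ^+ i) != 0.
      apply: contraNneq n2 => w0; have := cc2 (pi ^+ i)^-1.
      rewrite invr_neq0 // => /(_ isT) h; have := cc2 _ (pX0 i) (act V2 ((pi ^+ i)^-1)%:M v2).
      rewrite w0 scale0r -actM; last first.
      + by rewrite -M2_scalar M2_unit mul0r subr0 mulf_neq0 ?invr_neq0.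
      + by rewrite -M2_scalar M2_unit mul0r subr0 mulf_neq0.
      by rewrite -scalar_mxM mulfV // act1 => ->.
    have IH' i : (i < m)%N -> forall z, L' (act V2 (Gm pi i) v2) v1 z = 0.
      move=> im z'; have := E i z'; rewrite IH // => /esym/eqP.
      by rewrite scaler_eq0 (negPf (w2n i)) => /eqP.
    have T := ell_trace Hv HR Ltri' Linv' m0 irr2 sm2 (fd2 _) cc2 f2 n2 f1 IH' z.
    rewrite (@trace_ext _ pi R _ m _ (fun g => w2 (pi ^+ m) *: L' (act V2 (Gm pi m) v2) v1 (act V3 (invmx g) z))).
      move: T; rewrite /trace => T; rewrite -scaler_sumr.
      move: T; case: ifP => _; last by rewrite !addr0 => ->; rewrite scaler0.
      by rewrite -scalerDr => ->; rewrite scaler0.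
    by move=> g ug; apply: E.
  have vec : newfun v pi R m n (coef (ell pi Ltri m v1 v2) v3).
    split; first exact: (coef_biinv Hv).
      exact: (coef_ltrace Hv HR _ (linv m) new).
    have [n0|n0] := posnP n; first by rewrite n0; split.
    apply: (coef_rtrace Hv _ n0); apply: (new_vec_of_conductor Hv HR n0) => //.
    by apply: old; rewrite prednK.
  have V0 g : g \in unitmx -> ell pi Ltri m v1 v2 (act V3 g v3) = 0.
    move=> ug; have D : g 0 0 * g 1 1 - g 0 1 * g 1 0 != 0 by rewrite -det2 -unitfE -unitmxE.
    by have := newfun_level_gt Hv HR nm vec D; rewrite /coef -M2K.
  have P (u : V3) : forall h, h \in unitmx -> ell pi Ltri m v1 v2 (act V3 h u) = 0.
    apply: (irreducible_ind (P := fun u : V3 => forall h, h \in unitmx ->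
      ell pi Ltri m v1 v2 (act V3 h u) = 0) irr3 _ _ _ _ n3) => //.
    + by move=> h uh; rewrite !linear0.
    + by move=> a y y' yP yP' h uh; rewrite !linearP yP // yP' // scaler0 addr0.
    + by move=> g y ug yP h uh; rewrite -actM // yP // unitmx_mul uh.
  by move=> z; have := P z _ (unitmx1 _ _); rewrite act1.
apply: (level_inv_eq0 Hv HR sm3 (linv m)) => u; rewrite mn => un.
have old' : (0 < n)%N -> forall u : V3, level_fixed v n.-1 u -> u = 0.
  by move=> n0; apply: old; rewrite prednK.
have [e ->] := multiplicity_one Hv HR irr3 sm3 (fd3 n) old' f3 n3 un.
rewrite linearZ_LR; have -> : ell pi Ltri n v1 v2 v3 = 0 by exact: L0.
by rewrite scaler0.
Qed.

End Main.

(** * The valuation of a finite extension of Q_p *)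

Section Padic.
Context (p : nat) (p_prime : prime p) (Qp : fieldType) (absp : Qp -> rat).
Context (H : is_padic_field p absp).
Implicit Types (x y : Qp).

Lemma abs0 : absp 0 = 0. Proof. exact/(absp_eq0 H). Qed.

Lemma abs_neq0 x : x != 0 -> absp x != 0.
Proof. by apply: contraNneq => /(absp_eq0 H) ->. Qed.

Lemma abs_gt0 x : x != 0 -> 0 < absp x.
Proof. by move=> x0; rewrite lt_def abs_neq0 // (absp_ge0 H). Qed.

Lemma abs1 : absp 1 = 1.
Proof.
have := abspM H 1 1; rewrite mulr1 => /esym /(canRL (mulfK (abs_neq0 (oner_neq0 _)))).
by rewrite mulfV // abs_neq0 ?oner_neq0.
Qed.

Lemma absN x : absp (- x) = absp x.
Proof.
suff e : absp (-1) = 1 by rewrite -mulN1r (abspM H) e mul1r.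
have := abspM H (-1) (-1); rewrite mulrNN mulr1 abs1 => /esym/eqP.
rewrite -expr2 sqrf_eq1 => /orP[/eqP//|/eqP e].
by have := absp_ge0 H (-1); rewrite e.
Qed.

Lemma absV x : x != 0 -> absp x^-1 = (absp x)^-1.
Proof.
move=> x0; apply: (mulfI (abs_neq0 x0)).
by rewrite -(abspM H) !mulfV ?abs_neq0 // abs1.
Qed.

Lemma absD_le e x y : absp x <= e -> absp y <= e -> absp (x + y) <= e.
Proof. by move=> xe ye; apply: le_trans (abspD H _ _) _; rewrite ge_max xe. Qed.

Lemma absD_lt e x y : absp x < e -> absp y < e -> absp (x + y) < e.
Proof. by move=> xe ye; apply: le_lt_trans (abspD H _ _) _; rewrite gt_max xe. Qed.

Lemma absX x k : absp (x ^+ k) = absp x ^+ k.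
Proof. by elim: k => [|k IH]; rewrite ?expr0 ?abs1 // !exprS (abspM H) IH. Qed.

Lemma abs_p : absp p%:R = p%:R^-1.
Proof.
have p0 := prime_gt0 p_prime.
have := absp_ratr H (p%:Z)%:~R; rewrite ratr_int => ->; rewrite /padic_norm.
rewrite denq_int numq_int intr_eq0 /= logn1 logn_prime // eqxx sub0r exprN1.
by rewrite eqz_nat eqn0Ngt p0.
Qed.

Lemma pQ_neq0 : p%:R != 0 :> Qp.
Proof.
apply/negP => /eqP e; have := abs_p; rewrite e abs0 => /esym/eqP.
by rewrite invr_eq0 pnatr_eq0 -leqn0 leqNgt prime_gt0.
Qed.

Lemma abs_p_gt0 : 0 < absp p%:R. Proof. exact/abs_gt0/pQ_neq0. Qed.

Lemma abs_p_half : absp p%:R <= 2^-1.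
Proof. by rewrite abs_p lef_pV2 ?posrE ?ltr0n ?prime_gt0 // ler_nat prime_gt1. Qed.

Lemma abs_p_lt1 : absp p%:R < 1.
Proof. by apply: le_lt_trans abs_p_half _. Qed.

Lemma abs_nat n : absp n%:R <= 1.
Proof.
by elim: n => [|n IH]; rewrite ?abs0 // -addn1 natrD absD_le // abs1.
Qed.

Lemma abs_int (z : int) : absp z%:~R <= 1.
Proof. by case: z => n; rewrite ?NegzE ?mulrNz ?absN abs_nat. Qed.

Lemma abs_dvd (z : int) : (p%:Z %| z)%Z -> absp z%:~R <= absp p%:R.
Proof.
move=> /dvdzP[q ->]; rewrite intrM (abspM H) -[leRHS]mul1r ler_wpM2r ?(absp_ge0 H) //.
exact: abs_int.
Qed.

(** By Bezout, [absp z < 1] would give [1 = a p + b z] an absolute value below 1. *)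
Lemma abs_ndvd (z : int) : ~~ (p%:Z %| z)%Z -> absp z%:~R = 1.
Proof.
move=> nd; apply/eqP; rewrite eq_le abs_int /= leNgt; apply/negP => lt1.
have co : coprimez p z by rewrite coprimezE prime_coprime.
have /coprimezP[[a b] /= e] := co.
have : absp ((a * p%:Z + b * z)%:~R) < 1.
  rewrite intrD !intrM; apply: absD_lt; rewrite (abspM H).
    by apply: le_lt_trans abs_p_lt1; rewrite -[leRHS]mul1r ler_wpM2r ?(absp_ge0 H) // abs_int.
  by apply: le_lt_trans lt1; rewrite -[leRHS]mul1r ler_wpM2r ?(absp_ge0 H) // abs_int.
by rewrite e abs1 ltxx.
Qed.

Lemma abs_rat_den (q : rat) : absp (ratr q) <= 1 -> ~~ (p%:Z %| denq q)%Z.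
Proof.
move=> q1; apply/negP => dd; have d0 : (denq q)%:~R != 0 :> Qp.
  apply/negP => /eqP e.
  have := absp_ratr H ((denq q)%:~R); rewrite ratr_int e abs0 /padic_norm intr_eq0.
  rewrite (negPf (denq_neq0 q)) => /esym/eqP; rewrite expfz_eq0 => /andP[_].
  by rewrite pnatr_eq0 -leqn0 leqNgt prime_gt0.
have nn : ~~ (p%:Z %| numq q)%Z.
  apply/negP => nd; have := coprime_num_den q; rewrite /coprime => /eqP g1.
  have : (p %| gcdn `|numq q| `|denq q|)%N by rewrite dvdn_gcd; apply/andP.
  by rewrite g1 dvdn1 => /eqP p1; have := prime_gt1 p_prime; rewrite p1.
move: q1; rewrite /ratr (abspM H) absV // (abs_ndvd nn) mul1r.
rewrite invf_le1 ?abs_gt0 // leNgt => /negP; apply.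
by apply: le_lt_trans abs_p_lt1; apply: abs_dvd.
Qed.

(** A rational approximation of [x] has a denominator prime to [p], which Bezout inverts modulo
    [p]. *)
Lemma abs_residue x : absp x <= 1 -> exists2 c, (c < p)%N & absp (x - c%:R) < 1.
Proof.
move=> x1; have [q xq] := absp_dense H x (ltr01 : (0 : rat) < 1).
have q1 : absp (ratr q) <= 1.
  by rewrite -(subrK x (ratr q)) absD_le // -opprB absN ltW.
have nd := abs_rat_den q1.
have dq1 : absp (denq q)%:~R = 1 := abs_ndvd nd.
have co : coprimez (denq q) p by rewrite coprimez_sym coprimezE prime_coprime.
have /coprimezP[[a b] /= e] := co.
pose c := ((a * numq q) %% p)%Z.
have c0 : 0 <= c by rewrite modz_ge0 // eqz_nat -lt0n prime_gt0.
have cp : c < p by rewrite ltz_pmod // ltz_nat prime_gt0.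
exists `|c|%N; first by lia.
have ec : (`|c|%N%:R : Qp) = c%:~R by rewrite -[in RHS](gez0_abs c0).
rewrite ec -(subrK (ratr q) x) -addrA absD_lt //.
have d0 : (denq q)%:~R != 0 :> Qp.
  by apply/negP => /eqP e0; move: dq1; rewrite e0 abs0 => /eqP; rewrite eq_sym oner_eq0.
rewrite (_ : ratr q - c%:~R = (numq q - c * denq q)%:~R / (denq q)%:~R); last first.
  by rewrite /ratr intrB intrM mulrBl mulfK.
rewrite (abspM H) absV // dq1 invr1 mulr1; apply: le_lt_trans abs_p_lt1.
apply: abs_dvd; apply/dvdzP.
exists (b * numq q + ((a * numq q) %/ p)%Z * denq q).
have E : (a * numq q = ((a * numq q) %/ p)%Z * p + c)%Z by apply: divz_eq.
have -> : c = a * numq q - ((a * numq q) %/ p)%Z * p by rewrite [X in X - _]E addrAC subrr add0r.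
have e' : b * p = 1 - a * denq q by rewrite -e; ring.
rewrite [RHS]mulrDl (mulrC b) -(mulrA _ b) e'; ring.
Qed.

(** Discreteness of the absolute value: a rational number closer to [x] than [absp x] has at least
    the absolute value of [x], and its numerator is divisible by [p]. *)
Lemma abs_div_p x : absp x < 1 -> absp (x / p%:R) <= 1.
Proof.
move=> x1; have [->|x0] := eqVneq x 0; first by rewrite mul0r abs0.
have [q xq] := absp_dense H x (abs_gt0 x0).
have q1 : absp (ratr q) < 1.
  by rewrite -(subrK x (ratr q)) absD_lt // -opprB absN (lt_trans xq).
have xleq : absp x <= absp (ratr q).
  rewrite leNgt; apply/negP => qx; have := absD_lt xq qx.
  by rewrite subrK ltxx.
have nd := abs_rat_den (ltW q1); have dq1 := abs_ndvd nd.
have d0 : (denq q)%:~R != 0 :> Qp.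
  by apply/negP => /eqP e0; move: dq1; rewrite e0 abs0 => /eqP; rewrite eq_sym oner_eq0.
have eq : absp (ratr q) = absp (numq q)%:~R by rewrite /ratr (abspM H) absV // dq1 invr1 mulr1.
have dn : (p%:Z %| numq q)%Z.
  by apply/negPn/negP => /abs_ndvd e; move: q1; rewrite eq e ltxx.
rewrite (abspM H) absV ?pQ_neq0 // ler_pdivrMr ?abs_p_gt0 // mul1r.
by apply: le_trans xleq _; rewrite eq; apply: abs_dvd.
Qed.

Lemma abs_small x : (forall j, absp x <= absp p%:R ^+ j) -> x = 0.
Proof.
move=> xj; apply/eqP; apply/negPn/negP => x0; have xp := abs_gt0 x0.
have := archi_boundP (ltW (_ : 0 < (absp x)^-1)); rewrite invr_gt0 => /(_ xp).
set N := Num.bound _ => lt.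
have h : absp p%:R ^+ N <= 2^-1 ^+ N.
  by rewrite lerXn2r ?nnegrE ?(absp_ge0 H) ?invr_ge0 // abs_p_half.
have := le_trans (xj N) h; rewrite exprVn => h2.
have : (absp x)^-1 < (absp x)^-1.
  apply: (lt_le_trans lt); apply: (@le_trans _ _ (2 ^+ N)).
    by rewrite -natrX ler_nat ltnW // ltn_expl.
  by rewrite -(invrK (2 ^+ N)) lef_pV2 ?posrE ?invr_gt0 ?exprn_gt0.
by rewrite ltxx.
Qed.

(** The ring [Z_p]. The proof is an argument so that the closure properties can be registered as an
    instance depending on it. *)
Definition zp (_ : is_padic_field p absp) : {pred Qp} := fun x => absp x <= 1.

Lemma zp_subring : subring_closed (zp H).
Proof.
split; rewrite ?unfold_in ?abs1 // => x y; rewrite !unfold_in => x1 y1.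
  by apply: absD_le; rewrite ?absN.
by rewrite (abspM H) mulr_ile1 // (absp_ge0 H).
Qed.

End Padic.

HB.instance Definition _ (p : nat) (Qp : fieldType) (absp : Qp -> rat)
    (H : is_padic_field p absp) :=
  GRing.isSubringClosed.Build Qp (zp H) (zp_subring H).

Record padic_int (p : nat) (Qp : fieldType) (absp : Qp -> rat)
  (H : is_padic_field p absp) := PadicInt { zval : Qp; _ : zval \in zp H }.

Section PadicInt.
Context (p : nat) (Qp : fieldType) (absp : Qp -> rat) (H : is_padic_field p absp).
HB.instance Definition _ := [isSub for @zval p Qp absp H].
HB.instance Definition _ := [Choice of padic_int H by <:].
HB.instance Definition _ := [SubChoice_isSubComNzRing of padic_int H by <:].

Context (F : fieldExtType Qp).
Definition zp_in : padic_int H -> F := in_alg F \o val.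
HB.instance Definition _ := GRing.RMorphism.on zp_in.

(** Transfers the ring operations of an integral closure to [ringO]: polynomials over [Qp] with
    coefficients in [Z_p] become polynomials over the ring type [padic_int]. *)
Lemma ringO_integral x : ringO absp x <-> integralOver zp_in x.
Proof.
split=> [[q [q1 q2 q3]]|[q q1 q2]].
  have qz i : q`_i \in zp H by rewrite unfold_in q2.
  pose q' : {poly padic_int H} := \poly_(i < size q) PadicInt (qz i).
  have e : map_poly val q' = q.
    apply/polyP => i; rewrite coef_map_id0 ?rmorph0 // coef_poly.
    case: ltnP => //= h; by rewrite nth_default.
  exists q'.
    rewrite monicE -(inj_eq val_inj) rmorph1 -lead_coef_map_inj ?e ?(monicP q1) //.
    exact: val_inj.
  by rewrite map_poly_comp e.
exists (map_poly val q); split.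
- by rewrite monic_map.
- by move=> i; rewrite coef_map; have := valP q`_i; rewrite unfold_in.
- by rewrite -map_poly_comp.
Qed.
End PadicInt.

(** * The ring of integers and divisibility by the uniformizer *)

Section LocalField.
Context (p : nat) (p_prime : prime p) (Qp : fieldType) (absp : Qp -> rat).
Context (H : is_padic_field p absp) (F : fieldExtType Qp).
Notation O := (@ringO Qp absp F).

Lemma ringO0 : O 0. Proof. by apply/(ringO_integral H)/integral0. Qed.
Lemma ringO1 : O 1. Proof. by apply/(ringO_integral H)/integral1. Qed.
Lemma ringOD x y : O x -> O y -> O (x + y).
Proof. by move=> /(ringO_integral H) a /(ringO_integral H) b; apply/(ringO_integral H)/integral_add. Qed.
Lemma ringOM x y : O x -> O y -> O (x * y).
Proof. by move=> /(ringO_integral H) a /(ringO_integral H) b; apply/(ringO_integral H)/integral_mul. Qed.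
Lemma ringON x : O x -> O (- x).
Proof. by move=> /(ringO_integral H) a; apply/(ringO_integral H)/integral_opp. Qed.
Lemma ringOX x n : O x -> O (x ^+ n).
Proof. by move=> Ox; elim: n => [|n IH]; rewrite ?expr0 ?exprS; [exact: ringO1 | exact: ringOM]. Qed.
Lemma ringO_sum (I : Type) (r : seq I) (X : I -> F) : (forall i, O (X i)) -> O (\sum_(i <- r) X i).
Proof.
by move=> OX; elim: r => [|i r IH]; rewrite ?big_nil ?big_cons; [exact: ringO0 | exact: ringOD].
Qed.

Lemma ringO_scalar k : absp k <= 1 -> O (k%:A).
Proof.
move=> k1; exists ('X - k%:P); split; first exact: monicXsubC.
  move=> i; rewrite coefB coefX coefC; apply: (absD_le H); last first.
    by rewrite (absN H); case: ifP; rewrite ?(abs0 H).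
  by case: eqP => _; rewrite ?(abs1 H) ?(abs0 H).
by rewrite map_polyXsubC root_XsubC.
Qed.

(* Z_p is integrally closed: the leading term dominates when |k| > 1. *)
Lemma ringO_scalar_le k : O (k%:A) -> absp k <= 1.
Proof.
case=> q [qm q1]; rewrite (fmorph_root (in_alg F)) => /rootP qk.
rewrite leNgt; apply/negP => k1.
have k0 : 0 < absp k by apply: lt_trans k1.
have sq : size q = (size q).-1.+1 by rewrite prednK // lt0n size_poly_eq0 monic_neq0.
move: qk; rewrite horner_coef sq big_ord_recr /= -lead_coefE (monicP qm) mul1r.
set d := (size q).-1 => /eqP; rewrite addrC addr_eq0 => /eqP e.
have : absp (k ^+ d) < absp k ^+ d.
  rewrite e (absN H); elim/big_rec: _ => [|i y _ yd].
    by rewrite (abs0 H) exprn_gt0.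
  apply: (absD_lt H) yd; rewrite (abspM H) (absX H).
  apply: (@le_lt_trans _ _ (absp k ^+ i)).
    by rewrite -[leRHS]mul1r ler_wpM2r ?exprn_ge0 // ltW.
  by rewrite ltr_eXn2l.
by rewrite (absX H) ltxx.
Qed.

Context (pi : F) (pi_unif : uniformizer absp pi).

Lemma ringO_pi : O pi.
Proof.
have [] := (pi_unif pi).2 _ => //.
by exists 1; [exact: ringO1 | rewrite expr1 mulr1].
Qed.

Lemma nonunit_piO x : O x -> ~ unitO absp x -> exists2 y, O y & x = pi * y.
Proof. by move=> Ox nx; have [y Oy ->] := (pi_unif x).1 (conj Ox nx); exists y; rewrite ?expr1. Qed.

Lemma piO_nonunit y : O y -> ~ unitO absp (pi * y).
Proof. by move=> Oy; have [] := (pi_unif (pi * y)).2 _ => //; exists y; rewrite ?expr1. Qed.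

Lemma pF_neq0 : p%:R != 0 :> F.
Proof. by rewrite -(rmorph_nat (in_alg F)) fmorph_eq0 (pQ_neq0 p_prime H). Qed.

Lemma ringO_nat n : O n%:R.
Proof. by rewrite -(rmorph_nat (in_alg F)); apply: ringO_scalar; apply: (abs_nat H). Qed.

Lemma p_nonunit : ~ unitO absp (p%:R : F).
Proof.
case=> _ _; rewrite -(rmorph_nat (in_alg F)) -fmorphV => /ringO_scalar_le.
rewrite (absV H) ?(pQ_neq0 p_prime H) // invf_le1 ?(abs_p_gt0 p_prime H) //.
by rewrite leNgt (abs_p_lt1 p_prime H).
Qed.

Lemma p_in_piO : exists2 y, O y & p%:R = pi * y.
Proof. exact/nonunit_piO/p_nonunit/ringO_nat. Qed.

Lemma pi_neq0 : pi != 0.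
Proof.
have [y _ e] := p_in_piO; apply/negP => /eqP p0; have := pF_neq0.
by rewrite e p0 mul0r eqxx.
Qed.

Lemma ringO_horner (q : {poly Qp}) x : O x -> (forall i, absp q`_i <= 1) ->
  O (map_poly (in_alg F) q).[x].
Proof.
move=> Ox q1; rewrite horner_coef; apply: ringO_sum => i.
by rewrite coef_map; apply: ringOM; [exact: ringO_scalar | exact: ringOX].
Qed.

(* In a monic equation of pi over Z_p let i be the first index of a unit coefficient:
   the terms of lower degree are divisible by p, the rest is pi^i times a unit. *)
Lemma pi_power_in_pO : exists i y, O y /\ pi ^+ i = p%:R * y.
Proof.
have [q [qm q1 /rootP qpi]] := ringO_pi.
pose P i := absp q`_i == 1.
have exP : exists i, P i.
  by exists (size q).-1; rewrite /P -lead_coefE (monicP qm) (abs1 H).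
case: (ex_minnP exP) => i /eqP qi imin; exists i.
have lt1 j : (j < i)%N -> absp q`_j < 1.
  move=> ji; rewrite lt_neqAle q1 andbT; apply/negP => /imin; lia.
pose T := (p%:R)^-1 *: take_poly i q.
have T1 j : absp T`_j <= 1.
  rewrite coefZ coef_take_poly; case: ltnP => ji; last by rewrite mulr0 (abs0 H).
  by rewrite mulrC; apply: (abs_div_p p_prime H); apply: lt1.
pose D := drop_poly i.+1 q.
have D1 j : absp D`_j <= 1 by rewrite coef_drop_poly.
have eq : q = p%:R *: T + ((q`_i)%:P + D * 'X) * 'X^i.
  rewrite scalerA mulfV ?(pQ_neq0 p_prime H) // scale1r -{1}(poly_take_drop i q).
  congr (_ + _ * _); apply/polyP => j; rewrite coefD coefC coefMX !coef_drop_poly.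
  by case: j => [|j]; rewrite ?addr0 ?add0n //= add0r addSnnS.
pose u := (q`_i)%:A + (map_poly (in_alg F) D).[pi] * pi.
have OD : O (map_poly (in_alg F) D).[pi] by apply: ringO_horner => //; apply: ringO_pi.
have OT : O (map_poly (in_alg F) T).[pi] by apply: ringO_horner => //; apply: ringO_pi.
have Ou : O u by apply: ringOD; [exact/ringO_scalar | apply: ringOM => //; exact: ringO_pi].
have qi0 : q`_i != 0 by apply/negP => /eqP e; move: qi; rewrite e (abs0 H) => /eqP; rewrite eq_sym oner_eq0.
have uu : unitO absp u.
  (* If [u] were a multiple of [pi], so would be the coefficient of index [i], which is a unit. *)
  apply: contrapT => nu; have [y Oy e] := nonunit_piO Ou nu.
  apply: (@piO_nonunit (y - (map_poly (in_alg F) D).[pi])); first by apply: ringOD => //; apply: ringON.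
  have -> : pi * (y - (map_poly (in_alg F) D).[pi]) = (q`_i)%:A.
    by rewrite mulrBr -e /u (mulrC pi) addrK.
  split; first by rewrite scaler_eq0 oner_eq0 orbF.
    exact: ringO_scalar.
  rewrite -[_%:A]/(in_alg F _) -fmorphV; apply: ringO_scalar.
  by rewrite (absV H) // qi invr1.
case: uu => u0 _ OuV.
exists (- ((map_poly (in_alg F) T).[pi] / u)); split.
  by apply: ringON; apply: ringOM.
move: qpi; rewrite {1}eq rmorphD /= map_polyZ !rmorphM rmorphD /= rmorphM /= map_polyC map_polyX map_polyXn.
rewrite !hornerE ?hornerXn /= scaler_nat -/u => /eqP; rewrite addrC addr_eq0 => /eqP e.
by rewrite mulrN mulrA -mulNr -e mulrAC mulfV ?mul1r.
Qed.

(** The constant coefficient of an integral equation for [x] is a multiple of [x]; if it vanishes,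
    the equation can be divided by ['X]. *)
Lemma ringO_const x : O x -> x != 0 ->
  exists c, [/\ c != 0, absp c <= 1 & exists2 y, O y & c%:A = x * y].
Proof.
move=> Ox x0; have [q [qm q1 /rootP qx]] := Ox.
have [n sn] := ubnP (size q); elim: n q qm q1 qx sn => // n IH q qm q1 qx sn.
pose D := drop_poly 1 q.
have D1 j : absp D`_j <= 1 by rewrite coef_drop_poly.
have eq : q = (q`_0)%:P + D * 'X.
  apply/polyP => j; rewrite coefD coefC coefMX coef_drop_poly.
  by case: j => [|j]; rewrite ?addr0 //= add0r addn1.
have [q00|q00] := eqVneq q`_0 0; last first.
  exists q`_0; split=> //; exists (- (map_poly (in_alg F) D).[x]).
    by apply/ringON/ringO_horner.
  move: qx; rewrite {1}eq rmorphD /= rmorphM /= map_polyC map_polyX !hornerE => /eqP.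
  by rewrite addr_eq0 => /eqP /= ->; rewrite mulrN mulrC.
have Dm : D \is monic.
  by move: qm; rewrite {1}eq q00 polyC0 add0r monicMr ?monicX.
apply: (IH D) => //.
  move: qx; rewrite {1}eq q00 polyC0 add0r rmorphM /= map_polyX hornerM hornerX => /eqP.
  by rewrite mulf_eq0 (negPf x0) orbF => /eqP.
have : (size q).-1 = size D.
  by rewrite {1}eq q00 polyC0 add0r size_mulX ?monic_neq0.
by have := monic_neq0 qm; rewrite -size_poly_gt0; lia.
Qed.

(** If every power of [pi] divided [x], every power of [p] would divide the non-zero constant given
    by [ringO_const], because some power of [pi] is a multiple of [p]. *)
Lemma pi_power_bound x : O x -> x != 0 -> exists k, ~ exists2 y, O y & x = pi ^+ k * y.
Proof.
move=> Ox x0; have [c [c0 c1 [y Oy cy]]] := ringO_const Ox x0.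
have [i [z [Oz piz]]] := pi_power_in_pO.
apply: contrapT => h; move/negP: c0; apply; apply/eqP; apply: (abs_small p_prime H) => j.
have [y' Oy' xy'] : exists2 y', O y' & x = pi ^+ (i * j) * y'.
  by apply: contrapT => h'; apply: h; exists (i * j)%N.
have pj : absp (p%:R ^+ j) = absp p%:R ^+ j by rewrite (absX H).
have pj0 : p%:R ^+ j != 0 :> Qp by rewrite expf_neq0 ?(pQ_neq0 p_prime H).
rewrite -pj -[leRHS]mul1r -ler_pdivrMr ?(abs_gt0 H) // -(absV H) // -(abspM H).
apply: ringO_scalar_le; rewrite -[_%:A]/(in_alg F _) fmorph_div rmorphXn rmorph_nat /=.
rewrite cy xy' exprM piz exprMn.
have pFj : p%:R ^+ j != 0 :> F by rewrite expf_neq0 ?pF_neq0.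
rewrite (_ : _ / _ = z ^+ j * y' * y); last by field.
by apply: ringOM => //; apply: ringOM => //; apply: ringOX.
Qed.

Lemma pi_factor x : O x -> x != 0 -> exists k u, unitO absp u /\ x = pi ^+ k * u.
Proof.
move=> Ox x0; have [K nK] := pi_power_bound Ox x0.
pose P k := `[< exists2 y, O y & x = pi ^+ k * y >].
have P0 : exists k, P k by exists 0; apply/asboolP; exists x; rewrite // expr0 mul1r.
have PK k : P k -> (k <= K)%N.
  move=> /asboolP[y Oy e]; rewrite leqNgt; apply/negP => Kk; apply: nK.
  exists (pi ^+ (k - K) * y); first by apply: ringOM => //; apply/ringOX/ringO_pi.
  by rewrite mulrA -exprD subnKC // ltnW.
case: (ex_maxnP P0 PK) => k /asboolP[y Oy e] kmax; exists k, y; split=> //.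
apply: contrapT => ny; have [z Oz ez] := nonunit_piO Oy ny.
have /kmax : P k.+1 by apply/asboolP; exists z; rewrite // exprSr -mulrA -ez.
by rewrite ltnn.
Qed.

(** If [q] is the minimal polynomial, of degree [d], then [p^j x] is a root of the polynomial with
    coefficients [q_i p^(j (d - i))]. For large [j] these are in [Z_p], and the leading one is still
    1. *)
Lemma exists_ringO_mul x : exists j, O (p%:R ^+ j * x).
Proof.
have /polyOver1P[q eq] := minPolyOver 1%AS x.
have qm : q \is monic by rewrite -(map_monic (in_alg F)) -eq monic_minPoly.
have qx : root (map_poly (in_alg F) q) x by rewrite -eq root_minPoly.
have small y : exists j, absp (y * p%:R ^+ j) <= 1.
  apply: contrapT => h; have y0 : y != 0.
    by apply/negP => /eqP y0; apply: h; exists 0; rewrite y0 mul0r (abs0 H).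
  have := invr_neq0 y0 => /eqP; apply; apply: (abs_small p_prime H) => j.
  rewrite -(absX H) leNgt; apply/negP => lt; apply: h; exists j.
  have e1 : absp y * absp y^-1 = 1 by rewrite -(abspM H) mulfV // (abs1 H).
  rewrite (abspM H) -[leRHS]e1 ler_wpM2l ?(absp_ge0 H) //.
  exact: ltW.
have pow j : absp (p%:R ^+ j) <= 1.
  by rewrite (absX H) exprn_ile1 ?(absp_ge0 H) // ltW ?(abs_p_lt1 p_prime H).
have absM1 y z : absp y <= 1 -> absp z <= 1 -> absp (y * z) <= 1.
  by move=> y1 z1; rewrite (abspM H) mulr_ile1 ?(absp_ge0 H).
have [j qj] : exists j, forall i, (i < size q)%N -> absp (q`_i * p%:R ^+ j) <= 1.
  elim: (size q) => [|n [j hj]]; first by exists 0.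
  have [k hk] := small q`_n; exists (j + k)%N => i; rewrite exprD ltnS leq_eqVlt.
  move=> /orP[/eqP->|/hj ij]; last by rewrite mulrA absM1.
  by rewrite mulrCA mulrA [_ ^+ j * _]mulrC -mulrA mulrCA absM1.
pose d := (size q).-1.
have sq : size q = d.+1 by rewrite prednK // lt0n size_poly_eq0 monic_neq0.
have qd : q`_d = 1 by rewrite -lead_coefE (monicP qm).
exists j, (\poly_(i < d.+1) (q`_i * p%:R ^+ (j * (d - i)))); split.
- rewrite monicE lead_coef_poly // subnn muln0 expr0 mulr1 qd //.
  exact: oner_neq0.
- move=> i; rewrite coef_poly; case: ltnP => [|_]; last by rewrite (abs0 H).
  rewrite ltnS leq_eqVlt => /orP[/eqP->|id].
    by rewrite subnn muln0 expr0 mulr1 qd (abs1 H).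
  rewrite -(subnSK id) mulnS exprD mulrA absM1 // qj // sq ltnW //.
apply/rootP; rewrite (@horner_coef_wide _ d.+1); last first.
  by rewrite size_map_poly size_poly.
move/rootP: qx; rewrite horner_coef size_map_poly sq => qx.
transitivity ((p%:R ^+ (j * d)) * \sum_(i < d.+1) (map_poly (in_alg F) q)`_i * x ^+ i).
  rewrite mulr_sumr; apply: eq_bigr => i _; rewrite !coef_map coef_poly ltn_ord /=.
  rewrite -![_%:A]/(in_alg F _) rmorphM rmorphXn rmorph_nat exprMn -exprM.
  have -> : (p%:R : F) ^+ (j * d) = p%:R ^+ (j * (d - i)) * p%:R ^+ (j * i).
    by rewrite -exprD -mulnDr subnK // -ltnS.
  by ring.
by rewrite qx mulr0.
Qed.

End LocalField.

(** * Construction of the discrete valuation *)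

Section Valuation.
Context (p : nat) (p_prime : prime p) (Qp : fieldType) (absp : Qp -> rat).
Context (H : is_padic_field p absp) (F : fieldExtType Qp).
Context (pi : F) (pi_unif : uniformizer absp pi).
Notation O := (@ringO Qp absp F).
Notation U := (@unitO Qp absp F).

Let pi0 : pi != 0 := pi_neq0 p_prime H pi_unif.

Lemma unitOM x y : U x -> U y -> U (x * y).
Proof.
move=> [x0 Ox Ox'] [y0 Oy Oy']; split; first by rewrite mulf_neq0.
  exact: (ringOM H).
by rewrite invfM; apply: (ringOM H).
Qed.

Lemma unitOV x : U x -> U x^-1.
Proof. by move=> [x0 Ox Ox']; split; rewrite ?invr_neq0 ?invrK. Qed.

Lemma pi_int_factor x : x != 0 -> exists k : int, U (x / pi ^ k).
Proof.
move=> x0; have [j Oj] := exists_ringO_mul p_prime H x.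
have pj0 : p%:R ^+ j != 0 :> F by rewrite expf_neq0 ?(pF_neq0 p_prime H).
have Op : O (p%:R ^+ j) by apply: (ringOX H); apply: (ringO_nat H).
have [a [u [Uu eu]]] := pi_factor p_prime H pi_unif Oj (mulf_neq0 pj0 x0).
have [b [w [Uw ew]]] := pi_factor p_prime H pi_unif Op pj0.
exists (a%:Z - b%:Z); rewrite (_ : x / _ = u / w); first by apply/unitOM/unitOV.
have w0 : w != 0 by case: Uw.
have pa0 : pi ^+ a != 0 by rewrite expf_neq0.
have pb0 : pi ^+ b != 0 by rewrite expf_neq0.
have -> : x = pi ^+ a * u / (pi ^+ b * w) by rewrite -eu -ew mulrC mulKf.
rewrite expfzDr // -exprnP -invr_expz -exprnP.
by field; rewrite pa0 pb0 w0.
Qed.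

Definition ord_pi (x : F) : int :=
  if pselect (x != 0) is left x0 then projT1 (cid (pi_int_factor x0)) else 0.

Lemma ord_piP x : x != 0 -> U (x / pi ^ ord_pi x).
Proof. by move=> x0; rewrite /ord_pi; case: pselect => // h; case: cid. Qed.

Lemma ringO_piz (k : int) : 0 <= k -> O (pi ^ k).
Proof. by case: k => // k _; rewrite -exprnP; apply: (ringOX H); apply: (ringO_pi H pi_unif). Qed.

Lemma unitO_piz (k : int) u : U u -> U (u * pi ^ k) -> k <= 0.
Proof.
move=> Uu Uk; rewrite leNgt; apply/negP => k0.
have : U (pi * (pi ^ (k - 1))).
  rewrite -{1}(expr1z pi) -expfzDr // addrC subrK.
  have [u0 _ _] := Uu; have := unitOM (unitOV Uu) Uk; by rewrite mulKf.
by apply: piO_nonunit => //; apply: ringO_piz; rewrite subr_ge0.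
Qed.

Lemma val_unique x k : x != 0 -> U (x / pi ^ k) -> ord_pi x = k.
Proof.
move=> x0 Uk; have Uv := ord_piP x0.
have h (a b : int) : U (x / pi ^ a) -> U (x / pi ^ b) -> a <= b.
  move=> Ua Ub; rewrite -subr_le0; apply: (unitO_piz Ua).
  suff -> : x / pi ^ a * pi ^ (a - b) = x / pi ^ b by [].
  by rewrite expfzDr // mulrA divfK ?expfz_neq0 // invr_expz.
by apply/eqP; rewrite eq_le !h.
Qed.

Lemma ringO_val x : O x <-> vge ord_pi 0 x.
Proof.
have [->|x0] := eqVneq x 0; first by split=> _; [exact: vge0 | exact: (ringO0 H)].
have Uv := ord_piP x0; have pv0 : pi ^ ord_pi x != 0 by rewrite expfz_neq0.
rewrite vgeE //; split=> [Ox|v0]; last first.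
  by rewrite -(divfK pv0 x); case: Uv => _ Oq _; apply: (ringOM H) => //; apply: ringO_piz.
rewrite leNgt; apply/negP => v0.
have : U (pi * (x * pi ^ (- ord_pi x - 1))).
  rewrite mulrCA -{1}(expr1z pi) -expfzDr // (_ : 1 + _ = - ord_pi x); last by lia.
  by rewrite -invr_expz.
apply: piO_nonunit => //; apply: (ringOM H) => //; apply: ringO_piz; lia.
Qed.

Lemma val_valuation : valuation_at ord_pi pi.
Proof.
split.
- exact: pi0.
- by apply: val_unique; rewrite // expr1z mulfV //; split;
    rewrite ?invr1 ?oner_neq0 //; apply: (ringO1 H).
- move=> x y x0 y0; apply: val_unique; first by rewrite mulf_neq0.
  by rewrite expfzDr // invfM mulrACA; apply: unitOM; apply: ord_piP.
- move=> x y x0 y0 xy0; apply/orP.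
  wlog le : x y x0 y0 xy0 / ord_pi x <= ord_pi y.
    move=> W; have [xy|yx] := leP (ord_pi x) (ord_pi y); first exact: W.
    by rewrite addrC in xy0 *; case: (W y x y0 x0 xy0 (ltW yx)) => h; [right|left].
  left.
  have pv k : pi ^ k != 0 by rewrite expfz_neq0.
  have Oxy : O ((x + y) / pi ^ ord_pi x).
    rewrite mulrDl; apply: (ringOD H); first by case: (ord_piP x0).
    have -> : y / pi ^ ord_pi x = y / pi ^ ord_pi y * pi ^ (ord_pi y - ord_pi x).
      by rewrite expfzDr // mulrA divfK ?pv // invr_expz.
    apply: (ringOM H); first by case: (ord_piP y0).
    by apply: ringO_piz; rewrite subr_ge0.
  have q0 : (x + y) / pi ^ ord_pi x != 0 by rewrite mulf_neq0 ?invr_neq0.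
  have : 0 <= ord_pi ((x + y) / pi ^ ord_pi x) by rewrite -vgeE //; apply/ringO_val.
  suff -> : ord_pi ((x + y) / pi ^ ord_pi x) = ord_pi (x + y) - ord_pi x by rewrite subr_ge0.
  apply: val_unique => //; rewrite expfzDr // -invr_expz invfM invrK.
  by rewrite mulrACA mulVf // mulr1; apply: ord_piP.
Qed.

Lemma unitO_val x : U x <-> vunit ord_pi x.
Proof.
split=> [Ux|/andP[x0 /eqP vx]].
  have [x0 _ _] := Ux; apply/andP; split=> //; apply/eqP; apply: val_unique => //.
  by rewrite expr0z divr1.
by have := ord_piP x0; rewrite vx expr0z divr1.
Qed.

Lemma piO_val n x : piO absp pi n x <-> vge ord_pi n%:Z x.
Proof.
have Hv := val_valuation.
have pn0 : pi ^+ n != 0 by rewrite expf_neq0.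
split=> [[y /ringO_val Oy ->]|xn].
  by have := vgeM Hv (vge_piX Hv n) Oy; rewrite addr0.
exists (x / pi ^+ n); last by rewrite mulrC divfK.
apply/ringO_val; apply: vge_le (vge_div Hv pn0 xn).
by rewrite (val_piX Hv) subrr.
Qed.

End Valuation.

(** * Finiteness of the residue field *)

Section Residues.
Context (p : nat) (p_prime : prime p) (Qp : fieldType) (absp : Qp -> rat).
Context (H : is_padic_field p absp) (F : fieldExtType Qp).
Context (pi : F) (pi_unif : uniformizer absp pi).
Notation O := (@ringO Qp absp F).
Notation ord_pi := (ord_pi p_prime H pi_unif).

Let Hv : valuation_at ord_pi pi := val_valuation p_prime H pi_unif.

Lemma p_vge1 : vge ord_pi 1 (p%:R : F).
Proof.
have [y Oy ->] := p_in_piO p_prime H pi_unif.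
by apply: (vge1M Hv); [exact: (vge_pi Hv) | apply/ringO_val].
Qed.

Lemma scalar_vge1 k : absp k < 1 -> vge ord_pi 1 (k%:A : F).
Proof.
move=> k1; have pA : (p%:R : F) != 0 := pF_neq0 p_prime H F.
rewrite (_ : k%:A = p%:R * (k / p%:R)%:A).
  apply: (vge1M Hv); first exact: p_vge1.
  by apply/ringO_val; apply: (ringO_scalar H); apply: (abs_div_p p_prime H).
by rewrite -![_%:A]/(in_alg F _) fmorph_div rmorph_nat mulrC divfK.
Qed.

(** Linear independence over the field with [p] elements of the images in the residue field, with
    digits below [p] as scalars, so that no quotient has to be formed. *)
Definition indep (r : nat) (e : 'I_r -> F) : Prop :=
  (forall i, O (e i)) /\
  forall c : 'I_r -> nat, (forall i, (c i < p)%N) ->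
    vge ord_pi 1 (\sum_i (c i)%:R * e i) -> forall i, c i = 0%N.

(** More than [[F : Qp]] elements satisfy a linear relation over [Qp]. Divided by a coefficient of
    largest absolute value it is integral with one coefficient equal to 1, and its reduction
    contradicts independence. *)
Lemma indep_bound r (e : 'I_r -> F) : indep e -> (r <= \dim {:F})%N.
Proof.
move=> [Oe ie]; rewrite leqNgt; apply/negP => rd.
pose X := [tuple e i | i < r].
have Xe (i : 'I_r) : X`_i = e i by rewrite -tnth_nth tnth_mktuple.
have nX : ~~ free X.
  apply/negP; rewrite /free size_tuple => /eqP dX.
  by have := dimvS (subvf <<X>>%VS); rewrite dX leqNgt rd.
have [k [sum0 [i1 ki1]]] : exists k : 'I_r -> Qp,
    \sum_i k i *: e i = 0 /\ exists i, k i != 0.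
  apply: contrapT => h; move/negP: nX; apply; apply/freeP => k k0 i.
  apply/eqP; apply: contrapT => /negP ki; apply: h; exists k; split; last by exists i.
  by rewrite -[RHS]k0; apply: eq_bigr => j _; rewrite Xe.
have [i0 _ imax] := @arg_maxP _ _ _ i1 predT (fun i => absp (k i)) isT.
have ki0 : k i0 != 0.
  apply/negP => /eqP e0; have /= := imax i1 isT; rewrite e0 (abs0 H) => h.
  by have := lt_le_trans (abs_gt0 H ki1) h; rewrite ltxx.
pose k' i := k i / k i0.
have k'1 i : absp (k' i) <= 1.
  by rewrite (abspM H) (absV H) // ler_pdivrMr ?(abs_gt0 H) // mul1r; apply: imax.
have cP i : exists c, (c < p)%N /\ absp (k' i - c%:R) < 1.
  by have [c c1 c2] := abs_residue p_prime H (k'1 i); exists c.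
pose c i := projT1 (cid (cP i)).
have cp i : (c i < p)%N by rewrite /c; case: cid => x [].
have ck i : absp (k' i - (c i)%:R) < 1 by rewrite /c; case: cid => x [].
have s0 : \sum_i (k' i)%:A * e i = 0.
  have := congr1 (fun z => (k i0)^-1 *: z) sum0; rewrite scaler0 scaler_sumr => E.
  by rewrite -[RHS]E; apply: eq_bigr => i _; rewrite scalerA mulr_algl mulrC.
have : vge ord_pi 1 (\sum_i (c i)%:R * e i).
  have -> : \sum_i (c i)%:R * e i = - \sum_i ((k' i - (c i)%:R)%:A * e i).
    under [in RHS]eq_bigr => i _ do rewrite scalerBl mulrBl scaler_nat.
    by rewrite sumrB s0 sub0r opprK.
  rewrite (vgeN Hv); elim/big_rec: _ => [|i y _ yv]; first exact: vge0.
  apply: (vgeD Hv) => //; apply: (vge1M Hv); first exact: scalar_vge1.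
  exact/ringO_val.
move=> /(ie c cp) /(_ i0) c0; have := ck i0.
by rewrite c0 /k' mulfV // subr0 (abs1 H) ltxx.
Qed.

Lemma nat_mod_vge n : vge ord_pi 1 (n%:R - (n %% p)%:R : F).
Proof.
rewrite {1}(divn_eq n p) natrD addrK natrM mulrC; apply: (vge1M Hv); first exact: p_vge1.
exact/ringO_val/(ringO_nat H).
Qed.

(** An independent family of maximal size spans the residue field: adding [x] creates a relation in
    which the coefficient of [x] is invertible modulo [p]. The finitely many combinations thus cover
    [O], and [exists_reps] thins them out. *)
Lemma exists_residues : exists R : seq F, residues ord_pi R.
Proof.
pose P r := `[< exists e : 'I_r -> F, indep e >].
have P0 : exists r, P r.
  by exists 0; apply/asboolP; exists (fun=> 0); split=> [[]|c _ _ []].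
have Pb r : P r -> (r <= \dim {:F})%N by move=> /asboolP[e /indep_bound].
case: (ex_maxnP P0 Pb) => r /asboolP[e [Oe ie]] rmax.
pose L := [seq \sum_i (c i : 'I_p)%:R * e i | c : {ffun 'I_r -> 'I_p}].
suff cov x : vge ord_pi 0 x -> exists2 t, t \in L & vge ord_pi 1 (x - t).
  have [||S [uS SP cS iS]] := @exists_reps _ (fun x => vge ord_pi 0 x)
     (fun x y => vge ord_pi 1 (x - y)) L _ _ cov.
  - by move=> x y; rewrite -opprB (vgeN Hv).
  - by move=> x y z h1 h2; have := vgeD Hv h1 h2; rewrite addrA subrK.
  by exists S; split.
move=> /ringO_val Ox; pose e' (i : 'I_r.+1) := if unlift ord0 i is Some j then e j else x.
have e'0 : e' ord0 = x by rewrite /e' unlift_none.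
have e'S j : e' (lift ord0 j) = e j by rewrite /e' liftK.
have Oe' i : O (e' i) by rewrite /e'; case: unlift.
have : ~ indep e'.
  by move=> ind; have /rmax : P r.+1 by [apply/asboolP; exists e']; rewrite ltnn.
move=> nind.
have [c [cp cv [i ci]]] : exists c : 'I_r.+1 -> nat, [/\ forall i, (c i < p)%N,
    vge ord_pi 1 (\sum_i (c i)%:R * e' i) & exists i, c i <> 0%N].
  apply: contrapT => h; apply: nind; split=> // c cp cv i; apply: contrapT => ci.
  by apply: h; exists c; split=> //; exists i.
move: cv; rewrite big_ord_recl e'0; under eq_bigr => j _ do rewrite e'S.
move=> cv.
have c0 : c ord0 != 0%N.
  apply/eqP => c00; move: cv; rewrite c00 mul0r add0r => cv.
  have z := ie (fun j => c (lift ord0 j)) (fun j => cp _) cv.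
  by case: (unliftP ord0 i) ci => [j ->|->].
have co : coprime (c ord0) p.
  rewrite coprime_sym prime_coprime //; apply/negP => /dvdn_leq.
  by rewrite lt0n c0 leqNgt cp => /(_ isT).
have [b hb] : exists b, (c ord0 * b = 1 %[mod p])%N.
  have c00 : (0 < c ord0)%N by rewrite lt0n.
  have [b d] := egcdnP p c00; rewrite (eqP co) => hb _.
  by exists b; rewrite mulnC hb modnMDl.
(* [p - b %% p] stands for [-b] among the natural numbers, so [c' j] is the coefficient obtained by
   solving the relation for [x]. *)
pose c' j := ((p - b %% p) * c (lift ord0 j))%N.
have p0 := prime_gt0 p_prime.
have cc' j : (p %| c' j %% p + b * c (lift ord0 j))%N.
  rewrite /dvdn modnDml /c' -mulnDl {2}(divn_eq b p) addnCA -/(dvdn _ _).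
  rewrite dvdn_mulr // dvdn_add ?dvdn_mull //.
  by rewrite subnK // ltnW // ltn_pmod.
exists (\sum_j (c' j %% p)%N%:R * e j).
  rewrite /L; apply/mapP; exists [ffun j => Ordinal (ltn_pmod (c' j) p0)]; rewrite ?mem_enum //.
  by apply: eq_bigr => j _; rewrite ffunE.
have vdvd k : (p %| k)%N -> vge ord_pi 1 (k%:R : F).
  by move=> /dvdnP[q ->]; rewrite natrM mulrC (vge1M Hv) ?p_vge1 //; apply/ringO_val/(ringO_nat H).
have -> : x - \sum_j (c' j %% p)%N%:R * e j =
    (1 - (c ord0 * b)%N%:R) * x + b%:R * ((c ord0)%:R * x + \sum_j (c (lift ord0 j))%:R * e j)
      - \sum_j (c' j %% p + b * c (lift ord0 j))%N%:R * e j.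
  under [X in _ = _ - X]eq_bigr => j _ do rewrite natrD natrM mulrDl -mulrA.
  by rewrite big_split /= -mulr_sumr natrM; ring.
apply: (vgeB Hv); first apply: (vgeD Hv).
- apply: (vge1M Hv); last exact/ringO_val.
  have := nat_mod_vge (c ord0 * b); rewrite hb modn_small ?prime_gt1 //.
  by rewrite -(vgeN Hv) opprB.
- by rewrite mulrC; apply: (vge1M Hv) => //; apply/ringO_val/(ringO_nat H).
elim/big_rec: _ => [|j y _ yv]; first exact: vge0.
by apply: (vgeD Hv) => //; apply: (vge1M Hv); [exact: vdvd | exact/ringO_val].
Qed.

End Residues.

(** * From the stated groups and representations to valuations *)

Section Translation.
Context (p : nat) (p_prime : prime p) (Qp : fieldType) (absp : Qp -> rat).
Context (H : is_padic_field p absp) (F : fieldExtType Qp).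
Context (pi : F) (pi_unif : uniformizer absp pi).
Notation ord_pi := (ord_pi p_prime H pi_unif).
Implicit Types (g h k : 'M[F]_2).

Let Hv : valuation_at ord_pi pi := val_valuation p_prime H pi_unif.

Lemma maxK_levelI g : maxK absp g <-> levelI ord_pi 0 g.
Proof.
split=> [[gO gd]|/andP[/and4P[g1 g2 g3 g4] gd]].
  apply/andP; split; last exact/unitO_val.
  by apply/and4P; split; apply/ringO_val.
split; last exact/(unitO_val p_prime H pi_unif).
move=> i j; apply/(ringO_val p_prime H pi_unif).
by case: i j => [[|[|//]] hi] [[|[|//]] hj];
  [move: g1 | move: g2 | move: g3 | move: g4]; congr (vge _ _ (g _ _)); apply: val_inj.
Qed.

Lemma congI_levelI n g : congI absp pi n g <-> levelI ord_pi n g.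
Proof.
case: n => [|n]; first exact: maxK_levelI.
split=> [[g1 g2 g3 g4]|gn].
  have u1 := (unitO_val p_prime H pi_unif _).1 g1.
  have u4 := (unitO_val p_prime H pi_unif _).1 g4.
  have v2 := (ringO_val p_prime H pi_unif _).1 g2.
  have v3 := (piO_val p_prime H pi_unif _ _).1 g3.
  apply/andP; split; first by apply/and4P; split=> //; apply: vunit_vge.
  rewrite det2; have u14 := vunitM Hv u1 u4.
  have [u0 /eqP v0] := andP u14.
  have [|h1 h2] := @vge_valD _ _ _ Hv (g 0 0 * g 1 1) (- (g 0 1 * g 1 0)) u0.
    rewrite v0 add0r (vgeN Hv) mulrC; apply: (vge1M Hv) => //.
    by apply: vge_le v3; rewrite lez_nat.
  by rewrite /vunit h1 h2 v0.
have [u1 u4] := levelI_diag_units Hv (ltn0Sn n) gn.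
case/andP: gn => /and4P[_ g2 g3 _] _.
split; [exact/(unitO_val p_prime H pi_unif) | exact/(ringO_val p_prime H pi_unif) |
  exact/(piO_val p_prime H pi_unif) | exact/(unitO_val p_prime H pi_unif)].
Qed.

Lemma open_subgroup_levelI n : open_subgroup absp pi [set g | levelI ord_pi n g]%classic.
Proof.
split=> /=.
- by move=> g; apply: levelI_unit.
- exact: (levelI1 Hv).
- by move=> g h; apply: (levelIM Hv).
- by move=> g; apply: (levelIV Hv).
move=> g gn; exists n.+1 => h hg; apply: (cong_levelI Hv (ltn0Sn 0) gn).
have e i j : vge ord_pi n.+1 (g i j - h i j).
  by rewrite -opprB (vgeN Hv); apply/(piO_val p_prime H pi_unif).
have e1 i j : vge ord_pi 1 (g i j - h i j) by apply: vge_le (e i j); rewrite lez_nat.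
by rewrite /cong /eichler !mxE !e1 /= andbT; apply: vge_le (e _ _).
Qed.

Section Rep.
Context (C : numFieldType) (V : rep F C).

Lemma smooth_translate : smooth absp pi V -> val_smooth ord_pi V.
Proof.
move=> sm u; have [|m hm] := sm u 1%:M; first by split; rewrite ?unitmx1 ?act1.
exists m => h hh; have [] // : (h \in unitmx /\ act V h u = u).
by apply: hm => i j; apply/(piO_val p_prime H pi_unif).
Qed.

Lemma level_fixed_finite n : admissible absp pi V ->
  finite_dim (fun u : V => level_fixed ord_pi n u).
Proof. by case=> _ /(_ _ (open_subgroup_levelI n)). Qed.

Lemma fixI_level0 (w : F -> C) (u : V) : fixI absp pi w 0 u <-> level_fixed ord_pi 0 u.
Proof. by split=> h g /maxK_levelI; apply: h. Qed.

Lemma fixI_level (w : F -> C) n (u : V) : (forall z, vunit ord_pi z -> w z = 1) ->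
  fixI absp pi w n u <-> level_fixed ord_pi n u.
Proof.
move=> w1; case: n => [|n]; first exact: fixI_level0.
split=> [h g gn|h g /(congI_levelI n.+1) gn].
  have [_ u4] := levelI_diag_units Hv (ltn0Sn n) gn.
  by rewrite (h g) ?w1 ?scale1r //; apply/congI_levelI.
have [_ u4] := levelI_diag_units Hv (ltn0Sn n) gn.
by rewrite h // w1 // scale1r.
Qed.

(** A unit scalar matrix lies in [K], so it fixes [u] and also multiplies it by [w z]. *)
Lemma unramified_central (w : F -> C) (u : V) : central_character V w ->
  level_fixed ord_pi 0 u -> u != 0 -> forall z, vunit ord_pi z -> w z = 1.
Proof.
move=> cc u0 un z uz; have z0 := vunit_neq0 uz.
have zK : levelI ord_pi 0 z%:M.
  by rewrite -M2_scalar levelI_M2 !vge0 (vunit_vge uz) mul0r subr0 (vunitM Hv).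
have := cc z z0 u; rewrite u0 // => /esym/eqP.
rewrite -subr_eq0 -{2}[u]scale1r -scalerBl scaler_eq0 (negPf un) orbF subr_eq0.
by move/eqP.
Qed.

Lemma conductor_unique (w : F -> C) m n : conductor absp pi V w m ->
  conductor absp pi V w n -> m = n.
Proof. by move=> [am mm] [an nn]; apply/eqP; rewrite eqn_leq mm ?nn. Qed.

End Rep.

Lemma gamma_Gm n : gamma pi ^+ n = Gm pi n.
Proof.
have pi0 := val_pi_neq0 Hv.
elim: n => [|n IH]; first by rewrite expr0 Gm0.
rewrite exprSr IH /Gm -mulmxE (_ : gamma pi = M2 pi^-1 0 0 1) ?M2_mul.
  by rewrite exprSr; apply: M2_inj; rewrite ?invfM; ring.
apply/matrixP => i j; rewrite !mxE.
by case: i j => [[|[|//]] ?] [[|[|//]] ?].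
Qed.

End Translation.

Theorem theorem5 (R : realType)
    (p : nat) (p_prime : prime p)
    (Qp : fieldType) (absp : Qp -> rat) (Qp_padic : is_padic_field p absp)
    (F : fieldExtType Qp) (pi : F) (pi_unif : uniformizer absp pi)
    (V1 V2 V3 : rep F R[i]) (w1 w2 w3 : F -> R[i])
    (V1_irr : irreducible_rep V1) (V1_adm : admissible absp pi V1)
    (V1_inf : infinite_dim V1) (V1_cc : central_character V1 w1)
    (V2_irr : irreducible_rep V2) (V2_adm : admissible absp pi V2)
    (V2_inf : infinite_dim V2) (V2_cc : central_character V2 w2)
    (V3_irr : irreducible_rep V3) (V3_adm : admissible absp pi V3)
    (V3_inf : infinite_dim V3) (V3_cc : central_character V3 w3)
    (w123 : forall z : F, z != 0 -> w1 z * w2 z * w3 z = 1)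
    (V1_unr : unramified absp pi V1 w1) (V2_unr : unramified absp pi V2 w2)
    (n3 : nat) (V3_cond : conductor absp pi V3 w3 n3)
    (v1 : V1) (v2 : V2) (v3 : V3)
    (v1_new : new_vector absp pi w1 v1) (v2_new : new_vector absp pi w2 v2)
    (v3_new : new_vector absp pi w3 v3)
    (T : tensor3 V1 V2 V3) (l : {linear tensor_rep T -> R[i]^o})
    (l_inv : invariant_form l) (l_neq0 : exists t, l t != 0) :
  l (tens T (act V1 (gamma pi ^+ n3) v1) v2 v3) != 0.
Proof.
have Hv := val_valuation p_prime Qp_padic pi_unif.
have [S HS] := exists_residues p_prime Qp_padic pi_unif.
have [m1 [c1 f1 n1]] := v1_new; rewrite {m1 c1}(conductor_unique c1 V1_unr) in f1.
have [m2 [c2 f2 n2]] := v2_new; rewrite {m2 c2}(conductor_unique c2 V2_unr) in f2.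
have [m3 [c3 f3 nz3]] := v3_new; rewrite {m3 c3}(conductor_unique c3 V3_cond) in f3.
move: f1 f2 => /(fixI_level0 p_prime Qp_padic pi_unif) f1 /(fixI_level0 p_prime Qp_padic pi_unif) f2.
(* The relation between the central characters makes [w3] trivial on units, which turns the
   condition of [fixI] into plain invariance under [I_n]. *)
have u3 z : vunit (ord_pi p_prime Qp_padic pi_unif) z -> w3 z = 1.
  move=> uz; have := w123 z (vunit_neq0 uz).
  by rewrite (unramified_central V1_cc f1 n1 uz) (unramified_central V2_cc f2 n2 uz) !mul1r.
move: f3 => /(fixI_level _ _ u3) f3.
have old m : (m < n3)%N -> forall u : V3,
    level_fixed (ord_pi p_prime Qp_padic pi_unif) m u -> u = 0.
  move=> mn u um; apply/eqP; apply: contraLR mn => u0; rewrite -leqNgt.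
  by apply: V3_cond.2; exists u => //; apply/(fixI_level _ _ u3).
have [t1 t2 t3] := tens_trilinear T.
pose L x y z := l (tens T x y z).
have Ltri : trilinear (L : V1 -> V2 -> V3 -> R[i]^o).
  by split=> [y z|x z|x y] a u w; rewrite /L (t1, t2, t3) linearP.
have Linv g : g \in unitmx -> forall x y z,
    L (act V1 g x) (act V2 g y) (act V3 g z) = L x y z.
  by move=> ug x y z; rewrite /L -tens_actE; apply: (l_inv g ug).
apply/negP => /eqP; rewrite (gamma_Gm p_prime Qp_padic pi_unif) => L0.
have [t] := l_neq0; suff -> : l t = 0 by rewrite eqxx.
(* A linear form on the tensor product is determined by its values on pure tensors. *)
apply: (@tens_ext _ V1 V2 V3 T _ (l : {linear T -> R[i]^o}) (\0 : {linear T -> R[i]^o})) => x y z.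
apply: (test_vector Hv HS (L := L) (w1 := w1) (w2 := w2) (n := n3) (v1 := v1) (v2 := v2) (v3 := v3)) => //.
- exact: smooth_translate V1_adm.1.
- exact: smooth_translate V2_adm.1.
- exact: smooth_translate V3_adm.1.
- by move=> n; apply: level_fixed_finite.
- by move=> n; apply: level_fixed_finite.
- by move=> n; apply: level_fixed_finite.
Qed.
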